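(* Let $N\ge1$, $0<b<\min\{2,N\}$ and $\sigma=(2-b)/N$. Let $\psi\in H^1(\mathbb{R}^N,\mathbb{R})$ be the ground state (i.e. the unique positive radial solution) of $$\Delta u-u+|x|^{-b}|u|^{2\sigma}u=0\quad\text{on }\mathbb{R}^N .$$ Then there exists a solution $\varphi$ of $$i\partial_t\varphi+\Delta\varphi+|x|^{-b}|\varphi|^{2\sigma}\varphi=0$$ with critical mass, i.e. $\|\varphi(t)\|_{L^2}=\|\psi\|_{L^2}$, that blows up in finite time: there is $T\in(0,\infty)$ such that $\varphi\in C([0,T),H^1(\mathbb{R}^N,\mathbb{C}))$ and $\|\varphi(t)\|_{H^1}\to\infty$ as $t\uparrow T$.
   Context: Solutions of the evolution equation are strong solutions in $C([0,T),H^1(\mathbb{R}^N,\mathbb{C}))$; their $L^2$ norm $\|\varphi(t)\|_{L^2}$ is independent of $t$. It is known that the stationary equation in the claim has exactly one positive radial solution in $H^1(\mathbb{R}^N,\mathbb{R})$ (solutions understood in the weak sense), called its ground state; the number $\|\psi\|_{L^2}$ is called the critical mass. *)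

(* Defs.v *)
From HB Require Import structures.
From mathcomp Require Import all_boot all_order all_algebra.
From mathcomp Require Import all_classical all_reals all_analysis.
From mathcomp Require Import complex.

Set Implicit Arguments.
Unset Strict Implicit.
Unset Printing Implicit Defensive.

Import Order.TTheory GRing.Theory Num.Theory.
Import numFieldNormedType.Exports.

Local Open Scope classical_set_scope.
Local Open Scope ring_scope.

Section measurable_row.
Context {d} {T : sigmaRingType d}.
Variable n : nat.

Let coors : 'I_n -> 'rV[T]_n -> T := fun i x => x ord0 i.

Let row_set0 : g_sigma_preimage coors set0.
Proof. exact: sigma_algebra0. Qed.

Let row_setC A : g_sigma_preimage coors A -> g_sigma_preimage coors (~` A).
Proof. exact: sigma_algebraC. Qed.

Let row_bigcup (F : _^nat) : (forall i, g_sigma_preimage coors (F i)) ->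
  g_sigma_preimage coors (\bigcup_i (F i)).
Proof. exact: sigma_algebra_bigcup. Qed.

HB.instance Definition _ := @isMeasurable.Build (measure_tuple_display d)
  'rV[T]_n (g_sigma_preimage coors) row_set0 row_setC row_bigcup.

End measurable_row.

Lemma measurable_coord d (T : sigmaRingType d) n (i : 'I_n) :
  measurable_fun [set: 'rV[T]_n] (fun v => v ord0 i).
Proof.
move=> _ Y mY; rewrite setTI; apply: sub_sigma_algebra => /=.
rewrite -bigcup_seq/=; exists i => /=; first by rewrite mem_index_enum.
by exists Y => //; rewrite setTI.
Qed.

Lemma measurable_fun_coordP d1 d2 (T1 : measurableType d1)
    (T2 : measurableType d2) n (f : T1 -> 'rV[T2]_n) :
  measurable_fun [set: T1] f <->
  forall i, measurable_fun [set: T1] (fun x => f x ord0 i).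
Proof.
split=> [mf i|mf].
  exact: (measurableT_comp (measurable_coord i) mf).
move=> _ A mA; rewrite setTI.
suff: g_sigma_preimage (fun i (x : T1) => f x ord0 i) `<=` measurable.
  apply.
  by rewrite (g_sigma_preimage_comp (fun i (v : 'rV[T2]_n) => v ord0 i) f);
    exists A => //; rewrite setTI.
apply: smallest_sub; first exact: sigma_algebra_measurable.
case: n => [|n] in f mf A mA *; first by rewrite big_ord0.
rewrite -bigcup_mkord_ord; apply: bigcup_sub => i Ii.
by move=> B [C mC <-]; exact: mf.
Qed.

Section lebesgue_rV.
Context {R : realType}.

Definition cons_row n (z : measurableTypeR R * 'rV[R]_n) : 'rV[R]_n.+1 :=
  \row_(j < n.+1) (if unlift ord0 j is Some k then z.2 ord0 k else z.1).

Definition uncons_row n (v : 'rV[R]_n.+1) : measurableTypeR R * 'rV[R]_n :=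
  (v ord0 ord0, \row_(j < n) v ord0 (lift ord0 j)).

Lemma cons_row0 n z : cons_row z ord0 (@ord0 n) = z.1.
Proof. by rewrite mxE unlift_none. Qed.

Lemma cons_rowS n z (j : 'I_n) : cons_row z ord0 (lift ord0 j) = z.2 ord0 j.
Proof. by rewrite mxE liftK. Qed.

Lemma cons_rowK n : cancel (@cons_row n) (@uncons_row n).
Proof.
case=> x v; rewrite /uncons_row cons_row0; congr pair.
by apply/rowP => j; rewrite mxE cons_rowS.
Qed.

Lemma measurable_cons_row n : measurable_fun setT (@cons_row n).
Proof.
apply/measurable_fun_coordP => i; case: (unliftP ord0 i) => [j|] ->.
  under eq_fun do rewrite cons_rowS.
  exact: (measurableT_comp (measurable_coord j) measurable_snd).
under eq_fun do rewrite cons_row0.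
exact: measurable_fst.
Qed.

Lemma measurable_uncons_row n : measurable_fun setT (@uncons_row n).
Proof.
apply: measurable_fun_pair; first exact: (measurable_coord ord0).
apply/measurable_fun_coordP => i; under eq_fun do rewrite mxE.
exact: (measurable_coord (lift ord0 i)).
Qed.

Section step.
Variables (n : nat) (mu : {sigma_finite_measure set 'rV[R]_n -> \bar R}).

Definition lebesgue_cons : set 'rV[R]_n.+1 -> \bar R :=
  pushforward (@lebesgue_measure R \x mu)%E (@cons_row n).

Let prodm : {measure set (measurableTypeR R * 'rV[R]_n)%type -> \bar R} :=
  (@lebesgue_measure R \x mu)%E.

Let lebesgue_cons0 : lebesgue_cons set0 = 0%E.
Proof. by rewrite /lebesgue_cons /pushforward preimage_set0 (measure0 prodm). Qed.

Let lebesgue_cons_ge0 A : (0 <= lebesgue_cons A)%E.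
Proof. exact: (measure_ge0 prodm). Qed.

Let lebesgue_cons_sigma_additive : semi_sigma_additive lebesgue_cons.
Proof.
move=> F mF tF mUF; rewrite /lebesgue_cons /pushforward preimage_bigcup.
have mcons A : measurable A -> measurable (@cons_row n @^-1` A).
  by move=> mA; rewrite -[X in measurable X]setTI; exact: measurable_cons_row.
apply: (@measure_semi_sigma_additive _ _ _ prodm).
- by move=> k; exact: mcons.
- apply/trivIsetP => /= i j _ _ ij; rewrite -preimage_setI.
  by move/trivIsetP : tF => /(_ _ _ _ _ ij) ->//; rewrite preimage_set0.
- by rewrite -preimage_bigcup; exact: mcons.
Qed.

HB.instance Definition _ := isMeasure.Build _ _ _ lebesgue_cons
  lebesgue_cons0 lebesgue_cons_ge0 lebesgue_cons_sigma_additive.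

Let lebesgue_cons_sigma_finite : sigma_finite setT lebesgue_cons.
Proof.
have /sigma_finiteP[F [TF ndF Foo]] := sigma_finiteT (@lebesgue_measure R).
have /sigma_finiteP[G [TG ndG Goo]] := sigma_finiteT mu.
exists (fun k => @uncons_row n @^-1` (F k `*` G k)).
  rewrite -preimage_bigcup (_ : \bigcup_k _ = setT) ?preimage_setT//.
  rewrite -setXTT TF TG predeqE => -[x y]; split.
    by move=> [k _ []/= ? ?]; split; exists k.
  move=> [/= [k _ Fkx] [l _ Gly]]; exists (maxn k l) => //; split.
  - by move: x Fkx; exact/subsetPset/ndF/leq_maxl.
  - by move: y Gly; exact/subsetPset/ndG/leq_maxr.
move=> k; have [? ?] := Foo k; have [? ?] := Goo k; split.
  by rewrite -[X in measurable X]setTI; apply: measurable_uncons_row => //;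
    exact: measurableX.
rewrite /lebesgue_cons /pushforward -comp_preimage.
rewrite (_ : _ \o _ = id); last by apply/funext => z /=; rewrite cons_rowK.
by rewrite preimage_id product_measure1E// lte_mul_pinfty// ge0_fin_numE.
Qed.

HB.instance Definition _ := Measure_isSigmaFinite.Build _ _ _ lebesgue_cons
  lebesgue_cons_sigma_finite.

End step.

Fixpoint lebesgue_rV n : {sigma_finite_measure set 'rV[R]_n -> \bar R} :=
  match n with
  | 0 => \d_(0 : 'rV[R]_0)
  | m.+1 => lebesgue_cons (lebesgue_rV m)
  end.

End lebesgue_rV.

Section inhomogeneous_NLS.
Context {R : realType} {N : nat}.
Local Notation E := 'rV[R]_N.
Local Notation C := R[i].
Local Notation mu := (@lebesgue_rV R N).

(* `|x| on 'rV[R]_N is the sup norm, hence this separate definition *)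
Definition enorm (x : E) : R := Num.sqrt (\sum_(j < N) x ord0 j ^+ 2).

Definition cmeasurable (f : E -> C) :=
  measurable_fun setT (fun x => complex.Re (f x)) /\
  measurable_fun setT (fun x => complex.Im (f x)).

Definition cintegrable (f : E -> C) :=
  mu.-integrable setT (fun x => (complex.Re (f x))%:E) /\
  mu.-integrable setT (fun x => (complex.Im (f x))%:E).

Definition cintegral (f : E -> C) : C :=
  ((\int[mu]_x complex.Re (f x)) +i* (\int[mu]_x complex.Im (f x)))%C.

Definition in_L2 (f : E -> C) :=
  cmeasurable f /\
  mu.-integrable setT (fun x => (Normc.normc (f x) ^+ 2)%:E).

Definition L2norm (f : E -> C) : R :=
  Num.sqrt (\int[mu]_x (Normc.normc (f x) ^+ 2)).

Definition L2dot (f g : E -> C) : C := cintegral (fun x => f x * conjc (g x)).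

Definition partial (j : 'I_N) (f : E -> R) : E -> R :=
  'D_(delta_mx ord0 j) f.

Fixpoint Ck (k : nat) (f : E -> R) : Prop :=
  continuous f /\
  if k is k'.+1 then
    forall j : 'I_N,
      (forall x, derivable f x (delta_mx ord0 j)) /\ Ck k' (partial j f)
  else True.

Definition test_function (theta : E -> R) :=
  (forall k, Ck k theta) /\ compact (closure [set x | theta x != 0]).

Definition is_weak_partial (j : 'I_N) (f g : E -> C) :=
  forall theta : E -> R, test_function theta ->
    cintegral (fun x => f x * (partial j theta x)%:C%C) =
    - cintegral (fun x => g x * (theta x)%:C%C).

Definition in_H1 (f : E -> C) :=
  in_L2 f /\ forall j, exists g, in_L2 g /\ is_weak_partial j f g.

(* a chosen representative, unique up to a null set; 0 if there is none *)
Definition weak_partial (j : 'I_N) (f : E -> C) : E -> C :=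
  xget (fun=> 0) [set g | in_L2 g /\ is_weak_partial j f g].

Definition H1norm (f : E -> C) : R :=
  Num.sqrt (L2norm f ^+ 2 + \sum_(j < N) L2norm (weak_partial j f) ^+ 2).

Definition nonlinearity (b sigma : R) (u : E -> C) (x : E) : C :=
  (enorm x `^ (- b) * Normc.normc (u x) `^ (2 * sigma))%:C%C * u x.

(* The functional v |-> < Delta u + |x|^{-b} |u|^{2 sigma} u , v > on H^1,
   the Laplacian being integrated by parts. *)
Definition energy_gradient (b sigma : R) (u v : E -> C) : C :=
  L2dot (nonlinearity b sigma u) v -
  \sum_(j < N) L2dot (weak_partial j u) (weak_partial j v).

(* The pairing of the nonlinearity with v is an absolutely convergent
   integral, so that the default value 0 of divergent integrals plays no role. *)
Definition nonlinearity_pairs (b sigma : R) (u v : E -> C) :=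
  cintegrable (fun x => nonlinearity b sigma u x * conjc (v x)).

Definition of_real (psi : E -> R) : E -> C := fun x => (psi x)%:C%C.

(* Elements of H^1 are classes modulo null sets, so positivity and radial
   symmetry are almost everywhere properties; the equation holds in H^{-1}. *)
Definition is_ground_state (b sigma : R) (psi : E -> R) :=
  [/\ in_H1 (of_real psi),
      {ae mu, forall x, 0 < psi x},
      exists g : R -> R, {ae mu, forall x, psi x = g (enorm x)} &
      forall v, in_H1 v ->
        nonlinearity_pairs b sigma (of_real psi) v /\
        energy_gradient b sigma (of_real psi) v - L2dot (of_real psi) v = 0].

Definition continuous_in_H1 (T : R) (phi : R -> E -> C) :=
  (forall t, t \in `[0, T[ -> in_H1 (phi t)) /\
  forall t, t \in `[0, T[ ->
    H1norm (fun x => phi s x - phi t x) @[s --> within `[0, T[ (nbhs t)] --> 0.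

(* Strong solution on [0, T[: phi is a continuous curve in H^1, differentiable
   as a curve in H^{-1} (one-sidedly at t = 0), and
     i phi'(t) + Delta phi(t) + |x|^{-b} |phi(t)|^{2 sigma} phi(t) = 0
   in H^{-1} for each t, the difference quotients converging in the dual norm,
   i.e. uniformly for v in the unit ball of H^1. *)
Definition strong_solution (b sigma T : R) (phi : R -> E -> C) :=
  continuous_in_H1 T phi /\
  forall t, t \in `[0, T[ ->
    (forall v, in_H1 v -> nonlinearity_pairs b sigma (phi t) v) /\
    forall eps : R, 0 < eps ->
      \forall s \near within `[0, T[ t^',
        forall v, in_H1 v ->
          Normc.normc
            ('i%C * L2dot (fun x => (s - t)^-1%:C%C * (phi s x - phi t x)) v
             + energy_gradient b sigma (phi t) v)
          <= eps * H1norm v.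

End inhomogeneous_NLS.

(* Main.v *)
Require Import Defs.
From HB Require Import structures.
From mathcomp Require Import all_boot all_order all_algebra.
From mathcomp Require Import all_classical all_reals all_analysis.
From mathcomp Require Import complex.
From mathcomp Require Import measurable_realfun ring lra.

Set Implicit Arguments.
Unset Strict Implicit.
Unset Printing Implicit Defensive.

Import Order.TTheory GRing.Theory Num.Theory.
Import numFieldNormedType.Exports.

Local Open Scope classical_set_scope.
Local Open Scope ring_scope.

(** The blow-up solution is explicit: it is the pseudo-conformal transform of
the standing wave exp(i t) psi.  With r = 1/(1 - t),
<<
    phi(t, x) = r^(N/2) exp(i (r - r |x|^2 / 4)) psi(r x).
>>
Since sigma = (2 - b)/N, the potential |x|^(-b) |phi|^(2 sigma) scales like the
Laplacian, so that the phase turns the equation of psi into the evolution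
equation.  The dilation is unitary in L^2, whence the critical mass, and
||grad phi(t)|| >= r ||grad psi|| tends to infinity as t tends to 1.

A ground state is only known to be a weak solution in H^1, and the evolution
equation has to hold in H^(-1); the difference quotients in time converge even
in L^2.  Three points need an argument.

Decay.  The time derivative of phi contains |x|^2 psi and x . grad psi, which
must be square integrable (weighted_L2).  The equation is tested with w^2 psi
for the bounded weights w = (1 + |x|^2)/(1 + e |x|^2), uniformly in e; this
works because |x|^(-b) psi^(2 sigma) is small at infinity.  As b > 0, it is
enough that psi is bounded outside a ball, which holds for every radial
function with square integrable gradient (radial_bounded): almost everywhere,
psi(lam x) is bounded by the energies of psi and grad psi on the half-line
{s x : s >= 1}, uniformly in lam >= 1; those are finite for almost every x with
1 < x_0 < 2; and a bound along one ray is, for a radial function, a bound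
everywhere far out.

Differentiating dilations.  The pairing of f(s x) with a smooth function is
differentiable in s by moving the dilation to the smooth function.  The mean
value theorem and the density of smooth functions turn this into convergence in
L^2 of the difference quotients to the Euler derivative x . grad f
(sqcvg_dilation_derive).  This also gives integration by parts for the Euler
derivative (euler_by_parts), and that only the zero function has zero gradient
(gradient_eq0).

The equation.  No second derivatives are available, so the equation is checked
after integration by parts.  For a test function v, it is the sum of the
rescaled ground-state equation tested with cos(phase) v and of the
integration by parts of the Euler derivative tested with sin(phase) v
(profile_identity).  The products of v with the phase factors are not in H^1
because x v need not be square integrable; a cut-off 1/(1 + e |x|^2) repairs
this (cutoff_identity), and e tends to 0 afterwards.

Everything is done for real functions.  The real and imaginary parts of phi are
the members c = 0 and c = - pi/2 of the family
r^(N/2) cos(r - r |x|^2 / 4 + c) psi(r x), so that each computation is done once. *)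

(** * Dilations and Lebesgue measure *)

Section scaling.
Context {R : realType}.
Local Notation leb := (@lebesgue_measure R).
Local Notation mu n := (@lebesgue_rV R n).

Lemma lebesgue_measure_scale (s : R) (A : set R) : 0 < s -> measurable A ->
  leb (( *%R s) @^-1` A) = ((s^-1)%:E * leb A)%E.
Proof.
move=> s0 mA.
have ms : measurable_fun setT (( *%R s) : R -> R) by exact: measurable_realfun.mulrl_measurable.
pose nu : {measure set (measurableTypeR R) -> \bar R} :=
  mscale (NngNum (ltW s0)) (pushforward leb (( *%R s) : _ -> measurableTypeR R)).
have E : leb A = nu ms A.
  apply: lebesgue_measure_unique => //= _ [[a b]] _ <-.
  rewrite /mscale/= /pushforward.
  have -> : ( *%R s) @^-1` `]a, b] = [set` `]s^-1 * a, s^-1 * b]].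
    apply/seteqP; split => x /=; rewrite !in_itv/=.
      by rewrite ![s^-1 * _]mulrC ltr_pdivrMr// ler_pdivlMr// ![x * s]mulrC.
    by rewrite ![s^-1 * _]mulrC ltr_pdivrMr// ler_pdivlMr// ![x * s]mulrC.
  rewrite !lebesgue_measure_itv/= !lte_fin ltr_pM2l ?invr_gt0//.
  case: ifPn => _; last by rewrite mule0.
  by rewrite -!EFinD -EFinM; congr EFin; field; rewrite gt_eqF.
rewrite E /nu /mscale/= muleA -EFinM mulVf ?mul1e//; exact: lt0r_neq0.
Qed.

Lemma ge0_integral_scale1 (s : R) (f : R -> \bar R) : 0 < s ->
  measurable_fun [set: _] f -> (forall x, 0 <= f x)%E ->
  (\int[leb]_x f (s * x)%R = (s^-1)%:E * \int[leb]_x f x)%E.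
Proof.
move=> s0 mf f0.
have ms : measurable_fun [set: measurableTypeR R]
    (( *%R s) : _ -> measurableTypeR R).
  exact: measurable_realfun.mulrl_measurable.
transitivity (\int[pushforward leb (( *%R s) : _ -> measurableTypeR R)]_x f x)%E.
  have := @ge0_integral_pushforward _ _ _ _ _ _ ms leb setT f measurableT mf.
  by move=> ->//=; rewrite preimage_setT.
have s'0 : 0 <= s^-1 by rewrite invr_ge0 ltW.
rewrite -(ge0_integral_mscale leb measurableT (NngNum s'0))//.
apply: eq_measure_integral => A mA _.
by rewrite /= /mscale/= -lebesgue_measure_scale.
Qed.

Lemma measurable_scale n (s : R) :
  measurable_fun setT (fun x : 'rV[R]_n => s *: x).
Proof.
apply/measurable_fun_coordP => i.
under eq_fun do rewrite mxE.
apply: measurable_funM; first exact: measurable_cst.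
exact: measurable_coord.
Qed.

(** Lebesgue measure in dimension n.+1 is the image of a product measure; Tonelli
makes inductions on the dimension possible. *)
Lemma integral_lebesgue_cons n (f : 'rV[R]_n.+1 -> \bar R) :
  measurable_fun [set: _] f -> (forall x, 0 <= f x)%E ->
  (\int[mu n.+1]_x f x = \int[leb]_x \int[mu n]_y f (cons_row (x, y)))%E.
Proof.
move=> mf f0.
rewrite /= (@ge0_integral_pushforward _ _ _ _ _ _ (@measurable_cons_row R n)
  (leb \x mu n)%E setT)//.
rewrite preimage_setT (@fubini_tonelli1 _ _ _ _ _ leb (mu n) (f \o @cons_row R n))//.
  by apply: measurableT_comp => //; exact: measurable_cons_row.
by move=> z /=.
Qed.

Lemma cons_row_scale n (s : R) x (y : 'rV[R]_n) :
  s *: cons_row (x, y) = cons_row (s * x, s *: y).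
Proof.
apply/rowP => j; rewrite !mxE; case: (unliftP ord0 j) => [k|] _ //=.
by rewrite mxE.
Qed.

(** Induction on the dimension, one coordinate at a time. *)
Lemma ge0_integral_scale n (s : R) (f : 'rV[R]_n -> \bar R) : 0 < s ->
  measurable_fun [set: _] f -> (forall x, 0 <= f x)%E ->
  (\int[mu n]_x f (s *: x)%R = ((s^-1) ^+ n)%:E * \int[mu n]_x f x)%E.
Proof.
move=> s0; elim: n f => [|n IH] f mf f0.
  rewrite /= !integral_dirac//.
    by rewrite !diracT !mul1e scaler0.
  by apply: measurableT_comp => //; exact: measurable_scale.
have mfc : measurable_fun setT (fun z : R * 'rV[R]_n => f (cons_row z)).
  by apply: measurableT_comp => //; exact: measurable_cons_row.
rewrite !integral_lebesgue_cons//; last first.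
  by apply: measurableT_comp => //; exact: measurable_scale.
under eq_integral => x _.
  under eq_integral => y _ do rewrite cons_row_scale.
  rewrite (IH (fun y => f (cons_row (s * x, y))))//.
  over.
  by apply: (measurableT_comp mfc); exact: measurable_pair1.
have mF : measurable_fun setT (fun x => \int[mu n]_y f (cons_row (x, y)))%E.
  exact: (@measurable_fun_fubini_tonelli_F _ _ _ _ _ (mu n) _ mfc).
have F0 x : (0 <= \int[mu n]_y f (cons_row (x, y)))%E by exact: integral_ge0.
rewrite ge0_integralZl//; last 2 first.
- by apply: (measurableT_comp mF); exact: measurable_realfun.mulrl_measurable.
- by rewrite lee_fin exprn_ge0// invr_ge0 ltW.
rewrite (ge0_integral_scale1 s0 mF)// muleA -EFinM.
by rewrite exprSr.
Qed.

End scaling.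

(** * Square-integrable functions *)

(** Solves measurability goals on polynomial expressions whose atoms are
measurable by hypothesis. *)
Ltac mfun :=
  repeat first [ exact: measurable_cst | exact: measurable_id
  | match goal with H : _ |- measurable_fun _ _ => exact: H end
  | match goal with
    | |- measurable_fun _ (fun x => EFin _) => apply/measurable_EFinP
    | |- measurable_fun _ (EFin \o _) => apply/measurable_EFinP
    | |- measurable_fun _ (fun x => _ + - _) => apply: measurable_funB
    | |- measurable_fun _ (fun x => _ + _) => apply: measurable_funD
    | |- measurable_fun _ (fun x => - _) => apply: measurable_funN
    | |- measurable_fun _ (fun x => _ * _) => apply: measurable_funM
    | |- measurable_fun _ (fun x => _ ^+ _) => apply: measurable_funX
    end ].

Section square_integrable.
Context {R : realType} d (T : measurableType d) (mu : {measure set T -> \bar R}).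
Implicit Types (f g h : T -> R) (c : R).

Definition l2sq f : \bar R := (\int[mu]_x (f x ^+ 2)%:E)%E.
Definition isL2 f := measurable_fun setT f /\ (l2sq f < +oo)%E.
Definition l2dot f g : R := \int[mu]_x (f x * g x).

Lemma sq_ge0 f : (0 <= l2sq f)%E.
Proof. by apply: integral_ge0 => x _; rewrite lee_fin sqr_ge0. Qed.

Lemma L2_meas f : isL2 f -> measurable_fun setT f. Proof. by case. Qed.

Lemma measurable_sq f : measurable_fun setT f ->
  measurable_fun setT (fun x => (f x ^+ 2)%:E).
Proof. by move=> mf; mfun. Qed.

Lemma sq_le f g : measurable_fun setT f -> measurable_fun setT g ->
  {ae mu, forall x, `|f x| <= `|g x|} -> (l2sq f <= l2sq g)%E.
Proof.
move=> mf mg fg; apply: ae_ge0_le_integral => //.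
- by move=> x _; rewrite lee_fin sqr_ge0.
- exact: measurable_sq.
- by move=> x _; rewrite lee_fin sqr_ge0.
- exact: measurable_sq.
apply: filterS fg => x fg _.
by rewrite lee_fin -[f x ^+ 2]real_normK ?num_real// -[g x ^+ 2]real_normK ?num_real// lerXn2r ?nnegrE.
Qed.

Lemma sqZ c f : measurable_fun setT f ->
  l2sq (fun x => c * f x) = ((c ^+ 2)%:E * l2sq f)%E.
Proof.
move=> mf; rewrite /l2sq -ge0_integralZl_EFin//.
- by apply: eq_integral => x _; rewrite -EFinM exprMn.
- by move=> x _; rewrite lee_fin sqr_ge0.
- exact: measurable_sq.
- by rewrite sqr_ge0.
Qed.

Lemma sqD f g : measurable_fun setT f -> measurable_fun setT g ->
  (l2sq (fun x => f x + g x)%R <= 2%:E * l2sq f + 2%:E * l2sq g)%E.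
Proof.
move=> mf mg; rewrite /l2sq -!ge0_integralZl_EFin//; last 4 first.
- by move=> x _; rewrite lee_fin sqr_ge0.
- exact: measurable_sq.
- by move=> x _; rewrite lee_fin sqr_ge0.
- exact: measurable_sq.
rewrite -ge0_integralD//; last 4 first.
- by move=> x _; rewrite -EFinM lee_fin mulr_ge0// sqr_ge0.
- by apply: measurable_funeM; exact: measurable_sq.
- by move=> x _; rewrite -EFinM lee_fin mulr_ge0// sqr_ge0.
- by apply: measurable_funeM; exact: measurable_sq.
apply: ge0_le_integral => //.
- by move=> x _; rewrite lee_fin sqr_ge0.
- by apply: measurable_sq; mfun.
- by apply: emeasurable_funD; apply: measurable_funeM; exact: measurable_sq.
move=> x _; rewrite -!EFinM -EFinD lee_fin.
have := sqr_ge0 (f x - g x); nra.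
Qed.

Lemma L2_le f g : measurable_fun setT f -> isL2 g ->
  {ae mu, forall x, `|f x| <= `|g x|} -> isL2 f.
Proof. by move=> mf [mg Lg] fg; split=> //; apply: le_lt_trans Lg; exact: sq_le. Qed.

Lemma L2D f g : isL2 f -> isL2 g -> isL2 (fun x => f x + g x).
Proof.
move=> [mf Lf] [mg Lg]; split; first by mfun.
apply: le_lt_trans (sqD mf mg) _.
by apply: lte_add_pinfty; apply: lte_mul_pinfty.
Qed.

Lemma L2Z c f : isL2 f -> isL2 (fun x => c * f x).
Proof.
move=> [mf Lf]; split; first by mfun.
by rewrite sqZ//; apply: lte_mul_pinfty => //; rewrite lee_fin sqr_ge0.
Qed.

Lemma L2N f : isL2 f -> isL2 (fun x => - f x).
Proof. by move=> /(L2Z (-1)); under eq_fun do rewrite mulN1r. Qed.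

Lemma L2B f g : isL2 f -> isL2 g -> isL2 (fun x => f x - g x).
Proof. by move=> Lf Lg; apply: L2D => //; exact: L2N. Qed.

Lemma L20 : isL2 (fun=> 0).
Proof. by split; [exact: measurable_cst|rewrite /l2sq expr0n integral0]. Qed.

Lemma L2_sum (I : Type) (r : seq I) (F : I -> T -> R) :
  (forall i, isL2 (F i)) -> isL2 (fun x => \sum_(i <- r) F i x).
Proof.
move=> LF; elim: r => [|i r IH].
  by under eq_fun do rewrite big_nil; exact: L20.
by under eq_fun do rewrite big_cons; exact: L2D.
Qed.

(** Bounded multipliers are the only products with an L^2 function that are needed:
phases, cut-offs and weights. *)
Lemma L2_bounded (M : R) (m : T -> R) f : measurable_fun setT m -> (forall x, `|m x| <= M) ->
  isL2 f -> isL2 (fun x => m x * f x).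
Proof.
move=> mm mM Lf; apply: (L2_le _ (L2Z M Lf)).
  by have mf := L2_meas Lf; mfun.
apply: aeW => x; rewrite !normrM ler_wpM2r//.
by apply: (le_trans (mM x)); exact: ler_norm.
Qed.

Lemma L2_integrable f g : isL2 f -> isL2 g ->
  mu.-integrable setT (EFin \o (fun x => f x * g x)).
Proof.
move=> [mf Lf] [mg Lg].
have mfg : measurable_fun setT (fun x => f x * g x) by mfun.
apply/integrableP; split; first exact/measurable_EFinP.
apply: (@le_lt_trans _ _ (l2sq f + l2sq g)%E); last exact: lte_add_pinfty.
rewrite /l2sq -ge0_integralD//.
- apply: ge0_le_integral => //.
  + by apply/measurable_EFinP; apply: measurableT_comp => //.
  + by apply: emeasurable_funD; exact: measurable_sq.
  move=> x _; rewrite /= -EFinD lee_fin normrM.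
  rewrite -[f x ^+ 2]real_normK ?num_real// -[g x ^+ 2]real_normK ?num_real//.
  have := sqr_ge0 (`|f x| - `|g x|); have := normr_ge0 (f x); have := normr_ge0 (g x).
  nra.
- by move=> x _; rewrite lee_fin sqr_ge0.
- exact: measurable_sq.
- by move=> x _; rewrite lee_fin sqr_ge0.
- exact: measurable_sq.
Qed.

Lemma sqE f : isL2 f -> l2sq f = (l2dot f f)%:E.
Proof.
move=> Lf; rewrite /l2dot /Rintegral fineK//.
by apply: integrable_fin_num => //; exact: L2_integrable.
Qed.

Lemma dot_ge0 f : 0 <= l2dot f f.
Proof. by apply: Rintegral_ge0 => x _; rewrite -expr2 sqr_ge0. Qed.

Lemma dotC f g : l2dot f g = l2dot g f.
Proof. by apply: eq_Rintegral => x _; rewrite mulrC. Qed.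

Lemma dotDl f g h : isL2 f -> isL2 g -> isL2 h ->
  l2dot (fun x => f x + g x) h = l2dot f h + l2dot g h.
Proof.
move=> Lf Lg Lh; rewrite /l2dot; under eq_Rintegral do rewrite mulrDl.
by rewrite RintegralD//; exact: L2_integrable.
Qed.

Lemma dotZl c f h : isL2 f -> isL2 h -> l2dot (fun x => c * f x) h = c * l2dot f h.
Proof.
move=> Lf Lh; rewrite /l2dot; under eq_Rintegral do rewrite -mulrA.
by rewrite RintegralZl//; exact: L2_integrable.
Qed.

Lemma dotBl f g h : isL2 f -> isL2 g -> isL2 h ->
  l2dot (fun x => f x - g x) h = l2dot f h - l2dot g h.
Proof.
move=> Lf Lg Lh; rewrite /l2dot; under eq_Rintegral do rewrite mulrBl.
by rewrite RintegralB//; exact: L2_integrable.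
Qed.

Lemma dotDr f g h : isL2 f -> isL2 g -> isL2 h ->
  l2dot h (fun x => f x + g x) = l2dot h f + l2dot h g.
Proof. by move=> *; rewrite dotC dotDl// ![l2dot _ h]dotC. Qed.

Lemma dotZr c f h : isL2 f -> isL2 h -> l2dot h (fun x => c * f x) = c * l2dot h f.
Proof. by move=> *; rewrite dotC dotZl// dotC. Qed.

Lemma dotBr f g h : isL2 f -> isL2 g -> isL2 h ->
  l2dot h (fun x => f x - g x) = l2dot h f - l2dot h g.
Proof. by move=> *; rewrite dotC dotBl// ![l2dot _ h]dotC. Qed.

Lemma dot_suml (I : Type) (r : seq I) (F : I -> T -> R) h :
  (forall i, isL2 (F i)) -> isL2 h ->
  l2dot (fun x => \sum_(i <- r) F i x) h = \sum_(i <- r) l2dot (F i) h.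
Proof.
move=> LF Lh; elim: r => [|i r IH].
  rewrite big_nil /l2dot; under eq_Rintegral do rewrite big_nil mul0r.
  by rewrite Rintegral_cst// mul0r.
rewrite big_cons -IH -dotDl//; last exact: L2_sum.
by congr l2dot; apply/funext => x; rewrite big_cons.
Qed.

Lemma ae_eq_Rintegral f g : measurable_fun setT f -> measurable_fun setT g ->
  {ae mu, forall x, f x = g x} -> \int[mu]_x f x = \int[mu]_x g x.
Proof.
move=> mf mg fg; congr fine; apply: ae_eq_integral => //.
- exact/measurable_EFinP.
- exact/measurable_EFinP.
- by apply: filterS fg => x -> _.
Qed.

Lemma ae_eq_dot f1 f2 g1 g2 : isL2 f1 -> isL2 f2 -> isL2 g1 -> isL2 g2 ->
  {ae mu, forall x, f1 x = f2 x} -> {ae mu, forall x, g1 x = g2 x} ->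
  l2dot f1 g1 = l2dot f2 g2.
Proof.
move=> [m1 _] [m2 _] [m3 _] [m4 _] E1 E2; apply: ae_eq_Rintegral; try by mfun.
by apply: filterS2 E1 E2 => x -> ->.
Qed.

Lemma sq_eq0 f : measurable_fun setT f ->
  l2sq f = 0%E <-> {ae mu, forall x, f x = 0}.
Proof.
move=> mf; have := @ae_eq_integral_abs _ _ _ mu setT measurableT _ (measurable_sq mf).
have -> : (\int[mu]_x `|(f x ^+ 2)%:E|)%E = l2sq f.
  by apply: eq_integral => x _; rewrite gee0_abs// lee_fin sqr_ge0.
move=> ->; split; apply: filterS => x.
  by move=> /(_ I) /= [] /eqP; rewrite sqrf_eq0 => /eqP.
by move=> -> _; rewrite expr0n.
Qed.

Lemma cauchy_schwarz2 f g : isL2 f -> isL2 g ->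
  l2dot f g ^+ 2 <= l2dot f f * l2dot g g.
Proof.
move=> Lf Lg.
have key (c : R) : 0 <= l2dot f f * c ^+ 2 - 2 * c * l2dot f g + l2dot g g.
  have := dot_ge0 (fun x => c * f x - g x).
  have Lcf := L2Z c Lf.
  rewrite dotBl//; last exact: L2B.
  rewrite !dotBr// !dotZl// !dotZr// (dotC g f); nra.
have [f0|f0] := eqVneq (l2dot f f) 0.
  have [->|fg0] := eqVneq (l2dot f g) 0; first by rewrite f0 mul0r expr0n.
  have := key ((l2dot g g + 1) / (2 * l2dot f g)).
  rewrite f0 mul0r sub0r.
  have -> : 2 * ((l2dot g g + 1) / (2 * l2dot f g)) * l2dot f g = l2dot g g + 1.
    by field.
  lra.
have fp : 0 < l2dot f f by rewrite lt0r f0 dot_ge0.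
have := key (l2dot f g / l2dot f f).
have -> : l2dot f f * (l2dot f g / l2dot f f) ^+ 2 - 2 * (l2dot f g / l2dot f f) * l2dot f g + l2dot g g
  = (l2dot f f * l2dot g g - l2dot f g ^+ 2) / l2dot f f by field.
by rewrite pmulr_lge0 ?invr_gt0// subr_ge0.
Qed.

Lemma cauchy_schwarz f g : isL2 f -> isL2 g ->
  `|l2dot f g| <= Num.sqrt (l2dot f f) * Num.sqrt (l2dot g g).
Proof.
move=> Lf Lg; rewrite -sqrtrM ?dot_ge0// -sqrtr_sqr ler_wsqrtr//.
exact: cauchy_schwarz2.
Qed.

Definition l2cvg (f_ : nat -> T -> R) f :=
  l2sq (fun x => f_ n x - f x) @[n --> \oo] --> (0 : \bar R).

Lemma sqcvg_eq (f_ : nat -> T -> R) (g_ : nat -> T -> R) f g : (forall n x, f_ n x = g_ n x) -> (forall x, f x = g x) ->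
  l2cvg f_ f -> l2cvg g_ g.
Proof.
move=> E1 E2; rewrite /l2cvg.
by under eq_fun => n do (under [X in l2sq X]eq_fun => x do rewrite E1 E2).
Qed.

(** Dominated convergence for the squares. *)
Lemma sqcvg_dom (f_ : nat -> T -> R) f g : (forall n, measurable_fun setT (f_ n)) ->
  measurable_fun setT f ->
  (forall x, f_ n x @[n --> \oo] --> f x) -> isL2 g ->
  (forall n x, `|f_ n x - f x| <= `|g x|) -> l2cvg f_ f.
Proof.
move=> mf_ mf cf [mg Lg] dom; rewrite /l2cvg.
have ig : mu.-integrable setT (fun x => (g x ^+ 2)%:E).
  apply/integrableP; split; first exact: measurable_sq.
  rewrite (_ : (fun x => _) = (fun x => (g x ^+ 2)%:E))//.
  by apply/funext => x /=; rewrite ger0_norm// sqr_ge0.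
have := @dominated_convergence _ _ _ mu setT measurableT
  (fun n x => ((f_ n x - f x) ^+ 2)%:E) (cst 0%E) (fun x => (g x ^+ 2)%:E).
case=> //.
- by move=> n; apply: measurable_sq; mfun; exact: mf_.
- apply: aeW => x _; apply: cvg_EFin; first by apply: nearW.
  rewrite [X in _ --> X](_ : _ = (f x - f x) * (f x - f x)); last by rewrite subrr mulr0.
  rewrite (_ : _ \o _ = fun n => (f_ n x - f x) * (f_ n x - f x)); last first.
    by apply/funext => n /=; rewrite expr2.
  by apply: cvgM; (apply: cvgB; [exact: cf|exact: cvg_cst]).
- apply: aeW => x n _; rewrite lee_fin ger0_norm ?sqr_ge0//.
  by rewrite -real_normK ?num_real// -[leRHS]real_normK ?num_real// lerXn2r ?nnegrE.
by move=> _ _; rewrite integral0; apply.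
Qed.

Lemma sqcvg_le (f_ : nat -> T -> R) f (g_ : nat -> T -> R) g (M : R) : (forall n, measurable_fun setT (f_ n)) ->
  measurable_fun setT f -> (forall n, measurable_fun setT (g_ n)) ->
  measurable_fun setT g ->
  (forall n x, `|f_ n x - f x| <= M * `|g_ n x - g x|) ->
  l2cvg g_ g -> l2cvg f_ f.
Proof.
move=> mf_ mf mg_ mg dom cg; rewrite /l2cvg.
apply: (@squeeze_cvge _ _ _ _ (cst 0%E) _
   (fun n => (M ^+ 2)%:E * l2sq (fun x => (g_ n x - g x)%R))%E); first last.
- rewrite -[X in _ --> X](mule0 (M ^+ 2)%:E); apply: cvgeZl => //.
- exact: cvg_cst.
apply: nearW => n; rewrite sq_ge0/= -sqZ//; last by mfun.
apply: sq_le; [by mfun|by mfun|].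
apply: aeW => x; rewrite normrM (le_trans (dom n x))// ler_wpM2r//; exact: ler_norm.
Qed.

Lemma sqcvgD (f_ : nat -> T -> R) f (g_ : nat -> T -> R) g : (forall n, measurable_fun setT (f_ n)) ->
  measurable_fun setT f -> (forall n, measurable_fun setT (g_ n)) ->
  measurable_fun setT g -> l2cvg f_ f -> l2cvg g_ g ->
  l2cvg (fun n x => f_ n x + g_ n x) (fun x => f x + g x).
Proof.
move=> mf_ mf mg_ mg cf cg; rewrite /l2cvg.
apply: (@squeeze_cvge _ _ _ _ (cst 0%E) _
   (fun n => 2%:E * l2sq (fun x => (f_ n x - f x)%R) +
      2%:E * l2sq (fun x => (g_ n x - g x)%R))%E); first last.
- rewrite -[X in _ --> X](adde0 0%E) -[X in _ --> (X + X)%E](mule0 2%:E).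
  by apply: cvgeD => //; apply: cvgeZl.
- exact: cvg_cst.
apply: nearW => n; rewrite sq_ge0/=.
rewrite (_ : (fun x => _) = fun x => (f_ n x - f x) + (g_ n x - g x)); last first.
  by apply/funext => x; ring.
by apply: sqD; mfun.
Qed.

Lemma sqcvg_mul (M : R) (m_ : nat -> T -> R) (f_ : nat -> T -> R) f : (forall n, measurable_fun setT (f_ n)) ->
  measurable_fun setT f -> (forall n, measurable_fun setT (m_ n)) ->
  (forall n x, `|m_ n x| <= M) -> l2cvg f_ f ->
  l2cvg (fun n x => m_ n x * (f_ n x - f x)) (fun=> 0).
Proof.
move=> mf_ mf mm mM cf.
apply: (@sqcvg_le _ _ (fun n x => f_ n x - f x) (fun=> 0) M).
- by move=> n; mfun.
- exact: measurable_cst.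
- by move=> n; mfun.
- exact: measurable_cst.
- by move=> n x; rewrite !subr0 normrM ler_wpM2r.
apply: cvg_trans cf; apply: near_eq_cvg; apply: nearW => n.
by congr l2sq; apply/funext => x; rewrite subr0.
Qed.

Lemma sqcvg_cst f : l2cvg (fun=> f) f.
Proof.
rewrite /l2cvg (_ : (fun n => _) = cst 0%E); first exact: cvg_cst.
apply/funext => n; rewrite /l2sq (_ : (fun x => _) = cst 0%E) ?integral0//.
by apply/funext => x; rewrite subrr expr0n.
Qed.

(** The product splits into a bounded multiple of the error of the f_ n, and a fixed
L^2 function times multipliers that tend to 0 boundedly, to which dominated
convergence applies. *)
Lemma sqcvg_mulr (M : R) (A_ : nat -> T -> R) (A : T -> R) (f_ : nat -> T -> R) f :
  (forall n, measurable_fun setT (A_ n)) -> measurable_fun setT A ->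
  (forall n x, `|A_ n x| <= M) -> (forall x, A_ n x @[n --> \oo] --> A x) ->
  (forall n, measurable_fun setT (f_ n)) -> isL2 f -> l2cvg f_ f ->
  l2cvg (fun n x => A_ n x * f_ n x) (fun x => A x * f x).
Proof.
move=> mA_ mA AM cA mf_ Lf cf; have [mf _] := Lf.
have AM' x : `|A x| <= M.
  by apply: (ler_cvg_to (cvg_norm (cA x)) (cvg_cst M)); apply: nearW => n.
apply: (@sqcvg_eq (fun n x => A_ n x * (f_ n x - f x) + A_ n x * f x)
   _ (fun x => 0 + A x * f x)).
- by move=> n x; ring.
- by move=> x; rewrite add0r.
apply: sqcvgD; [by move=> n; mfun|by mfun|by move=> n; mfun|by mfun| |].
  exact: (sqcvg_mul mf_ mf mA_ AM cf).
apply: (sqcvg_dom _ _ _ (L2Z (2 * M) Lf)).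
- by move=> n; mfun.
- by mfun.
- by move=> x; apply: cvgM; [exact: cA|exact: cvg_cst].
move=> n x; have M0 : 0 <= M by exact: le_trans (AM' x).
rewrite -mulrBl !normrM ler_wpM2r//.
rewrite (le_trans (ler_normB _ _))// ger0_norm ?mulr_ge0// [2 * _]mulrDl mul1r.
by rewrite (ger0_norm M0) lerD.
Qed.

Lemma dot_cvg (f_ : nat -> T -> R) f (g_ : nat -> T -> R) g : (forall n, isL2 (f_ n)) -> isL2 f -> (forall n, isL2 (g_ n)) ->
  isL2 g -> l2cvg f_ f -> l2cvg g_ g ->
  l2dot (f_ n) (g_ n) @[n --> \oo] --> l2dot f g.
Proof.
move=> Lf_ Lf Lg_ Lg cf cg.
have nrm (h_ : nat -> T -> R) h : (forall n, isL2 (h_ n)) -> isL2 h -> l2cvg h_ h ->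
    Num.sqrt (l2dot (fun x => h_ n x - h x) (fun x => h_ n x - h x)) @[n --> \oo] --> (0:R).
  move=> Lh_ Lh ch; rewrite -[X in _ --> X]sqrtr0.
  apply: continuous_cvg; first exact: sqrt_continuous.
  by apply: fine_cvg; exact: ch.
set F := fun n => Num.sqrt (l2dot (fun x => f_ n x - f x) (fun x => f_ n x - f x)).
set G := fun n => Num.sqrt (l2dot (fun x => g_ n x - g x) (fun x => g_ n x - g x)).
set a := Num.sqrt (l2dot f f); set b := Num.sqrt (l2dot g g).
have cF : F n @[n --> \oo] --> (0:R) := nrm _ _ Lf_ Lf cf.
have cG : G n @[n --> \oo] --> (0:R) := nrm _ _ Lg_ Lg cg.
apply/subr_cvg0/norm_cvg0P.
apply: (@squeeze_cvgr _ _ _ _ (cst 0) (fun n => F n * G n + F n * b + a * G n)); first last.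
- rewrite (_ : 0 = 0 * 0 + 0 * b + a * 0); last by ring.
  apply: cvgD; first apply: cvgD; apply: cvgM => //; exact: cvg_cst.
- exact: cvg_cst.
apply: nearW => n /=; rewrite normr_ge0/=.
have LFn := L2B (Lf_ n) Lf; have LGn := L2B (Lg_ n) Lg.
have -> : l2dot (f_ n) (g_ n) - l2dot f g =
    l2dot (fun x => f_ n x - f x) (fun x => g_ n x - g x) +
    l2dot (fun x => f_ n x - f x) g + l2dot f (fun x => g_ n x - g x).
  by rewrite dotBl// !dotBr// dotBl//; ring.
rewrite (le_trans (ler_normD _ _))// lerD//; last exact: cauchy_schwarz.
by rewrite (le_trans (ler_normD _ _))// lerD//; exact: cauchy_schwarz.
Qed.

End square_integrable.

(** * Integrals as a relation *)

Section integrals.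
Context {R : realType} d (T : measurableType d) (mu : {measure set T -> \bar R}).
Implicit Types (f g : T -> R).

(** Linear combinations of integrals are computed together with their
integrability: the same combination proves both. *)
Definition has_integral f (a : R) := mu.-integrable setT (EFin \o f) /\ \int[mu]_x f x = a.

Lemma has_integral_eq f g a b : (forall x, f x = g x) -> a = b ->
  has_integral f a -> has_integral g b.
Proof. by move=> /funext-> ->. Qed.

Lemma has_integral_unique f a b : has_integral f a -> has_integral f b -> a = b.
Proof. by move=> [_ <-] [_ <-]. Qed.

Lemma has_integralD f g a b : has_integral f a -> has_integral g b ->
  has_integral (fun x => f x + g x) (a + b).
Proof.
move=> [if_ <-] [ig <-]; split; last by rewrite -RintegralD.
rewrite (_ : _ \o _ = (EFin \o f) \+ (EFin \o g))%E; last by apply/funext.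
exact: integrableD.
Qed.

Lemma has_integralZ c f a : has_integral f a -> has_integral (fun x => c * f x) (c * a).
Proof.
move=> [if_ <-]; split; last by rewrite RintegralZl.
rewrite (_ : _ \o _ = fun x => c%:E * (EFin \o f) x)%E; last by apply/funext.
exact: integrableZl.
Qed.

Lemma has_integralN f a : has_integral f a -> has_integral (fun x => - f x) (- a).
Proof.
by move=> /(has_integralZ (-1)); apply: has_integral_eq => [x|]; rewrite mulN1r.
Qed.

Lemma has_integralB f g a b : has_integral f a -> has_integral g b ->
  has_integral (fun x => f x - g x) (a - b).
Proof. by move=> hf /has_integralN; exact: has_integralD. Qed.

Lemma has_integral0 : has_integral (fun=> 0) 0.
Proof. by split; [exact: integrable0|rewrite Rintegral_cst// mul0r]. Qed.

Lemma has_integral_sum (I : Type) (r : seq I) (F : I -> T -> R) (a : I -> R) :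
  (forall i, has_integral (F i) (a i)) ->
  has_integral (fun x => \sum_(i <- r) F i x) (\sum_(i <- r) a i).
Proof.
move=> H; elim: r => [|i r IH].
  by apply: has_integral_eq has_integral0 => [x|]; rewrite big_nil.
by apply: has_integral_eq (has_integralD (H i) IH) => [x|]; rewrite big_cons.
Qed.

Lemma has_integral_dot f g : isL2 mu f -> isL2 mu g ->
  has_integral (fun x => f x * g x) (l2dot mu f g).
Proof. by move=> Lf Lg; split => //; exact: L2_integrable. Qed.

Lemma has_integral_ge0 f a : has_integral f a -> {ae mu, forall x, 0 <= f x} -> 0 <= a.
Proof.
move=> [if_ <-] f0; have [/measurable_EFinP mf _] := integrableP _ _ _ if_.
rewrite (@ae_eq_Rintegral R _ T mu f (fun x => `|f x|))//.
- exact: Rintegral_ge0.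
- exact: measurableT_comp.
by apply: filterS f0 => x fx; rewrite ger0_norm.
Qed.
End integrals.

(** * Smooth functions *)

Section smooth_functions.
Context {R : realType} {N : nat}.
Local Notation E := 'rV[R]_N.
Local Notation e_ j := (delta_mx ord0 j : E).
Implicit Types (f g th : E -> R).

(** A function given with all its derivatives, so that regularity of compositions is
an induction without computing anything. *)
Definition derivs (F : nat -> R -> R) := forall (k : nat) (x : R), is_derive x 1 (F k) (F k.+1 x).

(** Reduces directional derivatives to derivatives on the line, where the chain
rule is available. *)
Lemma is_derive_dirP (f : E -> R) x v d :
  is_derive x v f d <-> is_derive (0 : R) 1 (fun h : R => f (h *: v + x)) d.
Proof.
have E1 : 'D_1 (fun h : R => f (h *: v + x)) 0 = 'D_v f x.
  have H (h : R) : h^-1 *: (((fun h : R => f (h *: v + x)) \o shift 0) (h *: (1 : R))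
      - f ((0 : R) *: v + x)) = h^-1 *: ((f \o shift x) (h *: v) - f x).
    by rewrite /= addr0 scale0r add0r [h *: 1]mulr1.
  exact: (f_equal (fun G : R -> R => lim (G @ (0 : R)^')) (funext H)).
split=> -[D V]; split.
- exact: (derivable1P f x v).1 D.
- by rewrite E1.
- exact: (derivable1P f x v).2 D.
- by rewrite -E1.
Qed.

Lemma is_derive_dir_comp (F : R -> R) (f : E -> R) x v a d :
  is_derive (f x) 1 F a -> is_derive x v f d -> is_derive x v (F \o f) (a * d).
Proof.
move=> dF /is_derive_dirP df; apply/is_derive_dirP.
apply: (@is_derive1_comp _ F (fun h : R => f (h *: v + x)) 0 a d) => //.
by rewrite scale0r add0r.
Qed.

Lemma CkSP k f : continuous f ->
  (forall j, exists g, (forall x, is_derive x (e_ j) f (g x)) /\ Ck k g) ->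
  Ck k.+1 f.
Proof.
move=> cf H; split=> // j; have [g [dg Cg]] := H j.
split; first by move=> x; have [] := dg x.
rewrite (_ : partial j f = g)//; apply/funext => x.
by have [_] := dg x.
Qed.

Lemma Ck_continuous k f : Ck k f -> continuous f.
Proof. by case: k => [|k] []. Qed.

Lemma CkS_is_derive k f j x : Ck k.+1 f -> is_derive x (e_ j) f (partial j f x).
Proof. by move=> [_ /(_ j)[/(_ x)]] df _; exact: derivableP. Qed.

Lemma Ck_partial k f j : Ck k.+1 f -> Ck k (partial j f).
Proof. by move=> [_ /(_ j)[]]. Qed.

Lemma CkW k f : Ck k.+1 f -> Ck k f.
Proof.
elim: k f => [|k IH] f; first by case.
move=> Cf; apply: CkSP; first exact: Ck_continuous Cf.
move=> j; exists (partial j f); split; last exact/IH/Ck_partial.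
by move=> x; apply: CkS_is_derive; eassumption.
Qed.

Lemma Ck_cst k (c : R) : Ck k (fun _ : E => c).
Proof.
elim: k c => [|k IH] c; first by split=> //; exact: cst_continuous.
apply: CkSP; first exact: cst_continuous.
by move=> j; exists (fun=> 0); split=> // x; exact: is_derive_cst.
Qed.

Lemma is_derive_coord i j (x : E) :
  is_derive x (e_ j) (fun x => x ord0 i) (i == j)%:R.
Proof.
apply/is_derive_dirP.
rewrite (_ : (fun h => _) = fun h : R => h * (i == j)%:R + x ord0 i); last first.
  by apply/funext => h; rewrite !mxE eqxx.
apply: is_derive_eq.
by rewrite /GRing.scale/= !(mulr0, mulr1, addr0, add0r).
Qed.

Lemma Ck_coord k i : Ck k (fun x : E => x ord0 i).
Proof.
case: k => [|k]; first by split=> // x; exact: coord_continuous.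
apply: CkSP; first by move=> x; exact: coord_continuous.
move=> j; exists (fun=> (i == j)%:R); split; last exact: Ck_cst.
by move=> x; exact: is_derive_coord.
Qed.

Lemma CkD k f g : Ck k f -> Ck k g -> Ck k (fun x => f x + g x).
Proof.
elim: k f g => [|k IH] f g Cf Cg.
  by split=> // x; apply: continuousD; [exact: (Ck_continuous Cf)|exact: (Ck_continuous Cg)].
apply: CkSP.
  by move=> x; apply: continuousD; [exact: (Ck_continuous Cf)|exact: (Ck_continuous Cg)].
move=> j; exists (fun x => partial j f x + partial j g x); split.
  by move=> x; apply: is_deriveD; apply: CkS_is_derive; eassumption.
by apply: IH; exact: Ck_partial.
Qed.

Lemma CkM k f g : Ck k f -> Ck k g -> Ck k (fun x => f x * g x).
Proof.
elim: k f g => [|k IH] f g Cf Cg.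
  by split=> // x; apply: continuousM; [exact: (Ck_continuous Cf)|exact: (Ck_continuous Cg)].
apply: CkSP.
  by move=> x; apply: continuousM; [exact: (Ck_continuous Cf)|exact: (Ck_continuous Cg)].
move=> j; exists (fun x => f x * partial j g x + g x * partial j f x); split.
  by move=> x; apply: is_deriveM; apply: CkS_is_derive; eassumption.
by apply: CkD; apply: IH; (try exact: Ck_partial); exact: CkW.
Qed.

Lemma CkN k f : Ck k f -> Ck k (fun x => - f x).
Proof.
move=> Cf; rewrite (_ : (fun x => _) = fun x => (-1) * f x).
  by apply: CkM => //; exact: Ck_cst.
by apply/funext => x; rewrite mulN1r.
Qed.

Lemma CkB k f g : Ck k f -> Ck k g -> Ck k (fun x => f x - g x).
Proof. by move=> Cf Cg; apply: CkD => //; exact: CkN. Qed.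

Lemma Ck_sum k (I : Type) (r : seq I) (F : I -> E -> R) :
  (forall i, Ck k (F i)) -> Ck k (fun x => \sum_(i <- r) F i x).
Proof.
move=> CF; elim: r => [|i r IH].
  by under eq_fun do rewrite big_nil; exact: Ck_cst.
by under eq_fun do rewrite big_cons; exact: CkD.
Qed.

Lemma Ck_comp k (F : nat -> R -> R) f : derivs F -> Ck k f ->
  forall m, Ck k (fun x => F m (f x)).
Proof.
move=> dF; elim: k f => [|k IH] f Cf m.
  split=> // x; apply: (@continuous_comp _ _ _ f (F m)); first exact: (Ck_continuous Cf).
  by apply: differentiable_continuous; apply/derivable1_diffP; have [] := dF m (f x).
apply: CkSP.
  move=> x; apply: (@continuous_comp _ _ _ f (F m)); first exact: (Ck_continuous Cf).
  by apply: differentiable_continuous; apply/derivable1_diffP; have [] := dF m (f x).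
move=> j; exists (fun x => F m.+1 (f x) * partial j f x); split.
  move=> x; apply: is_derive_dir_comp; first exact: (dF m (f x)).
  by apply: CkS_is_derive; eassumption.
by apply: CkM; [apply: IH; exact: CkW|exact: Ck_partial].
Qed.

Lemma Ck_inv k f : (forall x, f x != 0) -> Ck k f -> Ck k (fun x => (f x)^-1).
Proof.
move=> f0; elim: k f f0 => [|k IH] f f0 Cf.
  by split=> // x; apply: continuousV => //; exact: (Ck_continuous Cf).
apply: CkSP.
  by move=> x; apply: continuousV => //; exact: (Ck_continuous Cf).
move=> j; exists (fun x => (- ((f x)^-1 * (f x)^-1)) * partial j f x); split.
  move=> x; apply: (@is_derive_dir_comp GRing.inv) => //; last by (apply: CkS_is_derive; eassumption).
  have /= := @is_deriveV R id (f x) 1 1 (f0 x) (is_derive_id _ _).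
  move=> H; apply: is_derive_eq.
  by rewrite /GRing.scale/= mulr1 -invfM expr2.
apply: CkM; last exact: Ck_partial.
by apply: CkN; apply: CkM; (apply: IH => //; exact: CkW).
Qed.

Lemma is_derive_scale f j (s : R) x d : is_derive (s *: x) (e_ j) f d ->
  is_derive x (e_ j) (fun x => f (s *: x)) (s * d).
Proof.
move=> /is_derive_dirP df; apply/is_derive_dirP.
rewrite (_ : (fun h => _) = (fun h : R => f (h *: e_ j + s *: x)) \o ( *%R s)); last first.
  by apply/funext => h /=; rewrite scalerDr scalerA.
rewrite mulrC; apply: is_derive1_comp; first by rewrite mulr0.
have H := @is_deriveZ R R R id s 0 1 1 (is_derive_id _ _).
by have := is_derive_eq H (mulr1 s).
Qed.

Lemma Ck_scale k f (s : R) : Ck k f -> Ck k (fun x => f (s *: x)).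
Proof.
have cs g : continuous g -> continuous (fun x : E => g (s *: x)).
  move=> cg x; apply: (@continuous_comp E E R (fun x => s *: x) g x); last exact: cg.
  exact: (@scaler_continuous R E s).
elim: k f => [|k IH] f Cf; first by split=> //; exact/cs/(Ck_continuous Cf).
apply: CkSP; first exact/cs/(Ck_continuous Cf).
move=> j; exists (fun x => s * partial j f (s *: x)); split.
  by move=> x; apply: is_derive_scale; apply: CkS_is_derive; eassumption.
by apply: CkM; [exact: Ck_cst|apply: IH; exact: Ck_partial].
Qed.

Definition Cinf f := forall k, Ck k f.

Lemma Cinf_partial f j : Cinf f -> Cinf (partial j f).
Proof. by move=> Cf k; exact: Ck_partial. Qed.

Lemma Cinf_is_derive f j x : Cinf f -> is_derive x (e_ j) f (partial j f x).
Proof. by move=> Cf; apply: CkS_is_derive; exact: (Cf 1%N). Qed.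

Lemma Cinf_continuous f : Cinf f -> continuous f.
Proof. by move=> Cf; exact: (Ck_continuous (Cf 0%N)). Qed.

Lemma is_derive_partial f j x d : is_derive x (e_ j) f d -> partial j f x = d.
Proof. by case. Qed.

Lemma partialM f g j x : Cinf f -> Cinf g ->
  partial j (fun x => f x * g x) x = f x * partial j g x + g x * partial j f x.
Proof.
by move=> Cf Cg; apply: is_derive_partial; apply: is_deriveM; exact: Cinf_is_derive.
Qed.

Lemma partial_scale f j (s : R) x : Cinf f ->
  partial j (fun x => f (s *: x)) x = s * partial j f (s *: x).
Proof.
by move=> Cf; apply: is_derive_partial; apply: is_derive_scale; exact: Cinf_is_derive.
Qed.

(** Having all iterated partial derivatives is all that a test function requires;
differentiability in the sense of Frechet is what a derivative along a ray needs. *)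
Definition smooth f := Cinf f /\ forall x, differentiable f x.

Lemma smooth_cst (c : R) : smooth (fun _ : E => c).
Proof. by split=> [k|x]; [exact: Ck_cst|exact: differentiable_cst]. Qed.

Lemma smooth_coord i : smooth (fun x : E => x ord0 i).
Proof. by split=> [k|x]; [exact: Ck_coord|exact: differentiable_coord]. Qed.

Lemma smoothD f g : smooth f -> smooth g -> smooth (fun x => f x + g x).
Proof.
by move=> [Cf df] [Cg dg]; split=> [k|x]; [exact: CkD|exact: differentiableD].
Qed.

Lemma smoothM f g : smooth f -> smooth g -> smooth (fun x => f x * g x).
Proof.
by move=> [Cf df] [Cg dg]; split=> [k|x]; [exact: CkM|exact: differentiableM].
Qed.

Lemma smooth_prod (I : Type) (r : seq I) (F : I -> E -> R) :
  (forall i, smooth (F i)) -> smooth (fun x => \prod_(i <- r) F i x).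
Proof.
move=> CF; elim: r => [|i r IH].
  by under eq_fun do rewrite big_nil; exact: smooth_cst.
by under eq_fun do rewrite big_cons; exact: smoothM.
Qed.

Lemma smooth_comp (F : nat -> R -> R) f m : derivs F -> smooth f ->
  smooth (fun x => F m (f x)).
Proof.
move=> dF [Cf df]; split=> [k|x]; first exact: Ck_comp.
apply: differentiable_comp => //.
by apply/derivable1_diffP; have [] := dF m (f x).
Qed.

Lemma smooth_ray f x (s : R) : smooth f ->
  is_derive s 1 (fun s : R => f (s *: x)) (\sum_j x ord0 j * partial j f (s *: x)).
Proof.
move=> [Cf df].
have D : is_derive (s *: x) x f (\sum_j x ord0 j * partial j f (s *: x)).
  split; first exact: diff_derivable.
  rewrite deriveE//; set L := 'd f (s *: x).
  transitivity (L (\sum_j x ord0 j *: e_ j)); first by rewrite -row_sum_delta.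
  rewrite linear_sum; apply: eq_bigr => j _.
  by rewrite linearZ/= /partial deriveE.
move/is_derive_dirP : D => D.
rewrite (_ : (fun s => _) = (fun h => f (h *: x + s *: x)) \o (fun t : R => t - s)); last first.
  by apply/funext => t /=; rewrite -scalerDl subrK.
rewrite -[X in is_derive _ _ _ X]mulr1; apply: is_derive1_comp; first by rewrite subrr.
by apply: is_derive_eq; rewrite subr0.
Qed.

End smooth_functions.

(** * Measurability, supports and bump functions *)

Section test_functions.
Context {R : realType} {N : nat}.
Local Notation E := 'rV[R]_N.

(** The sigma-algebra is generated by the coordinates, so an open set has to be
written as a countable union of cubes with rational centres. *)
Lemma open_measurable_rV (U : set E) : open U -> measurable U.
Proof.
move=> oU.
pose F (p : 'rV[rat]_N * nat) : set E :=
  [set x | (forall i, `|x ord0 i - ratr (p.1 ord0 i)| < p.2.+1%:R^-1) /\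
     (forall y : E, (forall i, `|y ord0 i - ratr (p.1 ord0 i)| < p.2.+1%:R^-1) -> U y)].
have -> : U = \bigcup_p F p.
  apply/seteqP; split => [x Ux|x [p _ [xp pU]]]; last exact: pU.
  have : nbhs x U by move: oU; rewrite openE; exact.
  move=> /nbhs_ballP[e /= e0 eU].
  pose n := Num.trunc (2 / e).
  have n0 : n.+1%:R^-1 < e / 2.
    rewrite invf_plt ?posrE ?divr_gt0//.
    by rewrite invf_div; exact: truncnS_gt.
  have H i : exists q : rat, `|x ord0 i - ratr q| < n.+1%:R^-1.
    have /rat_in_itvoo[q] : x ord0 i - n.+1%:R^-1 < x ord0 i + n.+1%:R^-1.
      by rewrite ltrD2l gtrN// invr_gt0.
    rewrite in_itv/= => /andP[q1 q2]; exists q.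
    move: q1 q2; rewrite ltr_norml; set d := _^-1; set r := ratr _ => q1 q2.
    by apply/andP; split; lra.
  have [q Hq] := choice H.
  exists (\row_i q i, n) => //; split => /=.
    by move=> i; rewrite mxE.
  move=> y Hy; apply: eU; split => // i' i; rewrite (ord1 i').
  rewrite /ball/=; have := Hy i; rewrite mxE; have := Hq i.
  move: n0; set u := ratr _; set d := _^-1 => n0 h1 h2.
  have -> : x ord0 i - y ord0 i = (x ord0 i - u) - (y ord0 i - u) by ring.
  by rewrite (le_lt_trans (ler_normB _ _))//; move: n0 h1 h2; clear; move=> *; lra.
apply: countable_bigcupT_measurable => //.
move=> p; have [pU|pU] := pselect (forall y : E,
   (forall i, `|y ord0 i - ratr (p.1 ord0 i)| < p.2.+1%:R^-1) -> U y); last first.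
  by rewrite (_ : F p = set0)//; apply/seteqP; split => // x [].
rewrite (_ : F p = \bigcap_(i in [set: 'I_N])
   ((fun x : E => `|x ord0 i - ratr (p.1 ord0 i)|) @^-1` [set r : R | r < p.2.+1%:R^-1])); last first.
  by apply/seteqP; split => [x [Hx _] i _|x Hx]; [exact: Hx|split=> // i; exact: Hx].
apply: fin_bigcap_measurable => [|i _].
  exact: finite_finset.
rewrite -[_ @^-1` _]setTI.
have m1 : measurable_fun setT (fun x : E => `|x ord0 i - ratr (p.1 ord0 i)|).
  apply: measurableT_comp => //; apply: measurable_funB; last exact: measurable_cst.
  exact: measurable_coord.
apply: m1 => //.
rewrite (_ : [set r : R | _] = `]-oo, p.2.+1%:R^-1[%classic); first exact: measurable_itv.
by apply/seteqP; split => r /=; rewrite in_itv.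
Qed.

Lemma continuous_measurable_rV (f : E -> R) : continuous f -> measurable_fun setT f.
Proof.
move=> cf; apply: (measurability _ (RGenOInfty.measurableE R)).
move=> _ [_ [a ->]] <-; rewrite setTI; apply: open_measurable_rV.
by move/continuousP : cf; apply; exact: interval_open.
Qed.

Lemma coord_le_norm (v : E) i : `|v ord0 i| <= `|v|.
Proof.
have /mapP[j Hj ->] : `|v ord0 i| \in [seq `|v x.1 x.2| | x : 'I_1 * 'I_N].
  by apply/mapP; exists (ord0, i) => //=; rewrite mem_enum.
by rewrite [leRHS]/Num.Def.normr /= mx_normrE; apply/bigmax_geP; right => /=; exists j.
Qed.

Definition in_cube (K : R) : set E := [set x | forall i, `|x ord0 i| <= K].
Definition supported (th : E -> R) (K : R) := forall x, th x != 0 -> in_cube K x.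

Lemma in_cube_compact K : compact (in_cube K).
Proof.
rewrite (_ : in_cube K = [set v : E | forall i, v ord0 i \in `[- K, K]]).
  by apply: (@rV_compact _  _ (fun=> `[- K, K]%classic)) => _; exact: segment_compact.
by apply/seteqP; split => x /= H i; have := H i; rewrite in_itv/= ler_norml.
Qed.

Lemma in_cube_closed K : closed (in_cube K).
Proof. apply: compact_closed; [exact: norm_hausdorff|exact: in_cube_compact]. Qed.

(** A bound on the support is easier to propagate than compactness of its closure. *)
Lemma test_functionP (th : E -> R) :
  test_function th <-> Cinf th /\ exists K, supported th K.
Proof.
split=> [[Cth cth]|[Cth [K Kth]]]; split=> //.
  have [M [_ HM]] := compact_bounded cth.
  exists (M + 1) => x x0 i; apply: (le_trans (coord_le_norm x i)).
  by apply: (HM (M + 1)); [rewrite ltrDl|exact: subset_closure].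
apply: (@subclosed_compact _ _ (in_cube K)).
- exact: closed_closure.
- exact: in_cube_compact.
- have -> : in_cube K = closure (in_cube K) by apply/closure_id/in_cube_closed.
  exact: closure_subset.
Qed.

Lemma supported_partial (th : E -> R) K j :
  Cinf th -> supported th K -> supported (partial j th) K.
Proof.
move=> Cth Kth x; apply: contraNP => xK; apply/eqP.
apply: is_derive_partial.
apply: (@near_eq_is_derive _ _ _ (cst (0 : R))).
have oC : open (~` in_cube K) by apply: closed_openC; exact: in_cube_closed.
have : nbhs x (~` in_cube K) by apply: open_nbhs_nbhs; split.
by apply: filterS => y yK; have [->|/Kth] := eqVneq (th y) 0.
Qed.

Lemma supportedMr (th g : E -> R) K : supported th K -> supported (fun x => g x * th x) K.
Proof. by move=> Kth x; rewrite mulf_eq0 negb_or => /andP[_ /Kth]. Qed.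

Lemma supported_bounded (th : E -> R) K : continuous th -> supported th K ->
  exists M : R, 0 <= M /\ forall x, `|th x| <= M.
Proof.
move=> cth Kth.
have cK : compact (th @` in_cube K).
  apply: continuous_compact; last exact: in_cube_compact.
  exact: continuous_subspaceT.
have [M [_ HM]] := compact_bounded cK.
exists (Num.max (M + 1) 0); split; first by rewrite le_max lexx orbT.
move=> x; rewrite le_max; have [->|x0] := eqVneq (th x) 0.
  by rewrite normr0 lexx orbT.
by apply/orP; left; apply: (HM (M + 1)); [rewrite ltrDl|exists x => //; exact: Kth].
Qed.

Lemma derivs_expR : derivs (fun=> @expR R).
Proof. by move=> k x; exact: is_derive_expR. Qed.

Lemma derivs_cos : derivs (fun k => fun x : R => cos (x + k%:R * (pi / 2))).
Proof.
move=> k x.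
have -> : cos (x + k.+1%:R * (pi / 2)) = - sin (x + k%:R * (pi / 2)) * (1 + 0).
  by rewrite -natr1 mulrDl mul1r addrA cosDpihalf addr0 mulr1.
apply: (@is_derive1_comp _ cos (fun x : R => x + k%:R * (pi / 2))).
Qed.

Lemma poly_expR_bound (p : {poly R}) :
  exists C : R, forall t, 0 <= t -> `|p.[t]| <= C * expR t.
Proof.
have mon n (t : R) : 0 <= t -> t ^+ n <= n`!%:R * expR t.
  move=> t0; case: n => [|n].
    by rewrite expr0 fact0 mul1r -expR0 ler_expR.
  have := expR_ge1Dxn n t0.
  have f0 : 0 < (n.+1)`!%:R :> R by rewrite ltr0n fact_gt0.
  rewrite -(ler_pM2l f0) mulrDr mulr1 mulrCA divff ?gt_eqF// mulr1 => H.
  by apply: le_trans H; rewrite lerDr ltW.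
exists (\sum_(i < size p) `|p`_i| * i`!%:R) => t t0.
rewrite horner_coef (le_trans (ler_norm_sum _ _ _))// mulr_suml.
apply: ler_sum => i _; rewrite normrM -mulrA ler_wpM2l//.
by rewrite normrX (ger0_norm t0) mon.
Qed.

(** The derivatives of exp(-1/x) on x > 0, extended by 0, are exactly of this form. *)
Definition flat (p : {poly R}) (x : R) : R :=
  if 0 < x then p.[x^-1] * expR (- x^-1) else 0.

(** At the origin, exp(1/x) dominates every polynomial in 1/x, so that flat p is
bounded by a multiple of h^2. *)
Lemma is_derive_flat p (x : R) : is_derive x 1 (flat p) (flat ('X^2 * (p - p^`())) x).
Proof.
have [x0|x0|->] := ltgtP x 0.
- rewrite {2}/flat (lt_gtF x0).
  apply: (@near_eq_is_derive _ _ _ (cst (0 : R))).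
  have : \forall y \near x, y < 0 by exact: lt_nbhsl.
  by apply: filterS => y y0; rewrite /flat lt_gtF.
- rewrite {2}/flat x0.
  have x0' : x != 0 by rewrite gt_eqF.
  have dV : is_derive x 1 (fun y : R => y^-1) (- x ^- 2).
    have := @is_deriveV R id x 1 1 x0' (is_derive_id _ _).
    by rewrite /GRing.scale/= mulr1.
  have d1 := @is_derive1_comp _ (horner p) _ x _ _ (is_derive_poly p x^-1) dV.
  have d2 := @is_derive1_comp _ expR _ x _ _ (is_derive_expR _) (is_deriveN dV).
  have d3 := is_deriveM d1 d2.
  have nr : \forall y \near x, ((horner p \o (fun y : R => y^-1)) *
      (expR \o - (fun y : R => y^-1)))%R y = flat p y.
    have : \forall y \near x, 0 < y by exact: lt_nbhsr.
    by apply: filterS => y y0; rewrite /flat y0; reflexivity.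
  apply: (is_derive_eq (near_eq_is_derive nr d3)).
  by rewrite /GRing.scale/= !hornerE/= -exprVn; ring.
rewrite {2}/flat ltxx.
have [C HC] := poly_expR_bound ('X^2 * p).
have bd h : `|flat p h| <= C * h ^+ 2.
  have C0 : 0 <= C.
    have := HC 0 (lexx 0); rewrite expR0 mulr1; apply: le_trans; exact: normr_ge0.
  rewrite /flat; case: ifPn => h0; last first.
    by rewrite normr0 mulr_ge0// sqr_ge0.
  have h0' : 0 <= h^-1 by rewrite invr_ge0 ltW.
  have := HC _ h0'; rewrite hornerM hornerXn normrM.
  rewrite (ger0_norm (sqr_ge0 _)) => H; rewrite normrM (ger0_norm (expR_ge0 _)).
  have hp : 0 < h ^+ 2 by rewrite exprn_gt0.
  rewrite expRN -(ler_pM2r (expR_gt0 h^-1)) mulfVK ?gt_eqF ?expR_gt0//.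
  rewrite -(ler_pM2l (_ : 0 < h^-1 ^+ 2)); last by rewrite exprn_gt0// invr_gt0.
  have -> : h^-1 ^+ 2 * (C * h ^+ 2 * expR h^-1) = C * expR h^-1.
    by field; rewrite gt_eqF.
  exact: H.
have cv : h^-1 *: ((flat p \o shift 0) (h *: (1 : R)) - flat p 0) @[h --> (0 : R)^'] --> (0 : R).
  apply/norm_cvg0P.
  apply: (@squeeze_cvgr _ _ _ _ (cst 0) (fun h => C * `|h|)); first last.
  - rewrite -[X in _ --> X](mulr0 C); apply: cvgM; first exact: cvg_cst.
    have H : `|h| @[h --> (0 : R)] --> `|0 : R| by exact: norm_continuous.
    by rewrite normr0 in H; apply: cvg_trans H; apply: cvg_app; exact: nbhs_dnbhs.
  - exact: cvg_cst.
  near=> h; rewrite normr_ge0/= addr0 {2}/flat ltxx subr0 [h *: 1]mulr1 normrM normfV.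
  have h0 : 0 < `|h| by rewrite normr_gt0; near: h; exact: nbhs_dnbhs_neq.
  rewrite mulrC ler_pdivrMr// (le_trans (bd h))//.
  by rewrite -mulrA -expr2 real_normK ?num_real.
split; first by apply/cvg_ex; exists 0.
exact/cvg_lim.
Unshelve. all: by end_near. Qed.

(** The polynomial in 1/x of the k-th derivative of exp(-1/x). *)
Fixpoint flatpoly k : {poly R} :=
  if k is k'.+1 then 'X^2 * (flatpoly k' - (flatpoly k')^`()) else 1.

Lemma derivs_flat : derivs (fun k => flat (flatpoly k)).
Proof. by move=> k x; exact: is_derive_flat. Qed.

Lemma flat1_gt0 x : (0 < flat 1 x) = (0 < x).
Proof.
rewrite /flat; case: ifPn => x0; last by rewrite ltxx.
by rewrite hornerC mul1r expR_gt0.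
Qed.

Lemma flat1_eq0 x : ~~ (0 < x) -> flat 1 x = 0.
Proof. by rewrite /flat => /negbTE ->. Qed.

Definition box_bump (a b : E) (x : E) : R :=
  \prod_j (flat 1 (x ord0 j - a ord0 j) * flat 1 (b ord0 j - x ord0 j)).

Lemma smooth_bump a b : smooth (box_bump a b).
Proof.
apply: smooth_prod => j; apply: smoothM; apply: (smooth_comp 0 derivs_flat).
  by apply: smoothD; [exact: smooth_coord|exact: smooth_cst].
rewrite (_ : (fun x => _) = (fun x : E => b ord0 j + (-1) * x ord0 j)).
  apply: smoothD; first exact: smooth_cst.
  by apply: smoothM; [exact: smooth_cst|exact: smooth_coord].
by apply/funext => x; rewrite mulN1r.
Qed.

Definition obox (a b : E) : set E := [set x | forall j, a ord0 j < x ord0 j < b ord0 j].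

Lemma bump_gt0 a b x : obox a b x -> 0 < box_bump a b x.
Proof.
move=> H; apply: prodr_gt0 => j _; have /andP[h1 h2] := H j.
by rewrite mulr_gt0// flat1_gt0 subr_gt0.
Qed.

Lemma bump_eq0 a b x : ~ obox a b x -> box_bump a b x = 0.
Proof.
move=> /existsNP[j /negP]; rewrite negb_and => H.
rewrite /box_bump (bigD1 j)//=; case/orP : H => H.
  by rewrite (flat1_eq0 (x := x ord0 j - _)) ?mul0r// subr_gt0.
by rewrite (flat1_eq0 (x := _ - x ord0 j)) ?mulr0 ?mul0r// subr_gt0.
Qed.

Lemma bump_ge0 a b x : 0 <= box_bump a b x.
Proof.
by have [/bump_gt0/ltW//|/bump_eq0 ->] := pselect (obox a b x).
Qed.

(** Increases to the indicator of the box, as box_bump is positive on the box and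
zero elsewhere. *)
Definition sbump (a b : E) (n : nat) (x : E) : R := 1 - expR (- (n%:R * box_bump a b x)).

Lemma smooth_sbump a b n : smooth (sbump a b n).
Proof.
rewrite (_ : sbump a b n = (fun x : E => 1 + (-1) * expR ((- n%:R) * box_bump a b x))).
  apply: smoothD; first exact: smooth_cst.
  apply: smoothM; first exact: smooth_cst.
  apply: (smooth_comp 0 derivs_expR); apply: smoothM; first exact: smooth_cst.
  exact: smooth_bump.
by apply/funext => x; rewrite mulN1r mulNr.
Qed.

Lemma sbump_ge0_le1 a b n x : 0 <= sbump a b n x <= 1.
Proof.
rewrite /sbump subr_ge0 gerBl expR_ge0 andbT -expR0 ler_expR oppr_le0.
by rewrite mulr_ge0// bump_ge0.
Qed.

Lemma sbump_eq0 a b n x : ~ obox a b x -> sbump a b n x = 0.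
Proof. by move=> /bump_eq0 H; rewrite /sbump H mulr0 oppr0 expR0 subrr. Qed.

Lemma supported_sbump a b n : exists K, supported (sbump a b n) K.
Proof.
exists (\sum_j (`|a ord0 j| + `|b ord0 j|)) => x x0.
have /(_ _) H : obox a b x by apply: contrapT => /(sbump_eq0 n) /eqP; rewrite (negbTE x0).
move=> i; rewrite (bigD1 i)//=; have /andP[h1 h2] := H i.
have S0 : 0 <= \sum_(j < N | j != i) (`|a ord0 j| + `|b ord0 j|).
  by apply: sumr_ge0 => j _; rewrite addr_ge0.
have := ler_norm (b ord0 i); have := ler_norm (- a ord0 i); rewrite normrN.
have := normr_ge0 (a ord0 i); have := normr_ge0 (b ord0 i).
by rewrite ler_norml => *; apply/andP; split; lra.
Qed.

Lemma sbump_cvg a b x :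
  sbump a b n x @[n --> \oo] --> (\1_(obox a b) x : R).
Proof.
rewrite indicE; have [H|H] := pselect (obox a b x); last first.
  rewrite memNset//; under eq_fun do rewrite sbump_eq0//.
  exact: cvg_cst.
rewrite mem_set//; rewrite -[X in _ --> X](subr0 (1%:R : R)).
apply: cvgB; first exact: cvg_cst.
have b0 := bump_gt0 H.
have H1 : (expR (- box_bump a b x)) ^+ n @[n --> \oo] --> (0 : R).
  by apply: cvg_expr; rewrite ger0_norm ?expR_ge0// -expR0 ltr_expR oppr_lt0.
apply: cvg_trans H1; apply: near_eq_cvg; apply: nearW => n.
by rewrite -expRM_natl mulrN.
Qed.

End test_functions.

(** * Density of smooth functions *)

Import HBSimple HBNNSimple.

Section density.
Context {R : realType} {N : nat}.
Local Notation E := 'rV[R]_N.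
Local Notation mu := (@lebesgue_rV R N).
Local Notation sq := (l2sq mu). Local Notation L2 := (isL2 mu).
Local Notation dot := (l2dot mu). Local Notation sqcvg := (l2cvg mu).

Lemma ge0_cvge0P (u : nat -> \bar R) : (forall n, 0 <= u n)%E ->
  u n @[n --> \oo] --> (0 : \bar R) <->
  forall e : R, 0 < e -> \forall n \near \oo, (u n < e%:E)%E.
Proof.
move=> u0; split=> [cu e e0|H].
  have /fine_cvgP[fu cfu] := cu.
  have lu : \forall n \near \oo, (fine \o u) n < e by exact: (@cvgr_lt _ _ _ _ _ _ cfu _ e0).
  near=> n; rewrite -(@fineK _ (u n)); last by near: n.
  by rewrite lte_fin; near: n; exact: lu.
apply/fine_cvgP; split.
  by apply: filterS (H 1 ltr01) => n un; rewrite ge0_fin_numE// (lt_trans un)// ltry.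
apply/cvgr0Pnorm_lt => e e0; apply: filterS (H e e0) => n un.
have fn : u n \is a fin_num by rewrite ge0_fin_numE// (lt_trans un)// ltry.
by rewrite /= ger0_norm ?fine_ge0// -lte_fin fineK.
Unshelve. all: by end_near. Qed.

(** The functions on which the weak derivatives are tested and along whose rays one
can differentiate. *)
Definition nice (th : E -> R) := smooth th /\ exists K, supported th K.

Lemma nice_test th : nice th -> test_function th.
Proof. by move=> [[Cth _] sth]; apply/test_functionP. Qed.

Lemma mu_cube_finite n K : (@lebesgue_rV R n (in_cube K) < +oo)%E.
Proof.
elim: n => [|n IH]; first by rewrite /= diracE; case: (_ \in _); rewrite ?ltry.
rewrite /= /lebesgue_cons /pushforward.
have -> : @cons_row R n @^-1` in_cube K = `[- K, K]%classic `*` in_cube K.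
  apply/seteqP; split => [[r v] /= H|[r v] /= [Hr Hv] i].
    split; first by have := H ord0; rewrite cons_row0/= in_itv/= ler_norml.
    by move=> i; have := H (lift ord0 i); rewrite cons_rowS.
  case: (unliftP ord0 i) => [j|] ->; first by rewrite cons_rowS; exact: Hv.
  by rewrite cons_row0/=; move: Hr; rewrite in_itv/= ler_norml.
rewrite product_measure1E//; last first.
  have -> : in_cube K = \bigcap_(i in [set: 'I_n])
     ((fun x : 'rV[R]_n => x ord0 i) @^-1` `[- K, K]%classic).
    apply/seteqP; split => [x H i _|x H i] /=.
      by rewrite in_itv/= -ler_norml; exact: H.
    by have := H i I; rewrite /= in_itv/= ler_norml.
  apply: fin_bigcap_measurable => [|i _]; first exact: finite_finset.
  by rewrite -[_ @^-1` _]setTI; exact: measurable_coord.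
have LE : (@lebesgue_measure R [set` `[(- K)%R, K]] < +oo)%E.
  by rewrite lebesgue_measure_itv/=; case: ifPn => _; rewrite ?ltry.
by rewrite lte_mul_pinfty// ge0_fin_numE.
Qed.

Lemma in_cube_measurable K : measurable (in_cube K : set E).
Proof.
rewrite -[in_cube K]setCK; apply: measurableC; apply: open_measurable_rV.
by apply: closed_openC; exact: in_cube_closed.
Qed.

Lemma L2_indic (A : set E) K : measurable A -> A `<=` in_cube K ->
  L2 (\1_A : E -> R).
Proof.
move=> mA AK; split; first exact: measurable_indic.
rewrite /sq (_ : (fun x => _) = (fun x => (\1_A x)%:E)); last first.
  by apply/funext => x; rewrite indicE; case: (_ \in _); rewrite ?expr1n// expr0n.
rewrite integral_indic// setIT; apply: le_lt_trans (mu_cube_finite N K).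
by apply: le_measure => //; rewrite inE//; exact: in_cube_measurable.
Qed.

Lemma nice_L2 th : nice th -> L2 th.
Proof.
move=> [[Cth _] [K Kth]].
have cth := Cinf_continuous Cth.
have [M [M0 HM]] := supported_bounded cth Kth.
have mth := continuous_measurable_rV cth.
have H := L2_indic (in_cube_measurable K) (@subset_refl _ _).
apply: (L2_le mth (L2Z M H)); apply: aeW => x; rewrite indicE.
have [->|x0] := eqVneq (th x) 0; first by rewrite normr0.
by rewrite mem_set ?mulr1 ?(ger0_norm M0)//; exact: Kth.
Qed.

(** Membership in the closure of the nice functions; the density proof shows that
more and more functions belong to it. *)
Definition approx (f : E -> R) := L2 f /\ forall eps : R, 0 < eps ->
  exists2 th, nice th & (sq (fun x => f x - th x)%R < eps%:E)%E.

Lemma nice0 : nice (fun=> 0).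
Proof.
by split; [exact: smooth_cst|exists 0 => x; rewrite eqxx].
Qed.

Lemma niceD f g : nice f -> nice g -> nice (fun x => f x + g x).
Proof.
move=> [sf [K Kf]] [sg [K' Kg]]; split; first exact: smoothD.
exists (`|K| + `|K'|) => x fg0 i.
have K1 := ler_norm K; have K2 := ler_norm K'.
have K3 := normr_ge0 K; have K4 := normr_ge0 K'.
have [f0|/Kf/(_ i) f0] := eqVneq (f x) 0; last lra.
have /Kg/(_ i) g0 : g x != 0 by move: fg0; rewrite f0 add0r.
lra.
Qed.

Lemma niceMl m f : smooth m -> nice f -> nice (fun x => m x * f x).
Proof.
move=> sm [sf [K Kf]]; split; first exact: smoothM.
by exists K; exact: supportedMr.
Qed.

Lemma approx_nice th : nice th -> approx th.
Proof.
move=> nth; split; first exact: nice_L2.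
move=> eps e0; exists th => //.
rewrite /sq (_ : (fun x => _) = cst 0%E) ?integral0 ?lte_fin//.
by apply/funext => x; rewrite subrr expr0n.
Qed.

Lemma approx_lim f_ f : (forall n, approx (f_ n)) -> L2 f -> sqcvg f_ f -> approx f.
Proof.
move=> af_ Lf cf; split=> // eps e0.
have e4 : (0 < (eps / 4)%:E)%E by rewrite lte_fin divr_gt0.
have /filter_ex[n Hn] : \forall n \near \oo, (sq (fun x => f_ n x - f x)%R < (eps / 4)%:E)%E.
  by apply: (ge0_cvge0P _).1 => // k; exact: sq_ge0.
have [Lfn /(_ (eps / 4))[|th nth Hth]] := af_ n; first by rewrite divr_gt0.
exists th => //.
have Lth := nice_L2 nth.
have [mf _] := Lf; have [mfn _] := Lfn; have [mth _] := Lth.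
have -> : (fun x => f x - th x) = fun x => (-1) * (f_ n x - f x) + (f_ n x - th x).
  by apply/funext => x; ring.
apply: le_lt_trans (sqD _ _ _) _; [by mfun|by mfun|].
rewrite sqZ; last by mfun.
rewrite sqrrN expr1n mul1e.
have -> : eps%:E = (2%:E * (eps / 4)%:E + 2%:E * (eps / 4)%:E)%E.
  by rewrite -!EFinM -EFinD; congr EFin; lra.
by apply: lteD; rewrite lte_pmul2l.
Qed.

Lemma approxD f g : approx f -> approx g -> approx (fun x => f x + g x).
Proof.
move=> [Lf af] [Lg ag]; split; first exact: L2D.
move=> eps e0; have e4 : 0 < eps / 4 by rewrite divr_gt0.
have [th nth Hth] := af _ e4; have [et net Het] := ag _ e4.
exists (fun x => th x + et x); first exact: niceD.
have [mf _] := Lf; have [mg _] := Lg.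
have [mth _] := nice_L2 nth; have [met _] := nice_L2 net.
have -> : (fun x => f x + g x - (th x + et x)) = fun x => (f x - th x) + (g x - et x).
  by apply/funext => x; ring.
apply: le_lt_trans (sqD _ _ _) _; [by mfun|by mfun|].
have -> : eps%:E = (2%:E * (eps / 4)%:E + 2%:E * (eps / 4)%:E)%E.
  by rewrite -!EFinM -EFinD; congr EFin; lra.
by apply: lteD; rewrite lte_pmul2l.
Qed.

Lemma approxZ (c : R) f : approx f -> approx (fun x => c * f x).
Proof.
move=> [Lf af]; split; first exact: L2Z.
move=> eps e0; have e4 : 0 < eps / (c ^+ 2 + 1) by rewrite divr_gt0// ltr_pwDr ?sqr_ge0.
have [th nth Hth] := af _ e4.
exists (fun x => c * th x); first by apply: niceMl => //; exact: smooth_cst.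
have [mf _] := Lf; have [mth _] := nice_L2 nth.
have -> : (fun x => c * f x - c * th x) = fun x => c * (f x - th x).
  by apply/funext => x; ring.
rewrite sqZ; last by mfun.
have c0 := sqr_ge0 c.
apply: (@le_lt_trans _ _ ((c ^+ 2)%:E * (eps / (c ^+ 2 + 1))%:E)%E).
  by rewrite lee_wpmul2l ?lee_fin// ltW.
rewrite -EFinM lte_fin mulrCA gtr_pMr// ltr_pdivrMr; nra.
Qed.

Lemma approx_sum (I : Type) (r : seq I) (F : I -> E -> R) :
  (forall i, approx (F i)) -> approx (fun x => \sum_(i <- r) F i x).
Proof.
move=> LF; elim: r => [|i r IH].
  by under eq_fun do rewrite big_nil; apply: approx_nice; exact: nice0.
by under eq_fun do rewrite big_cons; exact: approxD.
Qed.

Lemma measurable_obox (a b : E) : measurable (obox a b).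
Proof.
have -> : obox a b = \bigcap_(i in [set: 'I_N])
     ((fun x : E => x ord0 i) @^-1` `]a ord0 i, b ord0 i[%classic).
  apply/seteqP; split => [x H i _|x H i] /=.
    by rewrite in_itv/=; exact: H.
  by have := H i I; rewrite /= in_itv.
apply: fin_bigcap_measurable => [|i _]; first exact: finite_finset.
by rewrite -[_ @^-1` _]setTI; exact: measurable_coord.
Qed.

Lemma obox_sub_cube (a b : E) : exists K, obox a b `<=` in_cube K.
Proof.
have [K HK] := @supported_sbump R N a b 1; exists K => x Hx; apply: HK.
rewrite /sbump gt_eqF// subr_gt0 -expR0 ltr_expR oppr_lt0 pmulr_rgt0//.
exact: bump_gt0.
Qed.

Lemma approx_obox a b : approx (\1_(obox a b) : E -> R).
Proof.
have [K KS] := obox_sub_cube a b; have mo := measurable_obox a b.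
have LI := L2_indic mo KS.
apply: (@approx_lim (sbump a b)) => //.
- move=> n; apply: approx_nice; split; first exact: smooth_sbump.
  exact: supported_sbump.
apply: (@sqcvg_dom _ _ _ _ _ _ (\1_(obox a b))) => //.
- move=> n; apply: continuous_measurable_rV; apply: Cinf_continuous.
  by have [] := smooth_sbump a b n.
- by move=> x; exact: sbump_cvg.
move=> n x; rewrite indicE; have [H|H] := pselect (obox a b x); last first.
  by rewrite memNset// sbump_eq0// subrr.
rewrite mem_set// normr1 distrC.
have /andP[h1 h2] := sbump_ge0_le1 a b n x.
by rewrite ger0_norm ?subr_ge0// gerBl.
Qed.

Definition oboxes : set (set E) := [set A | exists a b, A = obox a b].

Lemma obox_setI (a b a' b' : E) : obox a b `&` obox a' b' =
  obox (\row_i Num.max (a ord0 i) (a' ord0 i)) (\row_i Num.min (b ord0 i) (b' ord0 i)).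
Proof.
apply/seteqP; split => [x [H1 H2] i|x H].
  by have /andP[h1 h2] := H1 i; have /andP[h3 h4] := H2 i; rewrite !mxE gt_max lt_min h1 h2 h3.
by split=> i; have := H i; rewrite !mxE gt_max lt_min -!andbA => /and4P[h1 h2 h3 h4];
  apply/andP.
Qed.

Lemma oboxes_setI : setI_closed oboxes.
Proof.
move=> A B [a [b ->]] [a' [b' ->]]; rewrite obox_setI.
by eexists; eexists.
Qed.

Lemma measurable_oboxes : @measurable _ E = <<s oboxes >>.
Proof.
apply/seteqP; split.
  apply: smallest_sub; first exact: smallest_sigma_algebra.
  rewrite -bigcup_seq => A [i _ [B mB <-]].
  rewrite setTI.
  have mc : @measurable_fun _ _ (g_sigma_algebraType oboxes) R setT (fun x : E => x ord0 i).
    apply: (measurability _ (RGenOInfty.measurableE R)).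
    move=> _ [_ [c ->]] <-; rewrite setTI.
    have -> : (fun x : E => x ord0 i) @^-1` `]c, +oo[%classic = \bigcup_n
        obox (\row_j if j == i then c else - n%:R) (const_mx n%:R).
      apply/seteqP; split => [x /=|x [n _ /(_ i)]]; last first.
        by rewrite /= in_itv/= !mxE eqxx => /andP[->].
      rewrite in_itv/= andbT => cx; exists (Num.trunc (`|x|)).+1 => // j.
      rewrite !mxE.
      have := le_lt_trans (coord_le_norm x j) (truncnS_gt `|x|).
      rewrite ltr_norml => /andP[h1 h2]; rewrite h2 andbT.
      by case: ifPn => [/eqP ->|_].
    apply: bigcupT_measurable => n; apply: sub_sigma_algebra.
    by eexists; eexists.
  by rewrite -[X in _ X]setTI; exact: mc.
apply: smallest_sub; first exact: sigma_algebra_measurable.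
by move=> A [a [b ->]]; exact: measurable_obox.
Qed.

(** Open boxes are stable under intersection and generate the sigma-algebra, hence
Dynkin induction; the fixed box keeps all the sets in a region of finite
measure. *)
Lemma approx_indic (A : set E) a b : measurable A ->
  approx (\1_(A `&` obox a b) : E -> R).
Proof.
move=> mA; pose O := obox a b.
have mO := measurable_obox a b.
have LI (B : set E) : measurable B -> L2 (\1_(B `&` O) : E -> R).
  move=> mB; have [K HK] := obox_sub_cube a b.
  by apply: (@L2_indic _ K); [exact: measurableI|move=> x [_ /HK]].
have : <<s oboxes >> A by rewrite -measurable_oboxes.
apply: (@dynkin_induction _ E oboxes (fun A => approx (\1_(A `&` O) : E -> R))).
- exact: measurable_oboxes.
- exact: oboxes_setI.
- by rewrite setTI; exact: approx_obox.
- by move=> B [a' [b' ->]]; rewrite obox_setI; exact: approx_obox.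
- move=> S mS aS.
  rewrite (_ : \1_(_ `&` _) = (fun x => \1_O x + (-1) * \1_(S `&` O) x)).
    by apply: approxD; [exact: approx_obox|exact: approxZ].
  apply/funext => x; rewrite !indicE !in_setI in_setC.
  by case: (x \in S); case: (x \in O) => /=; ring.
move=> F mF tF aF.
apply: (@approx_lim (fun n x => \sum_(i < n) \1_(F i `&` O) x)).
- by move=> n; apply: approx_sum => i; exact: aF.
- by apply: LI; exact: bigcupT_measurable.
have key n x : ((\sum_(i < n) \1_(F i `&` O) x : R) = \1_(\bigcup_(i < n) F i `&` O) x).
  elim: n => [|n IH]; first by rewrite big_ord0 bigcup_mkord big_ord0 set0I indicE in_set0.
  rewrite big_ord_recr/= IH !indicE !in_setI.
  have -> : (x \in \bigcup_(i < n.+1) F i) = (x \in \bigcup_(i < n) F i) || (x \in F n).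
    by rewrite -in_setU; congr (_ \in _); rewrite !bigcup_mkord big_ord_recr.
  have [xn|xn] := boolP (x \in F n); last by rewrite orbF andFb addr0.
  rewrite orbT; have -> : (x \in \bigcup_(i < n) F i) = false.
    apply/negbTE; rewrite notin_setE => -[i /= ilt xi].
    move/trivIsetP : tF => /(_ i n I I); rewrite (ltn_eqF ilt) => /(_ isT) E0.
    have : (F i `&` F n) x by split=> //; exact/set_mem.
    by rewrite E0.
  by rewrite add0r.
apply: (@sqcvg_dom _ _ _ _ _ _ (\1_O)).
- move=> n; under eq_fun do rewrite key; apply: measurable_indic; apply: measurableI => //.
  by apply: bigcup_measurable => k _; exact: mF.
- by have [] := LI (\bigcup_k F k) (bigcupT_measurable _ mF).
- move=> x; have [[k _ Fkx]|nF] := pselect ((\bigcup_k F k) x); last first.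
    under eq_fun do rewrite key.
    rewrite (_ : (fun n => _) = cst (\1_(\bigcup_k F k `&` O) x)); first exact: cvg_cst.
    apply/funext => n; rewrite !indicE !in_setI (memNset nF).
    by rewrite memNset// => -[i _ Fi]; apply: nF; exists i.
  apply: cvg_near_cst; near=> n; rewrite key !indicE !in_setI.
  have -> : (x \in \bigcup_k F k) = true by apply: mem_set; exists k.
  rewrite mem_set//; exists k => //=.
  by near: n; exact: nbhs_infty_gt.
- by have := LI setT measurableT; rewrite setTI.
move=> n x; rewrite key !indicE !in_setI.
case: (x \in O); rewrite ?andbT ?andbF ?subrr ?normr0//.
case: (x \in \bigcup_(i < n) F i) => /=; case: (x \in \bigcup_i F i) => /=;
  by rewrite ?subrr ?subr0 ?sub0r ?normrN ?normr0 ?normr1.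
Unshelve. all: by end_near. Qed.

Lemma obox_exhaust (x : E) : \forall n \near \oo, obox (const_mx (- n%:R)) (const_mx n%:R) x.
Proof.
near=> n; move=> i; rewrite !mxE -ltr_norml (le_lt_trans (coord_le_norm x i))//.
near: n; exact: nbhs_infty_gtr.
Unshelve. all: by end_near. Qed.

(** Simple functions increasing to f, cut to growing boxes. *)
Lemma approx_ge0 (f : E -> R) : L2 f -> (forall x, 0 <= f x) -> approx f.
Proof.
move=> Lf f0; have [mf _] := Lf.
have mf' : measurable_fun setT (EFin \o f) by exact/measurable_EFinP.
pose g n : E -> R := nnsfun_approx measurableT mf' n.
pose O n : set E := obox (const_mx (- n%:R)) (const_mx n%:R).
have cg x : g n x @[n --> \oo] --> f x.
  have C : (EFin \o (fun n => g n x)) n @[n --> \oo] --> (f x)%:E.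
    by apply: (@cvg_nnsfun_approx _ _ _ _ measurableT _ mf') => // y _; rewrite lee_fin.
  exact: (fine_cvg C).
have gf n x : g n x <= f x.
  rewrite -(cvg_lim (@Rhausdorff R) (cg x)).
  apply: (@nondecreasing_cvgn_le _ (fun n => g n x)) => //.
  - by move=> m k mk; have /lefP := nd_nnsfun_approx measurableT mf' mk; apply.
  - by apply/cvg_ex; exists (f x); exact: cg.
have g0 n x : 0 <= g n x by exact: fun_ge0.
have mg n : measurable_fun setT (g n) by exact: measurable_funPT.
have mI n : measurable_fun setT (\1_(O n) : E -> R).
  by apply: measurable_indic; exact: measurable_obox.
apply: (@approx_lim (fun n x => g n x * \1_(O n) x)) => //.
  move=> n.
  rewrite (_ : (fun x => _) = fun x => \sum_(y <- finmap.enum_fset (fset_set (range (g n))))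
      y * \1_(g n @^-1` [set y] `&` O n) x); last first.
    apply/funext => x; rewrite /g fimfunE fsbig_finite//= mulr_suml.
    by apply: eq_bigr => y _; rewrite indicI mulrA.
  apply: approx_sum => y; apply: approxZ; apply: approx_indic.
  by rewrite -[_ @^-1` _]setTI; apply: mg.
apply: (@sqcvg_dom _ _ _ _ _ _ f) => //.
- by move=> n; mfun.
- move=> x; rewrite -[X in _ --> X]mulr1; apply: cvgM; first exact: cg.
  apply: cvg_near_cst; apply: filterS (obox_exhaust x) => n Hn.
  by rewrite indicE mem_set.
move=> n x; rewrite distrC (ger0_norm (f0 x)) ger0_norm.
  by rewrite gerBl mulr_ge0// indicE; case: (_ \in _).
by rewrite subr_ge0 (le_trans _ (gf n x))// indicE; case: (_ \in _);
  rewrite ?mulr1 ?mulr0.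
Qed.

Lemma nice_dense (f : E -> R) : L2 f -> approx f.
Proof.
move=> Lf; have [mf _] := Lf.
have mn : measurable_fun setT (fun x => `|f x|) by apply: measurableT_comp.
have Ln : L2 (fun x => `|f x|).
  by apply: (L2_le mn Lf); apply: aeW => x; rewrite normr_id.
have Lp := L2Z 2^-1 (L2D Ln Lf); have Lm := L2Z 2^-1 (L2B Ln Lf).
have -> : f = fun x => 2^-1 * (`|f x| + f x) + (-1) * (2^-1 * (`|f x| - f x)).
  by apply/funext => x; lra.
apply: approxD; [|apply: approxZ]; apply: approx_ge0 => // x.
  by have := ler_norm (- f x); rewrite normrN => h; rewrite mulr_ge0//; lra.
by have := ler_norm (f x) => h; rewrite mulr_ge0//; lra.
Qed.

Lemma nice_seq (f : E -> R) : L2 f -> exists th_ : nat -> E -> R,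
  (forall n, nice (th_ n)) /\ sqcvg th_ f.
Proof.
move=> Lf; have [_ af] := nice_dense Lf.
have H n : exists th, nice th /\ (sq (fun x => f x - th x)%R < (n.+1%:R^-1)%:E)%E.
  by have [|th nth Hth] := af n.+1%:R^-1; [|exists th].
have [th Hth] := choice H; exists th; split; first by move=> n; have [] := Hth n.
rewrite /l2cvg; apply/ge0_cvge0P => [n|e e0]; first exact: sq_ge0.
near=> n; apply: (@lt_trans _ _ (n.+1%:R^-1)%:E).
  have [nth Hn] := Hth n; have [mth _] := nice_L2 nth; have [mf _] := Lf.
  rewrite (_ : (fun x => _) = fun x => (-1) * (f x - th n x)); last first.
    by apply/funext => x; ring.
  by rewrite sqZ ?sqrrN ?expr1n ?mul1e//; mfun.
rewrite lte_fin invf_plt ?posrE//.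
near: n.
have : \forall n \near \oo, e^-1 < n%:R by exact: nbhs_infty_gtr.
by apply: filterS => n; move=> /lt_trans; apply; rewrite ltr_nat.
Unshelve. all: by end_near. Qed.

(** The fundamental lemma of the calculus of variations: approximate f itself. *)
Lemma dot_nice_eq0 (f : E -> R) : L2 f -> (forall th, nice th -> dot f th = 0) ->
  {ae mu, forall x, f x = 0}.
Proof.
move=> Lf H; have [th [nth cth]] := nice_seq Lf.
have : dot f (th n) @[n --> \oo] --> dot f f.
  apply: dot_cvg => //; [by move=> n; exact: nice_L2|exact: sqcvg_cst].
under eq_fun do rewrite H//.
move=> /(cvg_unique (@Rhausdorff R)) /(_ (cvg_cst _)) E0.
by apply/sq_eq0; [have [] := Lf|rewrite sqE// E0].
Qed.

(** The norm of f as a linear form on a dense subspace.  This is how weak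
information becomes norm convergence. *)
Lemma dot_nice_bound (f : E -> R) (M : R) : 0 <= M -> L2 f ->
  (forall th, nice th -> `|dot f th| <= M * Num.sqrt (dot th th)) ->
  Num.sqrt (dot f f) <= M.
Proof.
move=> M0 Lf H; have [th [nth cth]] := nice_seq Lf.
have Lth n := nice_L2 (nth n).
have c0 := sqcvg_cst mu f.
have c1 : dot f (th n) @[n --> \oo] --> dot f f by exact: dot_cvg.
have c2 : M * Num.sqrt (dot (th n) (th n)) @[n --> \oo] --> M * Num.sqrt (dot f f).
  apply: cvgM; first exact: cvg_cst.
  by apply: continuous_cvg; [exact: sqrt_continuous|exact: dot_cvg].
have key : dot f f <= M * Num.sqrt (dot f f).
  apply: (ler_cvg_to c1 c2); apply: nearW => n.
  by apply: le_trans (H _ (nth n)); exact: ler_norm.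
have := sqrtr_ge0 (dot f f); rewrite le_eqVlt => /predU1P[<-//|s0].
by rewrite -(ler_pM2r s0) -expr2 sqr_sqrtr// dot_ge0.
Qed.

End density.

(** * Weak derivatives and continuity of dilations *)

Section weak_derivatives.
Context {R : realType} {N : nat}.
Local Notation E := 'rV[R]_N.
Local Notation mu := (@lebesgue_rV R N).
Local Notation sq := (l2sq mu). Local Notation L2 := (isL2 mu).
Local Notation dot := (l2dot mu). Local Notation sqcvg := (l2cvg mu).
Implicit Types (f g h m th : E -> R).

(** Real functions are enough, as is_weak_partial splits into the real and the
imaginary part. *)
Definition wpart (j : 'I_N) f g := forall th, test_function th ->
  dot f (partial j th) = - dot g th.

Lemma test_Cinf th : test_function th -> Cinf th. Proof. by case. Qed.

Lemma test_supp th : test_function th -> exists K, supported th K.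
Proof. by move=> /test_functionP[]. Qed.

Lemma test_partial j th : test_function th -> test_function (partial j th).
Proof.
move=> /test_functionP[Cth [K Kth]]; apply/test_functionP; split.
  exact: Cinf_partial.
by exists K; exact: supported_partial.
Qed.

Lemma testM m th : Cinf m -> test_function th -> test_function (fun x => m x * th x).
Proof.
move=> Cm /test_functionP[Cth [K Kth]]; apply/test_functionP; split.
  by move=> k; exact: CkM.
by exists K; exact: supportedMr.
Qed.

Lemma test_scale (s : R) th : 0 < s -> test_function th ->
  test_function (fun x => th (s *: x)).
Proof.
move=> s0 /test_functionP[Cth [K Kth]]; apply/test_functionP; split.
  by move=> k; exact: Ck_scale.
exists (s^-1 * K) => x /Kth H i; have := H i; rewrite mxE normrM gtr0_norm//.
by move=> h; rewrite -(ler_pM2l s0) mulVKf ?gt_eqF.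
Qed.

Lemma Cinf_measurable th : Cinf th -> measurable_fun setT th.
Proof. by move=> /Cinf_continuous; exact: continuous_measurable_rV. Qed.

Lemma supp_L2 th K : continuous th -> supported th K -> L2 th.
Proof.
move=> cth Kth; have [M [M0 HM]] := supported_bounded cth Kth.
have mth := continuous_measurable_rV cth.
have H : L2 (\1_(in_cube K) : E -> R).
  by apply: (@L2_indic R N _ K) => //; exact: in_cube_measurable.
apply: (L2_le mth (L2Z M H)); apply: aeW => x; rewrite indicE.
have [->|x0] := eqVneq (th x) 0; first by rewrite normr0.
by rewrite mem_set ?mulr1 ?(ger0_norm M0)//; exact: Kth.
Qed.

Lemma test_L2 th : test_function th -> L2 th.
Proof.
by move=> /test_functionP[/Cinf_continuous Cth [K Kth]]; exact: supp_L2 Kth.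
Qed.

Lemma wpart_unique j f g h : L2 g -> L2 h -> wpart j f g -> wpart j f h ->
  {ae mu, forall x, g x = h x}.
Proof.
move=> Lg Lh wg wh.
have : {ae mu, forall x, g x - h x = 0}.
  apply: dot_nice_eq0; first exact: L2B.
  move=> th nth; have tth := nice_test nth; have Lth := nice_L2 nth.
  by rewrite dotBl// -[dot g th]opprK -wg// -[dot h th]opprK -wh// subrr.
by apply: filterS => x /eqP; rewrite subr_eq0 => /eqP.
Qed.

Lemma wpartD j f g f' g' : L2 f -> L2 g -> L2 f' -> L2 g' ->
  wpart j f g -> wpart j f' g' ->
  wpart j (fun x => f x + f' x) (fun x => g x + g' x).
Proof.
move=> Lf Lg Lf' Lg' w w' th tth.
have Lth := test_L2 tth; have Lp := test_L2 (test_partial j tth).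
by rewrite !dotDl// w// w'// opprD.
Qed.

Lemma wpartZ j (c : R) f g : L2 f -> L2 g -> wpart j f g ->
  wpart j (fun x => c * f x) (fun x => c * g x).
Proof.
move=> Lf Lg w th tth.
have Lth := test_L2 tth; have Lp := test_L2 (test_partial j tth).
by rewrite !dotZl// w// mulrN.
Qed.

Lemma wpart0 j : wpart j (fun=> 0) (fun=> 0).
Proof.
have z h : dot (fun=> 0) h = 0.
  rewrite /l2dot; under eq_Rintegral do rewrite mul0r.
  by rewrite Rintegral_cst// mul0r.
by move=> th _; rewrite !z oppr0.
Qed.

Lemma dot_mulA f m g : dot (fun x => m x * f x) g = dot f (fun x => m x * g x).
Proof. by apply: eq_Rintegral => x _; ring. Qed.

(** Leibniz' rule needs no bound on m, since test functions have compact support. *)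
Lemma wpartM j m f g : Cinf m -> L2 f -> L2 g -> wpart j f g ->
  wpart j (fun x => m x * f x) (fun x => m x * g x + partial j m x * f x).
Proof.
move=> Cm Lf Lg w th tth.
have Lth := test_L2 tth; have tp := test_partial j tth.
have Cth := test_Cinf tth.
have L1 := test_L2 (testM Cm tth).
have L2' := test_L2 (testM (Cinf_partial j Cm) tth).
have L3 := test_L2 (testM Cm tp).
rewrite dot_mulA.
have -> : (fun x => m x * partial j th x) =
    (fun x => partial j (fun x => m x * th x) x - partial j m x * th x).
  by apply/funext => x; rewrite partialM//; ring.
rewrite dotBr//; last exact: test_L2 (test_partial j (testM Cm tth)).
rewrite w; last exact: testM.
rewrite -opprD; congr (- _).
rewrite /l2dot -RintegralD//; [|exact: L2_integrable|exact: L2_integrable].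
by apply: eq_Rintegral => x _; ring.
Qed.

Lemma Rintegral_scale (s : R) (F : E -> R) : 0 < s ->
  mu.-integrable setT (EFin \o F) ->
  \int[mu]_x F (s *: x) = (s^-1) ^+ N * \int[mu]_x F x.
Proof.
move=> s0 iF; have [mF _] := integrableP _ _ _ iF.
rewrite /Rintegral.
have -> : (\int[mu]_x (F (s *: x))%:E = ((s^-1) ^+ N)%:E * \int[mu]_x (F x)%:E)%E.
  rewrite integralE [X in (_ * X)%E]integralE.
  have ms := @measurable_scale R N s.
  have p1 := @ge0_integral_scale R N s (fun x => (EFin \o F)^\+ x)%E s0.
  have p2 := @ge0_integral_scale R N s (fun x => (EFin \o F)^\- x)%E s0.
  have E1 : ((fun x => (F (s *: x))%:E)^\+ = (fun x => (EFin \o F)^\+ (s *: x)))%E.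
    by apply/funext => x; rewrite !funepos.unlock.
  have E2 : ((fun x => (F (s *: x))%:E)^\- = (fun x => (EFin \o F)^\- (s *: x)))%E.
    by apply/funext => x; rewrite !funeneg.unlock.
  rewrite E1 E2 p1; [|exact: measurable_funepos|by move=> x; exact: funepos_ge0].
  rewrite p2; [|exact: measurable_funeneg|by move=> x; exact: funeneg_ge0].
  have fa : (\int[mu]_x (EFin \o F)^\+ x)%E \is a fin_num.
    exact: integrable_pos_fin_num.
  have fb : (\int[mu]_x (EFin \o F)^\- x)%E \is a fin_num.
    exact: integrable_neg_fin_num.
  have -> : (fun x => (F x)%:E) = EFin \o F by [].
  move: fa fb; move: (\int[mu]_x _)%E (\int[mu]_x _)%E => [a| |] [b| |]// _ _.
  by rewrite muleBr.
by rewrite fineM//; exact: integrable_fin_num.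
Qed.

Lemma measurable_comp_scale f (s : R) : measurable_fun setT f ->
  measurable_fun setT (fun x : E => f (s *: x)).
Proof. by move=> mf; apply: measurableT_comp => //; exact: measurable_scale. Qed.

Lemma sq_scale f (s : R) : 0 < s -> measurable_fun setT f ->
  sq (fun x => f (s *: x)) = (((s^-1) ^+ N)%:E * sq f)%E.
Proof.
move=> s0 mf; rewrite /l2sq (@ge0_integral_scale R N s (fun x => (f x ^+ 2)%:E))//.
  exact: measurable_sq.
by move=> x; rewrite lee_fin sqr_ge0.
Qed.

Lemma L2_scale f (s : R) : 0 < s -> L2 f -> L2 (fun x => f (s *: x)).
Proof.
move=> s0 [mf Lf]; split; first exact: measurable_comp_scale.
rewrite sq_scale//; apply: lte_mul_pinfty => //.
by rewrite lee_fin exprn_ge0// invr_ge0 ltW.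
Qed.

Lemma dot_scale f g (s : R) : 0 < s -> L2 f -> L2 g ->
  dot (fun x => f (s *: x)) (fun x => g (s *: x)) = (s^-1) ^+ N * dot f g.
Proof.
by move=> s0 Lf Lg; rewrite /l2dot (@Rintegral_scale s (fun x => f x * g x))//;
  exact: L2_integrable.
Qed.

Lemma dot_scale1 f g (s : R) : 0 < s -> L2 f -> L2 g ->
  dot (fun x => f (s *: x)) g = (s^-1) ^+ N * dot f (fun x => g (s^-1 *: x)).
Proof.
move=> s0 Lf Lg; rewrite -dot_scale//; last by apply: L2_scale => //; rewrite invr_gt0.
by apply: eq_Rintegral => x _; rewrite scalerA mulVf ?gt_eqF// scale1r.
Qed.

Lemma wpart_scale j f g (s : R) : 0 < s -> L2 f -> L2 g -> wpart j f g ->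
  wpart j (fun x => f (s *: x)) (fun x => s * g (s *: x)).
Proof.
move=> s0 Lf Lg w th tth.
have s'0 : 0 < s^-1 by rewrite invr_gt0.
have tp := test_partial j tth; have Cth := test_Cinf tth.
have ts := test_scale s'0 tth.
rewrite dot_scale1//; last exact: test_L2.
rewrite dotZl; [|exact: L2_scale|exact: test_L2].
rewrite dot_scale1//; last exact: test_L2.
have -> : (fun x => partial j th (s^-1 *: x)) =
    (fun x => s * partial j (fun x => th (s^-1 *: x)) x).
  by apply/funext => x; rewrite partial_scale// mulVKf ?gt_eqF.
rewrite dotZr//; last exact: test_L2 (test_partial j ts).
by rewrite w//; ring.
Qed.

Lemma sqcvg_nice_scale th (s_ : nat -> R) (a c : R) : nice th -> 0 < c ->
  (forall n, c <= s_ n) -> c <= a -> s_ n @[n --> \oo] --> a ->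
  sqcvg (fun n x => th (s_ n *: x)) (fun x => th (a *: x)).
Proof.
move=> [[Cth _] [K Kth]] c0 cs ca cvs.
have cth := Cinf_continuous Cth; have mth := Cinf_measurable Cth.
have [M [M0 HM]] := supported_bounded cth Kth.
have H : L2 (\1_(in_cube (c^-1 * K)) : E -> R).
  by apply: (@L2_indic R N _ (c^-1 * K)) => //; exact: in_cube_measurable.
have key s x : c <= s -> `|th (s *: x)| <= M * \1_(in_cube (c^-1 * K)) x.
  move=> cls; have s0 : 0 < s by exact: lt_le_trans cls.
  have [->|x0] := eqVneq (th (s *: x)) 0; first by rewrite normr0 mulr_ge0.
  rewrite indicE mem_set ?mulr1// => i; have := Kth _ x0 i.
  rewrite mxE normrM gtr0_norm// => h; rewrite -(ler_pM2l c0) mulVKf ?gt_eqF//.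
  by apply: le_trans h; rewrite ler_wpM2r.
apply: (sqcvg_dom _ _ _ (L2Z (2 * M) H)).
- by move=> n; exact: measurable_comp_scale.
- exact: measurable_comp_scale.
- move=> x; apply: (continuous_cvg _ (cth (a *: x))).
  by apply: cvgZr_tmp.
move=> n x; rewrite (le_trans (ler_normB _ _))//.
apply: le_trans (ler_norm _).
by rewrite -mulrA [2 * _]mulrDl mul1r lerD// key.
Qed.

(** Dilations with factors bounded below are bounded operators, so it is enough to
have continuity on the dense subspace of nice functions. *)
Lemma sqcvg_scale f (s_ : nat -> R) (a c : R) : L2 f -> 0 < c ->
  (forall n, c <= s_ n) -> c <= a -> s_ n @[n --> \oo] --> a ->
  sqcvg (fun n x => f (s_ n *: x)) (fun x => f (a *: x)).
Proof.
move=> Lf c0 cs ca cvs; have [mf _] := Lf.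
have a0 : 0 < a by exact: lt_le_trans ca.
have s0 n : 0 < s_ n by exact: lt_le_trans (cs n).
apply/ge0_cvge0P => [n|e e0]; first exact: sq_ge0.
pose C := (c^-1) ^+ N.
have C0 : 0 < C by rewrite exprn_gt0// invr_gt0.
have [_ /(_ (e / (16 * C)))[|th nth Hth]] := nice_dense Lf.
  by rewrite divr_gt0// mulr_gt0.
have [mth _] := nice_L2 nth.
have := sqcvg_nice_scale nth c0 cs ca cvs.
move=> /(ge0_cvge0P _).1 => /(_ (fun n => sq_ge0 _ _)) /(_ (e / 4)) H.
have {}H := H (divr_gt0 e0 (ltr0n _ 4)).
apply: filterS H => n Hn.
have bd s : c <= s -> (sq (fun x => f (s *: x) - th (s *: x))%R <= (e / 16)%:E)%E.
  move=> cls; have s'0 : 0 < s by exact: lt_le_trans cls.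
  rewrite (@sq_scale (fun x => f x - th x))//; last by mfun.
  apply: (@le_trans _ _ (C%:E * (e / (16 * C))%:E)%E).
    apply: lee_pmul.
    - by rewrite lee_fin exprn_ge0// invr_ge0 ltW.
    - exact: sq_ge0.
    - have sc : s^-1 <= c^-1 by rewrite lef_pV2 ?posrE.
      by rewrite lee_fin lerXn2r ?nnegrE ?invr_ge0 ?(ltW c0) ?(ltW s'0).
    - exact: ltW.
  rewrite -EFinM lee_fin (_ : C * _ = e / 16)//.
  by field; rewrite gt_eqF.
have ms := measurable_comp_scale.
have mfs := ms _ (s_ n) mf; have mfa := ms _ a mf.
have mts := ms _ (s_ n) mth; have mta := ms _ a mth.
have -> : (fun x => f (s_ n *: x) - f (a *: x)) = (fun x =>
   ((f (s_ n *: x) - th (s_ n *: x)) + (-1) * (f (a *: x) - th (a *: x))) +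
   (th (s_ n *: x) - th (a *: x))) by apply/funext => x; ring.
apply: le_lt_trans (sqD _ _ _) _; [by mfun|by mfun|].
have -> : e%:E = (2%:E * (e / 4)%:E + 2%:E * (e / 4)%:E)%E.
  by rewrite -!EFinM -EFinD; congr EFin; lra.
set S1 := sq _.
have S1e : (2%:E * S1 <= 2%:E * (e / 4)%:E)%E.
  rewrite lee_pmul2l//; apply: le_trans (sqD _ _ _) _; [by mfun|by mfun|].
  rewrite sqZ; last by mfun.
  rewrite sqrrN expr1n mul1e.
  have -> : (e / 4)%:E = (2%:E * (e / 16)%:E + 2%:E * (e / 16)%:E)%E.
    by rewrite -!EFinM -EFinD; congr EFin; lra.
  by apply: leeD; rewrite lee_pmul2l//; apply: bd.
apply: lee_ltD => //; last by rewrite lte_pmul2l.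
rewrite ge0_fin_numE; last by rewrite mule_ge0// sq_ge0.
by apply: le_lt_trans S1e _; rewrite -EFinM ltry.
Qed.

Lemma sqcvg_mul_scale f (A_ : nat -> E -> R) (A : E -> R) (M : R) (s_ : nat -> R) (a c : R) :
  L2 f -> 0 < c -> (forall n, c <= s_ n) -> c <= a -> s_ n @[n --> \oo] --> a ->
  (forall n, measurable_fun setT (A_ n)) -> measurable_fun setT A ->
  (forall n x, `|A_ n x| <= M) -> (forall x, A_ n x @[n --> \oo] --> A x) ->
  sqcvg (fun n x => A_ n x * f (s_ n *: x)) (fun x => A x * f (a *: x)).
Proof.
move=> Lf c0 cs ca cvs mA_ mA AM cA.
apply: (sqcvg_mulr mA_ mA AM cA _ (L2_scale (lt_le_trans c0 ca) Lf)).
  by move=> n; apply: measurable_comp_scale; case: Lf.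
exact: (sqcvg_scale Lf c0 cs ca cvs).
Qed.

End weak_derivatives.

(** * Differentiating dilations *)

(** Convergence theorems for integrals are about sequences.  A failing epsilon would
provide a sequence along which the property fails. *)
Lemma seq_eps_delta {R : realType} (D : R -> Prop) (a : R) (F : R -> \bar R) :
  (forall s_ : nat -> R, (forall n, D (s_ n)) -> s_ n @[n --> \oo] --> a ->
     forall e : R, 0 < e -> \forall n \near \oo, (F (s_ n) < e%:E)%E) ->
  forall e : R, 0 < e -> exists2 d : R, 0 < d &
    forall s, D s -> `|s - a| < d -> (F s < e%:E)%E.
Proof.
move=> H e e0; apply: contrapT => nH.
have {}nH n : exists s, [/\ D s, `|s - a| < n.+1%:R^-1 & ~ (F s < e%:E)%E].
  apply: contrapT => nE; apply: nH; exists n.+1%:R^-1; first by rewrite invr_gt0.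
  by move=> s Ds sa; apply: contrapT => Fs; apply: nE; exists s.
have [s_ Hs] := choice nH.
have cs : s_ n @[n --> \oo] --> a.
  apply/cvgrPdist_lt => d d0; near=> n.
  have [_ h _] := Hs n; rewrite distrC (lt_trans h)// invf_plt ?posrE//.
  near: n.
  have : \forall n \near \oo, d^-1 < n%:R by exact: nbhs_infty_gtr.
  by apply: filterS => n; move=> /lt_trans; apply; rewrite ltr_nat.
have Ds n : D (s_ n) by have [] := Hs n.
have /filter_ex[n Hn] := H s_ Ds cs e e0.
by have [_ _] := Hs n.
Unshelve. all: by end_near. Qed.

Lemma seq_is_derive {R : realType} (k : R -> R) (a c d : R) : c < a ->
  (forall s_ : nat -> R, (forall n, s_ n != a) -> (forall n, c <= s_ n) ->
    s_ n @[n --> \oo] --> a ->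
    (k (s_ n) - k a) / (s_ n - a) @[n --> \oo] --> d) ->
  is_derive a 1 k d.
Proof.
move=> ca H.
have cv : h^-1 *: ((k \o shift a) (h *: (1 : R)) - k a) @[h --> (0 : R)^'] --> d.
  apply/cvgrPdist_lt => e e0.
  have [|dl dl0 Hd] := @seq_eps_delta R (fun s => s != a /\ c <= s) a
     (fun s => `|(k s - k a) / (s - a) - d|%:E) _ e e0.
    move=> s_ Ds cs e' e'0.
    have := H s_ (fun n => (Ds n).1) (fun n => (Ds n).2) cs.
    move=> /cvgrPdist_lt/(_ _ e'0); apply: filterS => n.
    by rewrite lte_fin distrC.
  near=> h.
  have h0 : h != 0 by near: h; exact: nbhs_dnbhs_neq.
  rewrite distrC -lte_fin.
  have -> : h^-1 *: ((k \o shift a) (h *: (1 : R)) - k a) =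
     (k (h + a) - k a) / ((h + a) - a).
    by rewrite /= [h *: 1]mulr1 addrK mulrC.
  apply: Hd; last first.
    rewrite addrK; near: h.
    have : \forall h \near (0 : R), `|h| < dl.
      by apply/nbhs_ballP; exists dl => //= y; rewrite /ball/= sub0r normrN.
    exact: nbhs_dnbhs.
  split; first by rewrite -subr_eq0 addrK.
  have : `|h| < a - c.
    near: h.
    have : \forall h \near (0 : R), `|h| < a - c.
      apply/nbhs_ballP; exists (a - c); first by rewrite /= subr_gt0.
      by move=> y; rewrite /ball/= sub0r normrN.
    exact: nbhs_dnbhs.
  by rewrite ltr_norml => /andP[h1 h2]; lra.
split; first by apply/cvg_ex; exists d.
exact/cvg_lim.
Unshelve. all: by end_near. Qed.

Lemma is_derive_seq {R : realType} (k : R -> R) (a d : R) (s_ : nat -> R) :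
  is_derive a 1 k d -> (forall n, s_ n != a) -> s_ n @[n --> \oo] --> a ->
  (k (s_ n) - k a) / (s_ n - a) @[n --> \oo] --> d.
Proof.
move=> [dk <-] sa cs.
have cv : h^-1 *: ((k \o shift a) (h *: (1 : R)) - k a) @[h --> (0 : R)^'] --> 'D_1 k a.
  exact: dk.
apply/cvgrPdist_lt => e e0.
have /cvgrPdist_lt/(_ _ e0) := cv.
rewrite near_withinE => /nbhs_ballP[dl /= dl0 Hd].
have /cvgrPdist_lt/(_ _ dl0) := cs; apply: filterS => n hn.
have h0 : s_ n - a != 0 by rewrite subr_eq0.
have := Hd (s_ n - a) _ h0; rewrite /ball/= sub0r normrN distrC => /(_ hn).
by rewrite [_ *: 1]mulr1 subrK [_ *: _]mulrC.
Qed.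

Section dilations.
Context {R : realType} {N : nat}.
Local Notation E := 'rV[R]_N.
Local Notation mu := (@lebesgue_rV R N).
Local Notation sq := (l2sq mu). Local Notation L2 := (isL2 mu).
Local Notation dot := (l2dot mu). Local Notation sqcvg := (l2cvg mu).
Implicit Types (f g h m th : E -> R).

(** The derivative at s = 1 of s |-> f(s x), for g the gradient of f. *)
Definition euler (g : 'I_N -> E -> R) (x : E) : R := \sum_j x ord0 j * g j x.

Lemma euler_scale (g : 'I_N -> E -> R) (s : R) (x : E) : s != 0 ->
  \sum_j x ord0 j * g j (s *: x) = s^-1 * euler g (s *: x).
Proof.
move=> s0; rewrite /euler mulr_sumr; apply: eq_bigr => j _.
by rewrite mxE !mulrA mulVf// mul1r.
Qed.

Lemma nice_test_parts th : nice th -> test_function th /\ smooth th.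
Proof. by move=> nth; split; [exact: nice_test|case: nth]. Qed.

Lemma test_coordM j th : test_function th -> test_function (fun x => x ord0 j * th x).
Proof. by apply: testM => k; exact: Ck_coord. Qed.

Lemma test_sum (F : 'I_N -> E -> R) : (forall j, test_function (F j)) ->
  test_function (fun x => \sum_j F j x).
Proof.
move=> tF; apply/test_functionP; split.
  by move=> k; apply: Ck_sum => j; case: (tF j).
have H j : exists K, supported (F j) K by exact: test_supp.
have [K HK] := choice H.
exists (\sum_j `|K j|) => x x0.
have [j Fj] : exists j, F j x != 0.
  apply: contrapT => nF; move/negP : x0; apply.
  rewrite big1// => j _; apply/eqP; apply: contrapT => /negP Fj.
  by apply: nF; exists j.
move=> i; have := HK j x Fj i; move/le_trans; apply.
rewrite (bigD1 j)//= (le_trans (ler_norm _))// lerDl.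
exact: sumr_ge0.
Qed.

(** Pointwise this is the derivative along rays; the mean value theorem bounds the
quotients by a fixed square-integrable function. *)
Lemma sqcvg_nice_derive th (s_ : nat -> R) (a c : R) : nice th -> 0 < c ->
  (forall n, s_ n != a) ->
  (forall n, c <= s_ n) -> c <= a -> s_ n @[n --> \oo] --> a ->
  sqcvg (fun n x => (s_ n - a)^-1 * (th (s_ n *: x) - th (a *: x)))
        (fun x => a^-1 * euler (fun j => partial j th) (a *: x)).
Proof.
move=> nth c0 sa cs ca cvs; have [tth sth] := nice_test_parts nth.
have a0 : a != 0 by rewrite gt_eqF// (lt_le_trans c0).
pose H := euler (fun j => partial j th).
have tH : test_function H.
  by apply: test_sum => j; apply: test_coordM; exact: test_partial.
have [K KH] := test_supp tH.
have cH := Cinf_continuous (test_Cinf tH).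
have mH := Cinf_measurable (test_Cinf tH).
have mth := Cinf_measurable (test_Cinf tth).
have [M [M0 HM]] := supported_bounded cH KH.
have LI : L2 (\1_(in_cube (c^-1 * K)) : E -> R).
  by apply: (@L2_indic R N _ (c^-1 * K)) => //; exact: in_cube_measurable.
have der x (s : R) : s != 0 -> is_derive s 1 (fun s => th (s *: x)) (s^-1 * H (s *: x)).
  by move=> s0; rewrite -euler_scale//; exact: smooth_ray.
have bd x (s : R) : c <= s -> `|s^-1 * H (s *: x)| <= (c^-1 * M) * \1_(in_cube (c^-1 * K)) x.
  move=> cls; have s0 : 0 < s by exact: lt_le_trans cls.
  have [->|x0] := eqVneq (H (s *: x)) 0.
    by rewrite mulr0 normr0 mulr_ge0// mulr_ge0// invr_ge0 ltW.
  rewrite indicE mem_set ?mulr1.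
    rewrite normrM ler_pM// gtr0_norm ?invr_gt0// lef_pV2 ?posrE//.
  move=> i; have := KH _ x0 i.
  rewrite mxE normrM gtr0_norm// => h; rewrite -(ler_pM2l c0) mulVKf ?gt_eqF//.
  by apply: le_trans h; rewrite ler_wpM2r.
have mvt x (s : R) : c <= s -> s != a ->
   `|(s - a)^-1 * (th (s *: x) - th (a *: x))| <= (c^-1 * M) * \1_(in_cube (c^-1 * K)) x.
  move=> cls sna.
  have cont (u v : R) : {within `[u, v], continuous (fun s => th (s *: x))}.
    apply: continuous_subspaceT => z.
    by apply: differentiable_continuous; apply/derivable1_diffP;
      have [] := smooth_ray x z sth.
  have [lt|lt|eq] := ltgtP s a; last by rewrite eq eqxx in sna.
    have [|z] := MVT lt _ (cont s a) (df := fun s => s^-1 * H (s *: x)).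
      move=> z; rewrite in_itv/= => /andP[z1 z2].
      by apply: der; rewrite gt_eqF// (lt_trans _ z1)// (lt_le_trans c0).
    rewrite in_itv/= => /andP[z1 z2] E1.
    have -> : th (s *: x) - th (a *: x) = z^-1 * H (z *: x) * (s - a).
      by rewrite -[LHS]opprK opprB E1; ring.
    rewrite mulrC mulfK ?subr_eq0//.
    by apply: bd; rewrite (le_trans cls)// ltW.
  have [|z] := MVT lt _ (cont a s) (df := fun s => s^-1 * H (s *: x)).
    move=> z; rewrite in_itv/= => /andP[z1 z2].
    by apply: der; rewrite gt_eqF// (lt_trans _ z1)// (lt_le_trans c0).
  rewrite in_itv/= => /andP[z1 z2] E1.
  rewrite E1 mulrC mulfK ?subr_eq0//.
  by apply: bd; rewrite (le_trans ca)// ltW.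
apply: (sqcvg_dom _ _ _ (L2Z (2 * (c^-1 * M)) LI)).
- move=> n; have := measurable_comp_scale (s_ n) mth; have := measurable_comp_scale a mth.
  by move=> ? ?; mfun.
- by have := measurable_comp_scale a mH => ?; mfun.
- move=> x; have := is_derive_seq (der x a a0) sa cvs.
  by under eq_fun do rewrite mulrC.
move=> n x; rewrite (le_trans (ler_normB _ _))//; apply: le_trans (ler_norm _).
by rewrite -mulrA [2 * _]mulrDl mul1r lerD//; [exact: mvt|exact: bd].
Qed.

Variables (f : E -> R) (g : 'I_N -> E -> R).
Hypotheses (Lf : L2 f) (Lg : forall j, L2 (g j)) (wg : forall j, wpart j f (g j)).

Lemma is_derive_dot_dilated th (r : R) : nice th -> 0 < r ->
  is_derive r 1 (fun r => dot f (fun x => th (r *: x)))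
    (dot f (fun x => r^-1 * euler (fun j => partial j th) (r *: x))).
Proof.
move=> nth r0; have [tth sth] := nice_test_parts nth.
have Lth := test_L2 tth.
have c0 : 0 < r / 2 by rewrite divr_gt0.
have cr : r / 2 < r by rewrite ltr_pdivrMr// ltr_pMr// ltr1n.
have tH : test_function (euler (fun j => partial j th)).
  by apply: test_sum => j; apply: test_coordM; exact: test_partial.
apply: (seq_is_derive cr) => s_ sa cs cvs.
have s0 n : 0 < s_ n by exact: lt_le_trans (cs n).
have := @dot_cvg _ _ _ mu (fun=> f) f _ _ (fun=> Lf) Lf _ _ _
  (sqcvg_nice_derive nth c0 sa cs (ltW cr) cvs).
have LQ n : L2 (fun x => (s_ n - r)^-1 * (th (s_ n *: x) - th (r *: x))).
  by apply: L2Z; apply: L2B; apply: L2_scale.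
have LH : L2 (fun x => r^-1 * euler (fun j => partial j th) (r *: x)).
  by apply: L2Z; apply: (L2_scale r0); exact: test_L2.
have cf := sqcvg_cst mu f.
move=> /(_ LQ LH cf).
apply: cvg_trans; apply: near_eq_cvg; apply: nearW => n.
have La := L2_scale (s0 n) Lth; have Lb := L2_scale r0 Lth.
rewrite dotZr//; last exact: L2B.
by rewrite dotBr// mulrC.
Qed.

(** Move the dilation to the nice function, differentiate there, and integrate by
parts with the test functions x_j th(x/s).  The derivative of the Jacobian
s^(-N) cancels the divergence of the field x. *)
Lemma is_derive_dilated_dot th (s : R) : nice th -> 0 < s ->
  is_derive s 1 (fun s => dot (fun x => f (s *: x)) th)
    (\sum_j dot (fun x => g j (s *: x)) (fun x => x ord0 j * th x)).
Proof.
move=> nth s0; have [tth sth] := nice_test_parts nth.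
have Lth := test_L2 tth.
have r0 : 0 < s^-1 by rewrite invr_gt0.
set r := s^-1 in r0 *.
have dP := is_derive_dot_dilated nth r0.
have dX : is_derive r 1 (fun r : R => r ^+ N) (N%:R * r ^+ N.-1).
  have -> : (fun r : R => r ^+ N) = (id : R -> R) ^+ N.
    by apply/funext => y; rewrite exprfctE.
  have := @is_deriveX R R id N r 1 1 (is_derive_id _ _).
  by rewrite /GRing.scale/= mulr1.
have dM := is_deriveM dX dP.
have dV : is_derive s 1 (fun y : R => y^-1) (- s ^- 2).
  have := @is_deriveV R id s 1 1 (lt0r_neq0 s0) (is_derive_id _ _).
  by rewrite /GRing.scale/= mulr1.
have dC := @is_derive1_comp _ _ (fun y : R => y^-1) s _ _ dM dV.
have ts := test_scale r0 tth; have Cth := test_Cinf tth.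
have tc j := test_coordM j ts.
have pE j x : partial j (fun x => x ord0 j * th (r *: x)) x =
    th (r *: x) + x ord0 j * (r * partial j th (r *: x)).
  rewrite partialM; [|by move=> k; exact: Ck_coord|exact: test_Cinf].
  rewrite partial_scale// (is_derive_partial (is_derive_coord j j x)) eqxx mulr1.
  by rewrite addrC.
have key : \sum_j dot (g j) (fun x => x ord0 j * th (r *: x)) =
  - (N%:R * dot f (fun x => th (r *: x)) +
     r * dot f (fun x => r^-1 * euler (fun j => partial j th) (r *: x))).
  have LH : L2 (fun x => r^-1 * euler (fun j => partial j th) (r *: x)).
    apply: L2Z; apply: (L2_scale r0); apply: test_L2.
    by apply: test_sum => j; apply: test_coordM; exact: test_partial.
  have Lts := test_L2 ts.
  have -> : \sum_j dot (g j) (fun x => x ord0 j * th (r *: x)) =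
      \sum_j - dot f (partial j (fun x => x ord0 j * th (r *: x))).
    by apply: eq_bigr => j _; rewrite (wg j (tc j)) opprK.
  rewrite sumrN; congr (- _); rewrite -!dotZr// -dotDr//; [|exact: L2Z..].
  under eq_bigr do rewrite dotC.
  rewrite -dot_suml//; last by move=> j; exact: test_L2 (test_partial j (tc j)).
  rewrite dotC; congr dot; apply/funext => x.
  rewrite mulVKf ?lt0r_neq0//.
  under eq_bigr do rewrite pE.
  rewrite big_split/= sumr_const card_ord mulr_natl; congr (_ + _).
  by rewrite /euler; apply: eq_bigr => j _; rewrite mxE; ring.
have nr : \forall y \near s, (((fun r : R => r ^+ N) *
     (fun r => dot f (fun x => th (r *: x)))) \o (fun y : R => y^-1)) y =
     dot (fun x => f (y *: x)) th.
  have : \forall y \near s, 0 < y by exact: lt_nbhsr.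
  by apply: filterS => y y0; rewrite dot_scale1.
apply: (is_derive_eq (near_eq_is_derive nr dC)).
rewrite /GRing.scale/= -/r.
have -> : \sum_j dot (fun x => g j (s *: x)) (fun x => x ord0 j * th x) =
   r ^+ N * (r * \sum_j dot (g j) (fun x => x ord0 j * th (r *: x))).
  rewrite !mulr_sumr; apply: eq_bigr => j _.
  rewrite dot_scale1//; last exact: test_L2 (test_coordM j tth).
  congr (_ * _); rewrite -dotZr//; last exact: test_L2.
  by congr dot; apply/funext => x; rewrite mxE -/r; ring.
rewrite key -exprVn -/r; set A := dot f _; set B := dot f _.
have H : (N%:R * r ^+ N.-1 : R) * r = N%:R * r ^+ N.
  by case: (N) => [|n] /=; rewrite ?mul0r// exprSr mulrA.
transitivity (- r * (r * (r ^+ N * A) + B * ((N%:R * r ^+ N.-1 : R) * r))); first by ring.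
by rewrite H; ring.
Qed.

Lemma sum_dot_euler th (s : R) : test_function th -> 0 < s ->
  \sum_j dot (fun x => g j (s *: x)) (fun x => x ord0 j * th x) =
  dot (fun x => s^-1 * euler g (s *: x)) th.
Proof.
move=> tth s0.
have [_ <-] := has_integral_sum (index_enum 'I_N)
  (fun j => has_integral_dot (L2_scale s0 (Lg j)) (test_L2 (test_coordM j tth))).
apply: eq_Rintegral => x _; rewrite -euler_scale ?gt_eqF// mulr_suml.
by apply: eq_bigr => j _; ring.
Qed.

Hypothesis Lh : L2 (euler g).

Let dh (s : R) x := s^-1 * euler g (s *: x).

Let L2_dh (s : R) : 0 < s -> L2 (dh s).
Proof. by move=> s0; apply: L2Z; apply: L2_scale. Qed.

(** By the mean value theorem, the pairing of a difference quotient with th is the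
pairing of th with a dilate of the Euler derivative, for an intermediate factor
z that depends on th.  Continuity of dilations makes the choice of z harmless,
and dot_nice_bound concludes. *)
Lemma sqcvg_dilation_derive (s_ : nat -> R) (a c : R) : 0 < c ->
  (forall n, s_ n != a) -> (forall n, c <= s_ n) -> c <= a ->
  s_ n @[n --> \oo] --> a ->
  sqcvg (fun n x => (s_ n - a)^-1 * (f (s_ n *: x) - f (a *: x)))
        (fun x => a^-1 * euler g (a *: x)).
Proof.
move=> c0 sa cs ca cvs.
have a0 : 0 < a by exact: lt_le_trans ca.
have s0 n : 0 < s_ n by exact: lt_le_trans (cs n).
have [mh _] := Lh.
have cont (t_ : nat -> R) : (forall n, c <= t_ n) -> t_ n @[n --> \oo] --> a ->
    forall e : R, 0 < e -> \forall n \near \oo,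
      (sq (fun x => dh (t_ n) x - dh a x)%R < e%:E)%E.
  move=> ct cvt; apply: (ge0_cvge0P _).1; first by move=> n; exact: sq_ge0.
  apply: (@sqcvg_mul_scale R N (euler g) (fun n _ => (t_ n)^-1) (fun=> a^-1) c^-1 t_ a c) => //.
    move=> n x; have t0 : 0 < t_ n by exact: lt_le_trans (ct n).
    by rewrite gtr0_norm ?invr_gt0// lef_pV2 ?posrE.
  by move=> x; apply: cvgV => //; rewrite gt_eqF.
apply/ge0_cvge0P => [n|e e0]; first exact: sq_ge0.
have e2 : 0 < e / 2 by rewrite divr_gt0.
have [d d0 Hd] := @seq_eps_delta R (fun s => c <= s) a
   (fun s => sq (fun x => dh s x - dh a x)%R) cont _ e2.
have /cvgrPdist_lt/(_ _ d0) := cvs; apply: filterS => n; rewrite distrC => nd.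
set Q := fun x => (s_ n - a)^-1 * (f (s_ n *: x) - f (a *: x)).
have Lfs := L2_scale (s0 n) Lf; have Lfa := L2_scale a0 Lf.
have LQ : L2 Q by apply: L2Z; apply: L2B.
have LF : L2 (fun x => Q x - dh a x) by apply: L2B => //; exact: L2_dh.
suff : Num.sqrt (dot (fun x => Q x - dh a x) (fun x => Q x - dh a x)) <= Num.sqrt (e / 2).
  rewrite ler_sqrt ?dot_ge0 ?(ltW e2)// => H.
  by rewrite [X in (X < _)%E](sqE LF) lte_fin (le_lt_trans H)// ltr_pdivrMr// ltr_pMr// ltr1n.
apply: dot_nice_bound => //.
move=> th nth; have Lth := nice_L2 nth; have tth := nice_test nth.
pose k s := dot (fun x => f (s *: x)) th.
have dk (s : R) : 0 < s -> is_derive s 1 k (dot (dh s) th).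
  by move=> s'0; rewrite /dh -sum_dot_euler//; exact: is_derive_dilated_dot.
have kc (u v : R) : 0 < u -> {within `[u, v], continuous k}.
  move=> u0; apply: derivable_within_continuous => z; rewrite in_itv/= => /andP[uz _].
  by have [] := dk z (lt_le_trans u0 uz).
have [z [cz zd E1]] : exists z, [/\ c <= z, `|z - a| < d & dot Q th = dot (dh z) th].
  have [lt|lt|eq] := ltgtP (s_ n) a; last by have := sa n; rewrite eq eqxx.
    have [|z] := MVT lt _ (kc _ _ (s0 n)) (df := fun s => dot (dh s) th).
      by move=> z; rewrite in_itv/= => /andP[z1 z2]; apply: dk; exact: lt_trans z1.
    rewrite in_itv/= => /andP[z1 z2] E1; exists z; split.
    - by rewrite (le_trans (cs n))// ltW.
    - by move: nd; rewrite !ltr0_norm ?subr_lt0//; lra.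
    rewrite dotZl//; last exact: L2B.
    rewrite dotBl// -/(k _) -/(k a).
    have -> : k (s_ n) - k a = dot (dh z) th * (s_ n - a).
      by rewrite -[LHS]opprK opprB E1; ring.
    by rewrite mulrC mulfK ?subr_eq0.
  have [|z] := MVT lt _ (kc _ _ a0) (df := fun s => dot (dh s) th).
    by move=> z; rewrite in_itv/= => /andP[z1 z2]; apply: dk; exact: lt_trans z1.
  rewrite in_itv/= => /andP[z1 z2] E1; exists z; split.
  - by rewrite (le_trans ca)// ltW.
  - by move: nd; rewrite !gtr0_norm ?subr_gt0//; lra.
  rewrite dotZl//; last exact: L2B.
  by rewrite dotBl// -/(k _) -/(k a) E1 mulrC mulfK ?subr_eq0.
have z0 : 0 < z by exact: lt_le_trans cz.
have Lz := L2_dh z0; have La := L2_dh a0.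
rewrite dotBl// E1 -dotBl//.
apply: le_trans (cauchy_schwarz (L2B Lz La) Lth) _.
rewrite ler_wpM2r ?sqrtr_ge0// ler_wsqrtr//.
have := Hd z cz zd; rewrite [X in (X < _)%E](sqE (L2B Lz La)) lte_fin.
exact: ltW.
Qed.

End dilations.

(** * Integration by parts for the Euler derivative *)

Section integration_by_parts.
Context {R : realType} {N : nat}.
Local Notation E := 'rV[R]_N.
Local Notation mu := (@lebesgue_rV R N).
Local Notation L2 := (isL2 mu).
Local Notation dot := (l2dot mu).

(** The pairing of f(s x) with f'(s x) is s^(-N) times the pairing of f with f';
differentiate at s = 1. *)
Lemma euler_by_parts (f f' : E -> R) (g g' : 'I_N -> E -> R) :
  L2 f -> L2 f' -> (forall j, L2 (g j)) -> (forall j, L2 (g' j)) ->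
  (forall j, wpart j f (g j)) -> (forall j, wpart j f' (g' j)) ->
  L2 (euler g) -> L2 (euler g') ->
  dot (euler g) f' + dot f (euler g') + N%:R * dot f f' = 0.
Proof.
move=> Lf Lf' Lg Lg' wg wg' Lh Lh'.
pose s_ n : R := 1 + n.+1%:R^-1.
have cs : s_ n @[n --> \oo] --> (1 : R).
  rewrite -[X in _ --> X]addr0; apply: cvgD; first exact: cvg_cst.
  exact: cvg_harmonic.
have s1 n : 1 <= s_ n by rewrite lerDl invr_ge0.
have s1' n : s_ n != 1 by rewrite gt_eqF// ltrDl invr_gt0.
have s0 n : 0 < s_ n by exact: lt_le_trans (s1 n).
have D1 := sqcvg_dilation_derive Lf Lg wg Lh ltr01 s1' s1 (lexx 1) cs.
have D2 := sqcvg_dilation_derive Lf' Lg' wg' Lh' ltr01 s1' s1 (lexx 1) cs.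
have D3 := sqcvg_scale Lf' ltr01 s1 (lexx 1) cs.
have e1 (h : E -> R) : (fun x => (1 : R)^-1 * h (1 *: x)) = h.
  by apply/funext => x; rewrite invr1 mul1r scale1r.
have e2 (h : E -> R) : (fun x => h ((1 : R) *: x)) = h.
  by apply/funext => x; rewrite scale1r.
have cf := sqcvg_cst mu f.
rewrite e1 in D1; rewrite e1 in D2; rewrite e2 in D3.
have LQ (F : E -> R) n : L2 F -> L2 (fun x => (s_ n - 1)^-1 * (F (s_ n *: x) - F (1 *: x))).
  by move=> LF; apply: L2Z; apply: L2B; apply: L2_scale.
have Lfs n := L2_scale (s0 n) Lf'; have Lfs' n := L2_scale (s0 n) Lf.
have C1 := dot_cvg (fun n => LQ f n Lf) Lh Lfs Lf' D1 D3.
have C2 := dot_cvg (fun=> Lf) Lf (fun n => LQ f' n Lf') Lh' cf D2.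
have C3 := cvgD C1 C2.
have dV : is_derive (1 : R) 1 (fun y : R => y^-1) (- 1 ^- 2).
  have := @is_deriveV R id 1 1 1 (oner_neq0 _) (is_derive_id _ _).
  by rewrite /GRing.scale/= mulr1.
have dX : is_derive ((1 : R)^-1) 1 (fun r : R => r ^+ N) (N%:R * (1^-1) ^+ N.-1).
  have -> : (fun r : R => r ^+ N) = (id : R -> R) ^+ N.
    by apply/funext => y; rewrite exprfctE.
  have := @is_deriveX R R id N (1^-1) 1 1 (is_derive_id _ _).
  by rewrite /GRing.scale/= mulr1.
have dC := @is_derive1_comp _ _ (fun y : R => y^-1) 1 _ _ dX dV.
have C4 := cvgM (is_derive_seq dC s1' cs) (cvg_cst (dot f f')).
have E1 : (fun n => dot (fun x => (s_ n - 1)^-1 * (f (s_ n *: x) - f (1 *: x))) (fun x => f' (s_ n *: x)) +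
   dot f (fun x => (s_ n - 1)^-1 * (f' (s_ n *: x) - f' (1 *: x)))) =
   (fun n => (((fun r : R => r ^+ N) \o (fun y : R => y^-1)) (s_ n) - ((fun r : R => r ^+ N) \o (fun y : R => y^-1)) 1)
     / (s_ n - 1) * dot f f').
  apply/funext => n; have := dot_scale (s0 n) Lf Lf'.
  have L1 := L2_scale ltr01 Lf; have L1' := L2_scale ltr01 Lf'.
  rewrite /= dotZl ?dotZr//; [|exact: L2B..].
  by rewrite dotBl// dotBr// (e2 f) (e2 f') => ->; rewrite invr1 expr1n; ring.
have C3' : (fun n => dot (fun x => (s_ n - 1)^-1 * (f (s_ n *: x) - f (1 *: x))) (fun x => f' (s_ n *: x)) +
   dot f (fun x => (s_ n - 1)^-1 * (f' (s_ n *: x) - f' (1 *: x)))) n @[n --> \oo] -->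
   dot (euler g) f' + dot f (euler g') by exact: C3.
rewrite E1 in C3'.
have := cvg_unique (@Rhausdorff R) C3' (C4 _ _) => ->.
by rewrite invr1 !expr1n invr1; ring.
Qed.

(** With zero gradients, integration by parts of the Euler derivative leaves N
times the square of the norm. *)
Lemma gradient_eq0 (f : E -> R) (g : 'I_N -> E -> R) : (0 < N)%N ->
  L2 f -> (forall j, L2 (g j)) -> (forall j, wpart j f (g j)) ->
  (forall j, {ae mu, forall x, g j x = 0}) -> {ae mu, forall x, f x = 0}.
Proof.
move=> N0 Lf Lg wg g0.
have h0 : {ae mu, forall x, euler g x = 0}.
  have : \forall x \ae mu, forall j, g j x = 0 by apply: filter_forall.
  by apply: filterS => x gx; rewrite /euler big1// => j _; rewrite gx mulr0.
have mh : measurable_fun setT (euler g).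
  apply: measurable_sum => j; apply: measurable_funM; first exact: measurable_coord.
  by have [] := Lg j.
have Lh : L2 (euler g).
  by apply: (L2_le mh (L20 mu)); apply: filterS h0 => x ->.
have := euler_by_parts Lf Lf Lg Lg wg wg Lh Lh.
have z : dot (euler g) f = 0.
  rewrite (ae_eq_dot (f2 := fun=> 0) (g2 := f))//; last 2 first.
  - exact: L20.
  - exact: aeW.
  by rewrite /l2dot; under eq_Rintegral do rewrite mul0r; rewrite Rintegral_cst// mul0r.
rewrite [dot f _]dotC z !add0r => /eqP; rewrite mulf_eq0 pnatr_eq0 gtn_eqF//= => /eqP f0.
by apply/sq_eq0; [have [] := Lf|rewrite sqE// f0].
Qed.

End integration_by_parts.

(** * Null sets and averages along rays *)

Section ae_swap.
Context {R : realType} d1 d2 (T1 : measurableType d1) (T2 : measurableType d2).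
Variables (m1 : {sigma_finite_measure set T1 -> \bar R})
  (m2 : {sigma_finite_measure set T2 -> \bar R}).

(** By Tonelli, both statements say that A is a null set of the product. *)
Lemma ae_swap (A : set (T1 * T2)) : measurable A ->
  {ae m1, forall x, {ae m2, forall y, ~ A (x, y)}} ->
  {ae m2, forall y, {ae m1, forall x, ~ A (x, y)}}.
Proof.
move=> mA H.
pose F (z : T1 * T2) : \bar R := (\1_A z)%:E.
have mF : measurable_fun setT F by apply/measurable_EFinP; exact: measurable_indic.
have F0 z : (0 <= F z)%E by rewrite lee_fin.
have aE (d : measure_display) (T : measurableType d) (m : {measure set T -> \bar R}) (G : T -> \bar R) :
    measurable_fun setT G -> (forall x, 0 <= G x)%E ->
    (\int[m]_x G x = 0)%E <-> {ae m, forall x, G x = 0%E}.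
  move=> mG G0; have := @ae_eq_integral_abs _ _ _ m setT measurableT _ mG.
  have -> : (\int[m]_x `|G x|)%E = (\int[m]_x G x)%E.
    by apply: eq_integral => x _; rewrite gee0_abs.
  by move=> ->; split; apply: filterS => x; [apply|move=> Gx _].
have E := @fubini_tonelli _ _ _ _ _ m1 m2 F mF F0.
have mF1 : measurable_fun setT (fun x => \int[m2]_y F (x, y))%E.
  exact: (@measurable_fun_fubini_tonelli_F _ _ _ _ _ m2 _ mF).
have mF2 : measurable_fun setT (fun y => \int[m1]_x F (x, y))%E.
  exact: (@measurable_fun_fubini_tonelli_G _ _ _ _ _ m1 _ mF).
have z1 : (\int[m1]_x \int[m2]_y F (x, y) = 0)%E.
  apply/aE => //; first by move=> x; exact: integral_ge0.
  apply: filterS H => x Hx; apply/aE => //.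
    by apply: (measurableT_comp mF); exact: measurable_pair1.
  by apply: filterS Hx => y nA; rewrite /F indicE memNset.
have /aE : (\int[m2]_y \int[m1]_x F (x, y) = 0)%E by rewrite -E.
move=> /(_ mF2) /(_ (fun y => integral_ge0 _ (fun x _ => F0 (x, y)))).
apply: filterS => y /aE.
have mFy : measurable_fun setT (fun x => F (x, y)).
  by apply: (measurableT_comp mF); exact: measurable_pair2.
move=> /(_ mFy) /(_ (fun x => F0 (x, y))).
apply: filterS => x; rewrite /F indicE => Fxy Axy.
by move: Fxy; rewrite mem_set//= => -[] /eqP; rewrite oner_eq0.
Qed.

End ae_swap.

Section rays.
Context {R : realType} {N : nat}.
Local Notation E := 'rV[R]_N.
Local Notation mu := (@lebesgue_rV R N).
Local Notation leb := (@lebesgue_measure R).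
Local Notation sq := (l2sq mu). Local Notation L2 := (isL2 mu).
Local Notation dot := (l2dot mu). Local Notation sqcvg := (l2cvg mu).

Lemma measurable_scale2 : measurable_fun [set: R * E] (fun z => z.1 *: z.2).
Proof.
apply/measurable_fun_coordP => i; under eq_fun do rewrite mxE.
apply: measurable_funM; first exact: measurable_fst.
by apply: (measurableT_comp (measurable_coord i)); exact: measurable_snd.
Qed.

Lemma measurable_comp_scale2 (h : E -> R) : measurable_fun setT h ->
  measurable_fun [set: R * E] (fun z => h (z.1 *: z.2)).
Proof. by move=> mh; apply: (measurableT_comp mh); exact: measurable_scale2. Qed.

Lemma ae_scale (P : E -> Prop) (s : R) : 0 < s -> {ae mu, forall x, P x} ->
  {ae mu, forall x, P (s *: x)}.
Proof.
move=> s0 [A [mA A0 PA]]; exists ((fun x => s *: x) @^-1` A); split.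
- by rewrite -[_ @^-1` _]setTI; exact: measurable_scale.
- have mi : measurable_fun [set: E] (fun x => (\1_A x : R)%:E).
    by apply/measurable_EFinP; exact: measurable_indic.
  have := @ge0_integral_scale R N s (fun x => (\1_A x)%:E) s0 mi.
  have -> : (\int[mu]_x (\1_A x)%:E = 0)%E by rewrite integral_indic// setIT.
  rewrite mule0 => <-; last by move=> x; rewrite lee_fin.
  rewrite (_ : (fun x => _) = (fun x => (\1_((fun x => s *: x) @^-1` A) x : R)%:E)).
    by rewrite integral_indic ?setIT// -[_ @^-1` _]setTI; exact: measurable_scale.
  by apply/funext => x.
by move=> x nP; apply: PA.
Qed.

Lemma ae_scale1 (P : R -> Prop) (s : R) : 0 < s -> {ae leb, forall x, P x} ->
  {ae leb, forall x, P (s * x)}.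
Proof.
move=> s0 [A [mA A0 PA]]; exists (( *%R s) @^-1` A); split.
- by rewrite -[_ @^-1` _]setTI; exact: measurable_realfun.mulrl_measurable.
- by rewrite lebesgue_measure_scale// [X in (_ * X)%E]A0 mule0.
- by move=> x nP; apply: PA.
Qed.

(** Dilations preserve null sets for each factor; exchange the quantifiers. *)
Lemma ae_ray (P : E -> Prop) : {ae mu, forall x, P x} ->
  {ae mu, forall x, {ae leb, forall s, 0 < s -> P (s *: x)}}.
Proof.
move=> [A [mA A0 PA]].
pose B : set (R * E) := [set z | 0 < z.1 /\ A (z.1 *: z.2)].
have mB : measurable B.
  have -> : B = (fst @^-1` `]0, +oo[%classic) `&` ((fun z : R * E => z.1 *: z.2) @^-1` A).
    by apply/seteqP; split => z; rewrite /B/= in_itv/= andbT.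
  apply: measurableI; rewrite -[_ @^-1` _]setTI; first exact: measurable_fst.
  exact: measurable_scale2.
have := @ae_swap R _ _ (measurableTypeR R) E leb mu B mB.
have H : {ae leb, forall s, {ae mu, forall x, ~ B (s, x)}}.
  apply: aeW => s; have [s0|s0] := ltP 0 s; last first.
    by apply: aeW => x [/=]; rewrite ltNge s0.
  have aA : {ae mu, forall x, ~ A x}.
    by exists A; split => // x /contrapT.
  by apply: filterS (ae_scale s0 aA) => x nA [_].
move=> /(_ H); apply: filterS => x; apply: filterS => s nB s0.
by apply: contrapT => nP; apply: nB; split => //; exact: PA.
Qed.

(** By Tonelli, some factor s works for almost every x; dilate back by s. *)
Lemma ray_ae (A : set E) : measurable A ->
  {ae mu, forall x, {ae leb, forall s, 0 < s -> ~ A (s *: x)}} ->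
  {ae mu, forall x, ~ A x}.
Proof.
move=> mA H.
pose B : set (E * R) := [set z | 0 < z.2 /\ A (z.2 *: z.1)].
have mB : measurable B.
  have -> : B = (snd @^-1` `]0, +oo[%classic) `&`
      ((fun z : E * R => z.2 *: z.1) @^-1` A).
    by apply/seteqP; split => z; rewrite /B/= in_itv/= andbT.
  apply: measurableI; rewrite -[_ @^-1` _]setTI; first exact: measurable_snd.
  have ms : measurable_fun [set: E * R] (fun z => z.2 *: z.1).
    apply/measurable_fun_coordP => i; under eq_fun do rewrite mxE.
    apply: measurable_funM; first exact: measurable_snd.
    by apply: (measurableT_comp (measurable_coord i)); exact: measurable_fst.
  exact: ms.
have := @ae_swap R _ _ E (measurableTypeR R) mu leb B mB.
have H' : {ae mu, forall x, {ae leb, forall s : measurableTypeR R, ~ B (x, s)}}.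
  apply: filterS H => x [Z [mZ Z0 HZ]]; exists Z; split => // s nB; apply: HZ => h.
  by apply: nB => -[/= s0]; exact: h.
move=> /(_ H') [Z [mZ Z0 BZ]].
have [s [/andP[s1 s2] ns]] : exists s : R, (1 < s < 2) /\ ~ Z s.
  apply: contrapT => nE.
  have : (leb [set` `]1%R, 2%R[] <= leb Z)%E.
    apply: le_measure; rewrite ?inE//.
    move=> s /=; rewrite in_itv/= => h; apply: contrapT => nZ; apply: nE.
    by exists s.
  rewrite [X in (_ <= X)%E -> _]Z0 lebesgue_measure_itv/= lte_fin ltr1n.
  by rewrite -EFinB lee_fin; lra.
have s0 : 0 < s by lra.
have : {ae mu, forall x, ~ B (x, s)} by apply: contrapT => nB; apply: ns; exact: BZ.
have s'0 : 0 < s^-1 by rewrite invr_gt0.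
move=> /(ae_scale s'0); apply: filterS => x nB Ax; apply: nB; split => //=.
by rewrite scalerA divff ?gt_eqF// scale1r.
Qed.

(** Extend the hypothesis to square-integrable functions by density, then take the
sign of F times the positive part of |F| - D. *)
Lemma ae_dominated (F D : E -> R) : L2 F -> L2 D -> (forall x, 0 <= D x) ->
  (forall th, nice th -> `|dot F th| <= dot (fun x => `|th x|) D) ->
  {ae mu, forall x, `|F x| <= D x}.
Proof.
move=> LF LD D0 H; have [mF _] := LF; have [mD _] := LD.
have mabs (th : E -> R) : measurable_fun setT th -> measurable_fun setT (fun x => `|th x|).
  by move=> mt; apply: measurableT_comp.
have Labs (th : E -> R) : L2 th -> L2 (fun x => `|th x|).
  by move=> Lt; apply: (L2_le _ Lt); [apply: mabs; case: Lt|apply: aeW => x; rewrite normr_id].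
have {}H th : L2 th -> `|dot F th| <= dot (fun x => `|th x|) D.
  move=> Lt; have [t_ [nt ct]] := nice_seq Lt.
  have Lt_ n := nice_L2 (nt n).
  have cc (h : E -> R) := sqcvg_cst mu h.
  have C1 : `|dot F (t_ n)| @[n --> \oo] --> `|dot F th|.
    by apply: cvg_norm; exact: (dot_cvg (fun=> LF) LF Lt_ Lt (cc F) ct).
  have ca : sqcvg (fun n x => `|t_ n x|) (fun x => `|th x|).
    apply: (@sqcvg_le _ _ _ _ _ _ t_ th 1) => //.
    - by move=> n; apply: mabs; case: (Lt_ n).
    - by apply: mabs; case: Lt.
    - by move=> n; case: (Lt_ n).
    - by case: Lt.
    by move=> n x; rewrite mul1r; exact: ler_dist_dist.
  have C2 := dot_cvg (fun n => Labs _ (Lt_ n)) (Labs _ Lt) (fun=> LD) LD ca (cc D).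
  apply: (ler_cvg_to C1 C2); apply: nearW => n; exact: H.
(* positive part of |F| - D *)
pose pos x := 2^-1 * (`| `|F x| - D x | + (`|F x| - D x)).
have Lpos : L2 pos by apply: L2Z; apply: L2D; [apply: (Labs)|]; apply: L2B => //; exact: (Labs).
have [mpos _] := Lpos.
have mlt : measurable_fun setT (fun x => if 0 <= F x then 1 else -1 : R).
  apply: measurable_fun_ifT => //.
  apply: measurable_fun_ler => //; exact: measurable_cst.
pose th x := (if 0 <= F x then 1 else -1) * pos x.
have Lth : L2 th.
  apply: (L2_bounded (M := 1)) => // x; case: ifP => _; rewrite ?normrN normr1//.
have pos0 x : 0 <= pos x.
  rewrite mulr_ge0// ?invr_ge0//.
  by have := ler_norm (- (`|F x| - D x)); rewrite normrN; lra.
have := H th Lth.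
have -> : (fun x => `|th x|) = pos.
  apply/funext => x; rewrite /th normrM (ger0_norm (pos0 x)).
  by case: ifP => _; rewrite ?normrN normr1 mul1r.
have -> : dot F th = dot (fun x => `|F x|) pos.
  apply: eq_Rintegral => x _; rewrite /th; case: ifPn => F0.
    by rewrite mul1r (ger0_norm F0).
  by rewrite mulN1r mulrN -mulNr ltr0_norm// ltNge.
rewrite ger0_norm; last by apply: Rintegral_ge0 => x _; rewrite mulr_ge0.
rewrite [X in _ <= X]dotC -subr_le0 -dotBl//; last exact: Labs.
have -> : dot (fun x => `|F x| - D x) pos = dot pos pos.
  apply: eq_Rintegral => x _; rewrite /pos.
  have [h|h] := leP 0 (`|F x| - D x).
    by rewrite (ger0_norm h); lra.
  by rewrite (ltr0_norm h) addNr mulr0 !mulr0.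
move=> p0; have : dot pos pos = 0 by apply/eqP; rewrite eq_le p0 dot_ge0.
move=> E0; have : {ae mu, forall x, pos x = 0} by apply/sq_eq0 => //; rewrite sqE// E0.
apply: filterS => x; rewrite /pos => /eqP.
rewrite mulf_eq0 invr_eq0 pnatr_eq0/= => /eqP.
have := normr_ge0 (`|F x| - D x); lra.
Qed.

Lemma abs_Rintegral_le (F : E -> R) : mu.-integrable setT (EFin \o F) ->
  (`|\int[mu]_x F x|%:E <= \int[mu]_x `|F x|%:E)%E.
Proof.
move=> iF; rewrite EFin_normr_Rintegral//.
apply: (le_trans (le_abse_integral mu measurableT _)).
  by have [] := integrableP _ _ _ iF.
by rewrite le_eqVlt; apply/orP; left; apply/eqP; apply: eq_integral => x _.
Qed.

Definition window (lam : R) (s : R) : R := \1_(`[lam, lam + 1]%classic) s.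

(** Pointwise values along a ray mean nothing for an element of L^2; their average
over a unit window of dilation factors is again square integrable in x. *)
Definition avg (lam : R) (h m : E -> R) (x : E) : \bar R :=
  (\int[leb]_s (`|m x * h (s *: x)| * window lam s)%:E)%E.

Lemma measurable_window lam : measurable_fun [set: R] (window lam).
Proof. exact: measurable_indic. Qed.

Lemma window_ge0 lam s : 0 <= window lam s.
Proof. by rewrite /window indicE. Qed.

Lemma window_sq lam s : window lam s * window lam s = window lam s.
Proof. by rewrite /window indicE; case: (_ \in _); rewrite ?mulr1 ?mulr0. Qed.

Lemma window_neq0 lam s : window lam s != 0 -> lam <= s.
Proof.
rewrite /window indicE; have [|] := boolP (s \in _); last by rewrite eqxx.
by rewrite inE/= in_itv/= => /andP[].
Qed.

Lemma integral_window lam : (\int[leb]_s (window lam s)%:E = 1)%E.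
Proof.
have H : (leb [set` `[lam, (lam + 1)%R]] = 1)%E.
  by rewrite lebesgue_measure_itv/= lte_fin ltrDl ltr01 -EFinB addrC addKr.
by rewrite /window integral_indic// setIT; exact: H.
Qed.

Lemma measurable_ray (h : E -> R) x : measurable_fun setT h ->
  measurable_fun [set: R] (fun s => h (s *: x)).
Proof.
move=> mh; have := measurable_comp_scale2 mh.
exact: (fun H => measurableT_comp H (measurable_pair2 x)).
Qed.

Lemma measurable_weighted (lam : R) (h m : E -> R) :
  measurable_fun setT h -> measurable_fun setT m ->
  measurable_fun [set: R * E] (fun z => `|m z.2 * h (z.1 *: z.2)| * window lam z.1).
Proof.
move=> mh mm; apply: measurable_funM.
  apply: measurableT_comp => //; apply: measurable_funM.
    exact: (measurableT_comp mm measurable_snd).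
  exact: measurable_comp_scale2.
exact: (measurableT_comp (measurable_window lam) measurable_fst).
Qed.

Lemma avg_ge0 lam h m x : (0 <= avg lam h m x)%E.
Proof. by apply: integral_ge0 => s _; rewrite lee_fin mulr_ge0// window_ge0. Qed.

Lemma measurable_avg lam h m : measurable_fun setT h -> measurable_fun setT m ->
  measurable_fun setT (avg lam h m).
Proof.
move=> mh mm.
have mQ : measurable_fun [set: measurableTypeR R * E]
    (fun z => (`|m z.2 * h (z.1 *: z.2)| * window lam z.1)%:E).
  by apply/measurable_EFinP; exact: measurable_weighted.
apply: (@measurable_fun_fubini_tonelli_G _ _ _ _ _ leb _ mQ).
by move=> z; rewrite lee_fin mulr_ge0// window_ge0.
Qed.

(** Cauchy-Schwarz in the window, then Tonelli; the dilations in the window do not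
increase the norm as lam >= 1. *)
Lemma avg_L2 (lam M : R) (h m : E -> R) : 1 <= lam -> L2 h ->
  measurable_fun setT m -> (forall x, `|m x| <= M) ->
  L2 (fun x => fine (avg lam h m x)) /\
  {ae mu, forall x, avg lam h m x = (fine (avg lam h m x))%:E}.
Proof.
move=> lam1 Lh mm mM; have [mh _] := Lh.
have M0 : 0 <= M by apply: le_trans (mM 0).
pose W x := (\int[leb]_s ((`|m x * h (s *: x)| * window lam s) ^+ 2)%:E)%E.
have mQ : measurable_fun [set: measurableTypeR R * E]
    (fun z => ((`|m z.2 * h (z.1 *: z.2)| * window lam z.1) ^+ 2)%:E).
  by apply/measurable_EFinP; apply: measurable_funX; exact: measurable_weighted.
have Q0 (z : measurableTypeR R * E) :
    (0 <= ((`|m z.2 * h (z.1 *: z.2)| * window lam z.1) ^+ 2)%:E)%E.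
  by rewrite lee_fin sqr_ge0.
have mW : measurable_fun setT W.
  exact: (@measurable_fun_fubini_tonelli_G _ _ _ _ _ leb _ mQ Q0).
have W0 x : (0 <= W x)%E by apply: integral_ge0 => s _; rewrite lee_fin sqr_ge0.
have iW : (\int[mu]_x W x < +oo)%E.
  rewrite /W -(@fubini_tonelli _ _ _ _ _ leb mu _ mQ Q0).
  apply: (@le_lt_trans _ _ (\int[leb]_s ((M ^+ 2 * dot h h)%:E * (window lam s)%:E))%E); last first.
    rewrite ge0_integralZl_EFin//.
    - by rewrite integral_window mule1 ltry.
    - by move=> s _; rewrite lee_fin window_ge0.
    - by apply/measurable_EFinP; exact: measurable_window.
    - by rewrite mulr_ge0// ?sqr_ge0// dot_ge0.
  apply: ge0_le_integral => //.
  - by move=> s _; apply: integral_ge0 => x _; exact: (Q0 (s, x)).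
  - exact: (@measurable_fun_fubini_tonelli_F _ _ _ _ _ mu _ mQ Q0).
  - by apply: measurable_funeM; apply/measurable_EFinP; exact: measurable_window.
  move=> s _ /=.
  have [->|i0] := eqVneq (window lam s) 0.
    rewrite mule0 (_ : (fun x => _) = cst 0%E) ?integral0//.
    by apply/funext => x; rewrite mulr0 expr0n.
  have ls := window_neq0 i0; have s1 : 1 <= s by exact: le_trans ls.
  have s0 : 0 < s by exact: lt_le_trans s1.
  have -> : window lam s = 1.
    by move: i0; rewrite /window indicE; case: (_ \in _); rewrite ?eqxx.
  rewrite mule1 EFinM -sqE//.
  apply: (@le_trans _ _ (sq (fun x => M * h (s *: x)))).
    apply: ge0_le_integral => //.
    - apply/measurable_EFinP; apply: measurable_funX; apply: measurable_funM => //.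
      apply: measurableT_comp => //; apply: measurable_funM => //.
      exact: measurable_comp_scale.
    - by apply: measurable_sq; have := measurable_comp_scale s mh => ?; mfun.
    move=> x _; rewrite lee_fin mulr1 real_normK ?num_real// !exprMn ler_wpM2r ?sqr_ge0//.
    by rewrite -real_normK ?num_real// lerXn2r ?nnegrE.
  rewrite sqZ; last exact: measurable_comp_scale.
  apply: lee_wpmul2l; first by rewrite lee_fin sqr_ge0.
  rewrite sq_scale//.
  rewrite -[leRHS]mul1e; apply: lee_wpmul2r; first exact: sq_ge0.
  have si : s^-1 <= 1 by rewrite invf_le1.
  have si0 : 0 <= s^-1 by rewrite invr_ge0 ltW.
  by rewrite lee_fin exprn_ile1.
have key x : (W x < +oo)%E -> avg lam h m x \is a fin_num /\
    (((fine (avg lam h m x)) ^+ 2)%:E <= W x)%E.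
  move=> Wx.
  have mr := measurable_ray x mh.
  pose a s := `|m x * h (s *: x)| * window lam s.
  have ma : measurable_fun [set: R] a.
    apply: measurable_funM; last exact: measurable_window.
    by apply: measurableT_comp => //; apply: measurable_funM => //; exact: measurable_cst.
  have La : isL2 leb a by split.
  have Lb : isL2 leb (window lam).
    split; first exact: measurable_window.
    rewrite /l2sq (_ : (fun s => _) = (fun s => (window lam s)%:E)) ?integral_window ?ltry//.
    by apply/funext => s; rewrite expr2 window_sq.
  have iab := L2_integrable La Lb.
  have ab s : a s * window lam s = a s by rewrite /a -mulrA window_sq.
  have E1 : avg lam h m x = (l2dot leb a (window lam))%:E.
    rewrite /l2dot /Rintegral fineK; last exact: integrable_fin_num.
    by apply: eq_integral => s _; rewrite ab.
  rewrite E1; split => //=.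
  have E2 : W x = (l2dot leb a a)%:E by rewrite -sqE.
  rewrite E2 lee_fin; apply: le_trans (cauchy_schwarz2 La Lb) _.
  have -> : l2dot leb (window lam) (window lam) = 1.
    rewrite /l2dot /Rintegral.
    rewrite (_ : (fun s => _) = (fun s => (window lam s)%:E)) ?integral_window//.
    by apply/funext => s; rewrite window_sq.
  by rewrite mulr1.
have ma := measurable_avg lam mh mm.
have mfa : measurable_fun setT (fun x => fine (avg lam h m x)).
  by apply: measurableT_comp.
split.
  split=> //; apply: le_lt_trans iW.
  apply: ge0_le_integral => //.
  - by move=> x _; rewrite lee_fin sqr_ge0.
  - exact: measurable_sq.
  move=> x _; have [Wx|] := ltP (W x) +oo%E; last by rewrite leye_eq => /eqP ->; rewrite leey.
  by have [] := key x Wx.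
have : {ae mu, forall x, setT x -> W x \is a fin_num}.
  apply: integrable_ae => //; apply/integrableP; split=> //.
  by rewrite (eq_integral W)// => x _; rewrite gee0_abs.
apply: filterS => x /(_ I) Wx; rewrite fineK//.
by have [] := key x; first by rewrite -ge0_fin_numE.
Qed.

Lemma avg_dot (lam M : R) (h m th : E -> R) : 1 <= lam -> L2 h ->
  measurable_fun setT m -> (forall x, `|m x| <= M) -> L2 th ->
  (\int[leb]_s \int[mu]_x (`|m x * h (s *: x)| * window lam s * `|th x|)%:E =
   (dot (fun x => `|th x|) (fun x => fine (avg lam h m x)))%:E)%E.
Proof.
move=> lam1 Lh mm mM Lth; have [mh _] := Lh; have [mth _] := Lth.
have mabs : measurable_fun setT (fun x => `|th x|) by apply: measurableT_comp.
have [La aeE] := avg_L2 lam1 Lh mm mM.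
have mQ : measurable_fun [set: measurableTypeR R * E]
    (fun z => (`|m z.2 * h (z.1 *: z.2)| * window lam z.1 * `|th z.2|)%:E).
  apply/measurable_EFinP; apply: measurable_funM; first exact: measurable_weighted.
  exact: (measurableT_comp mabs measurable_snd).
rewrite (@fubini_tonelli _ _ _ _ _ leb mu _ mQ); last first.
  by move=> z; rewrite lee_fin mulr_ge0// mulr_ge0// window_ge0.
have Labs : L2 (fun x => `|th x|).
  by apply: (L2_le mabs Lth); apply: aeW => x; rewrite normr_id.
rewrite /l2dot /Rintegral fineK; last first.
  by apply: integrable_fin_num => //; exact: L2_integrable.
have ma := measurable_avg lam mh mm.
transitivity (\int[mu]_x ((`|th x|)%:E * avg lam h m x))%E.
  apply: eq_integral => x _ /=; rewrite -ge0_integralZl_EFin//.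
  - by apply: eq_integral => s _; rewrite -EFinM mulrC.
  - by move=> s _; rewrite lee_fin mulr_ge0// window_ge0.
  apply/measurable_EFinP; apply: measurable_funM; last exact: measurable_window.
  apply: measurableT_comp => //; apply: measurable_funM; first exact: measurable_cst.
  exact: measurable_ray.
apply: ae_eq_integral => //.
- by apply: emeasurable_funM => //; apply/measurable_EFinP.
- by have [mfa _] := La; apply/measurable_EFinP; mfun.
by apply: filterS aeE => x -> _ /=; rewrite -EFinM.
Qed.

Lemma continuous_dot_dilated (h th : E -> R) (a : R) : L2 h -> L2 th -> 0 < a ->
  {for a, continuous (fun s : R => dot (fun x => h (s *: x)) th)}.
Proof.
move=> Lh Lth a0.
have c0 : 0 < a / 2 by rewrite divr_gt0.
have ca : a / 2 < a by rewrite ltr_pdivrMr// ltr_pMr// ltr1n.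
apply/cvgrPdist_lt => e e0.
have [|d d0 Hd] := @seq_eps_delta R (fun s => a / 2 <= s) a
   (fun s : R => `|dot (fun x => h (s *: x)) th - dot (fun x => h (a *: x)) th|%:E) _ e e0.
  move=> s_ Ds cs e' e'0.
  have s0 n : 0 < s_ n by exact: lt_le_trans (Ds n).
  have cc := sqcvg_cst mu th.
  have C := dot_cvg (fun n => L2_scale (s0 n) Lh) (L2_scale a0 Lh) (fun=> Lth) Lth
    (sqcvg_scale Lh c0 Ds (ltW ca) cs) cc.
  have /cvgrPdist_lt/(_ _ e'0) := C; apply: filterS => n.
  by rewrite lte_fin distrC.
near=> s; rewrite distrC -lte_fin; apply: Hd.
  near: s; have : \forall s \near a, a / 2 < s by exact: lt_nbhsr.
  by apply: filterS => s /ltW.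
near: s; apply/nbhs_ballP; exists d => //= y; rewrite /ball/= distrC.
exact.
Unshelve. all: by end_near. Qed.

End rays.

(** * Boundedness of radial functions *)

Section pointwise_bound.
Context {R : realType} {N : nat}.
Local Notation E := 'rV[R]_N.
Local Notation mu := (@lebesgue_rV R N).
Local Notation leb := (@lebesgue_measure R).
Local Notation L2 := (isL2 mu).
Local Notation dot := (l2dot mu).
Variables (f : E -> R) (g : 'I_N -> E -> R).
Hypotheses (Lf : L2 f) (Lg : forall j, L2 (g j)) (wg : forall j, wpart j f (g j)).

Lemma nice_bounded (th : E -> R) : nice th -> exists M : R, 0 <= M /\ forall x, `|th x| <= M.
Proof. by move=> [[/Cinf_continuous Cth _] [K Kth]]; exact: supported_bounded Kth. Qed.

Lemma nice_coordM j (th : E -> R) : nice th -> nice (fun x => x ord0 j * th x).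
Proof. by move=> nth; apply: niceMl => //; exact: smooth_coord. Qed.

(** With k the pairing of f(s x) with chi th, integrate the derivative of
(lam + 1 - s) k(s) over [lam, lam + 1]: the value k(lam) is bounded by integrals
of |k| and |k'|.  The cut-off chi makes the factors x_j bounded. *)
Lemma dilated_dot_le (lam : R) (chi th : E -> R) : 1 <= lam -> nice chi -> nice th ->
  `|dot (fun x => chi x * f (lam *: x)) th| <=
  dot (fun x => `|th x|) (fun x => fine (avg lam f chi x) +
    \sum_j fine (avg lam (g j) (fun x => x ord0 j * chi x) x)).
Proof.
move=> lam1 nchi nth.
have lam0 : 0 < lam by exact: lt_le_trans lam1.
have [[Cchi _] _] := nchi; have mchi := Cinf_measurable Cchi.
have Lth := nice_L2 nth; have [mth _] := Lth.
have [M [M0 HM]] := nice_bounded nchi.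
have nct : nice (fun x => chi x * th x) by apply: niceMl => //; case: nchi.
have Lct := nice_L2 nct.
have ncj j := nice_coordM j nct; have Lcj j := nice_L2 (ncj j).
have njc j := nice_coordM j nchi.
have mjc j : measurable_fun setT (fun x : E => x ord0 j * chi x).
  by have [[/Cinf_measurable]] := njc j.
rewrite dot_mulA.
pose k (s : R) := dot (fun x => f (s *: x)) (fun x => chi x * th x).
pose K (s : R) := \sum_j dot (fun x => g j (s *: x)) (fun x => x ord0 j * (chi x * th x)).
have dk (s : R) : 0 < s -> is_derive s 1 k (K s) by move=> s0; exact: is_derive_dilated_dot.
have ck (s : R) : 0 < s -> {for s, continuous k}.
  by move=> s0; exact: continuous_dot_dilated.
have cK (s : R) : 0 < s -> {for s, continuous K}.
  move=> s0; rewrite /K.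
  elim: (index_enum _) => [|j r IH].
    rewrite (_ : (fun s => _) = fun=> 0); first exact: cst_continuous.
    by apply/funext => y; rewrite big_nil.
  rewrite (_ : (fun s => _) = fun s : R => dot (fun x => g j (s *: x)) (fun x => x ord0 j * (chi x * th x))
     + \sum_(j <- r) dot (fun x => g j (s *: x)) (fun x => x ord0 j * (chi x * th x))).
    apply: continuousD; last exact: IH.
    exact: continuous_dot_dilated.
  by apply/funext => y; rewrite big_cons.
(* the weight lam + 1 - s is 1 at lam and 0 at the end of the window *)
pose F (s : R) := (lam + 1 - s) * k s.
pose kern (s : R) := (lam + 1 - s) * K s - k s.
have dF (s : R) : 0 < s -> is_derive s 1 F (kern s).
  move=> s0.
  have d1 : is_derive s 1 (fun s : R => lam + 1 - s) (0 - 1).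
    by apply: is_deriveB.
  apply: (is_derive_eq (is_deriveM d1 (dk s s0))).
  by rewrite /GRing.scale/= /kern; ring.
have cphi (s : R) : 0 < s -> {for s, continuous kern}.
  move=> s0; apply: continuousB; last exact: ck.
  apply: continuousM; last exact: cK.
  by apply: continuousB; [exact: cst_continuous|].
have cF (s : R) : 0 < s -> {for s, continuous F}.
  by move=> s0; apply: differentiable_continuous; apply/derivable1_diffP; have [] := dF s s0.
have ll : lam < lam + 1 by rewrite ltrDl.
have pos (s : R) : s \in `[lam, lam + 1] -> 0 < s.
  by rewrite in_itv/= => /andP[h _]; exact: lt_le_trans h.
have wphi : {within `[lam, lam + 1], continuous kern}.
  by apply: continuous_in_subspaceT => s; rewrite inE => /pos; exact: cphi.
have FTC : (\int[leb]_(s in `[lam, (lam + 1)%R]) (kern s)%:E = (F (lam + 1))%:E - (F lam)%:E)%E.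
  apply: continuous_FTC2 => //.
    split.
    - by move=> s; rewrite in_itv/= => /andP[h _]; have [] := dF s (lt_trans lam0 h).
    - by apply: cvg_at_right_filter; exact: cF.
    - by apply: cvg_at_left_filter; apply: cF; exact: lt_trans ll.
  move=> s; rewrite in_itv/= => /andP[h _]; rewrite derive1E.
  by have [_ ->] := dF s (lt_trans lam0 h).
pose Phi0 s := (\int[mu]_x (`|chi x * f (s *: x)| * window lam s * `|th x|)%:E)%E.
pose Phi j s := (\int[mu]_x (`|x ord0 j * chi x * g j (s *: x)| * window lam s * `|th x|)%:E)%E.
have mPhi (h m : E -> R) : measurable_fun setT h -> measurable_fun setT m ->
    measurable_fun [set: R] (fun s =>
      \int[mu]_x (`|m x * h (s *: x)| * window lam s * `|th x|)%:E)%E.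
  move=> mh mm.
  have mQ : measurable_fun [set: measurableTypeR R * E]
      (fun z => (`|m z.2 * h (z.1 *: z.2)| * window lam z.1 * `|th z.2|)%:E).
    apply/measurable_EFinP; apply: measurable_funM; first exact: measurable_weighted.
    apply: measurableT_comp => //; exact: (measurableT_comp mth measurable_snd).
  apply: (@measurable_fun_fubini_tonelli_F _ _ _ _ _ mu _ mQ).
  by move=> z; rewrite lee_fin mulr_ge0// mulr_ge0// window_ge0.
have m0 : measurable_fun [set: R] Phi0 by apply: mPhi => //; case: Lf.
have mj j : measurable_fun [set: R] (Phi j) by apply: mPhi => //; case: (Lg j).
have P0 s : (0 <= Phi0 s)%E.
  by apply: integral_ge0 => x _; rewrite lee_fin mulr_ge0// mulr_ge0// window_ge0.
have Pj j s : (0 <= Phi j s)%E.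
  by apply: integral_ge0 => x _; rewrite lee_fin mulr_ge0// mulr_ge0// window_ge0.
have mtot : measurable_fun [set: R] (fun s => Phi0 s + \sum_j Phi j s)%E.
  by apply: emeasurable_funD => //; apply: emeasurable_sum.
have tot0 s : (0 <= Phi0 s + \sum_j Phi j s)%E.
  by rewrite adde_ge0// sume_ge0.
have mI : measurable (`[lam, lam + 1]%classic : set R) by exact: measurable_itv.
have step1 : (`|k lam|%:E <= \int[leb]_s (Phi0 s + \sum_j Phi j s))%E.
  have mphi : measurable_fun `[lam, lam + 1]%classic kern.
    by apply: subspace_continuous_measurable_fun.
  have -> : (`|k lam|%:E = `| \int[leb]_(s in `[lam, (lam + 1)%R]) (kern s)%:E |)%E.
    rewrite FTC /F subrr mul0r (_ : lam + 1 - lam = 1) ?mul1r; last by ring.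
    by rewrite -EFinB sub0r /= normrN.
  apply: (le_trans (le_abse_integral leb mI _)); first exact/measurable_EFinP.
  apply: (@le_trans _ _ (\int[leb]_(s in `[lam, (lam + 1)%R]) (Phi0 s + \sum_j Phi j s))%E); last first.
    by apply: ge0_subset_integral => //.
  apply: ge0_le_integral => //.
  - by apply: measurableT_comp => //; exact/measurable_EFinP.
  - exact: measurable_funTS.
  move=> s sI.
  have i1 : window lam s = 1 by rewrite /window indicE mem_set.
  have s0 := pos _ sI.
  have bd (h m : E -> R) : L2 h -> L2 (fun x => m x * th x) ->
     (`|dot (fun x => h (s *: x)) (fun x => m x * th x)|%:E <=
       \int[mu]_x (`|m x * h (s *: x)| * window lam s * `|th x|)%:E)%E.
    move=> Lh Lm; apply: (le_trans (abs_Rintegral_le _)).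
      by apply: L2_integrable => //; exact: L2_scale.
    rewrite le_eqVlt; apply/orP; left; apply/eqP; apply: eq_integral => x _.
    by rewrite i1 mulr1 -normrM; congr (`| _ |%:E); ring.
  rewrite /=; apply: (@le_trans _ _ (`|k s| + \sum_j
     `|dot (fun x => g j (s *: x)) (fun x => (x ord0 j * chi x) * th x)|)%:E).
    rewrite lee_fin /kern (le_trans (ler_normB _ _))// addrC lerD2l normrM.
    move: sI; rewrite /= in_itv/= => /andP[s1 s2].
    rewrite -[leRHS]mul1r ler_pM//.
      by rewrite ger0_norm; lra.
    rewrite /K (le_trans (ler_norm_sum _ _ _))//; apply: ler_sum => j _.
    rewrite le_eqVlt; apply/orP; left; apply/eqP; congr `| _ |; congr dot.
    by apply/funext => x; ring.
  rewrite EFinD -sumEFin; apply: leeD; first exact: bd.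
  apply: lee_sum => j _; apply: bd => //.
  rewrite (_ : (fun x => _) = (fun x : E => x ord0 j * (chi x * th x)))//.
  by apply/funext => x; ring.
rewrite -lee_fin; apply: (le_trans step1).
rewrite ge0_integralD//; last 2 first.
- by move=> s _; rewrite sume_ge0.
- by apply: emeasurable_sum.
rewrite ge0_integral_sum//.
have B0 := avg_dot lam1 Lf mchi HM Lth.
have Bj j := nice_bounded (njc j).
have [Mj HMj] := choice Bj.
have Aj j := avg_dot lam1 (Lg j) (mjc j) (HMj j).2 Lth.
rewrite /Phi0 B0 (eq_bigr _ (fun j _ => Aj j)) sumEFin -EFinD lee_fin.
have La := (avg_L2 lam1 Lf mchi HM).1.
have Laj j := (avg_L2 lam1 (Lg j) (mjc j) (HMj j).2).1.
have Labs : L2 (fun x => `|th x|).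
  apply: (L2_le _ Lth); first by apply: measurableT_comp.
  by apply: aeW => x; rewrite normr_id.
rewrite dotDr//; last exact: L2_sum.
rewrite [X in _ <= _ + X]dotC dot_suml// lerD2l.
by apply: ler_sum => j _; rewrite dotC.
Qed.

End pointwise_bound.

Section ray_bound.
Context {R : realType} {N : nat}.
Local Notation E := 'rV[R]_N.
Local Notation mu := (@lebesgue_rV R N).
Local Notation leb := (@lebesgue_measure R).
Local Notation sq := (l2sq mu). Local Notation L2 := (isL2 mu).

Definition ge1 (s : R) : R := \1_(`[1, +oo[%classic) s.

Lemma measurable_ge1 : measurable_fun [set: R] ge1.
Proof. exact: measurable_indic. Qed.

Lemma ge1_ge0 s : 0 <= ge1 s. Proof. by rewrite /ge1 indicE. Qed.

Lemma ge1E s : 1 <= s -> ge1 s = 1.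
Proof. by move=> s1; rewrite /ge1 indicE mem_set//= in_itv/= s1. Qed.

Lemma ge1_neq0 s : ge1 s != 0 -> 1 <= s.
Proof.
rewrite /ge1 indicE; have [|] := boolP (s \in _); last by rewrite eqxx.
by rewrite inE/= in_itv/= andbT.
Qed.

Definition ray_energy (h : E -> R) (x : E) : \bar R :=
  (\int[leb]_s (h (s *: x) ^+ 2 * ge1 s)%:E)%E.

Lemma ray_energy_ge0 h x : (0 <= ray_energy h x)%E.
Proof. by apply: integral_ge0 => s _; rewrite lee_fin mulr_ge0// ?sqr_ge0// ge1_ge0. Qed.

Lemma measurable_ray_energy2 (h : E -> R) : measurable_fun setT h ->
  measurable_fun [set: measurableTypeR R * E]
    (fun z => (h (z.1 *: z.2) ^+ 2 * ge1 z.1)%:E).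
Proof.
move=> mh; apply/measurable_EFinP; apply: measurable_funM.
  by apply: measurable_funX; exact: measurable_comp_scale2.
exact: (measurableT_comp measurable_ge1 measurable_fst).
Qed.

Lemma measurable_ray_energy (h : E -> R) : measurable_fun setT h ->
  measurable_fun setT (ray_energy h).
Proof.
move=> mh.
apply: (@measurable_fun_fubini_tonelli_G _ _ _ _ _ leb _ (measurable_ray_energy2 mh)).
by move=> z; rewrite lee_fin mulr_ge0// ?sqr_ge0// ge1_ge0.
Qed.

(** y |h| <= (y^2 + h^2)/2 in the window, which lies in [1, +oo[. *)
Lemma avg_le_ray_energy (lam y c : R) (h m : E -> R) x : 1 <= lam ->
  measurable_fun setT h -> 0 <= c -> m x = y * c ->
  (avg lam h m x <= (c / 2)%:E * ((y ^+ 2)%:E + ray_energy h x))%E.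
Proof.
move=> lam1 mh c0 mx.
have c20 : 0 <= c / 2 by rewrite divr_ge0.
have mr := measurable_ray x mh.
have m1 : measurable_fun [set: R] (fun s => (y ^+ 2 * window lam s)%:E).
  by apply/measurable_EFinP; apply: measurable_funM; [exact: measurable_cst|exact: measurable_window].
have m2 : measurable_fun [set: R] (fun s => (h (s *: x) ^+ 2 * ge1 s)%:E).
  apply/measurable_EFinP; apply: measurable_funM; last exact: measurable_ge1.
  exact: measurable_funX.
have p1 s : (0 <= (y ^+ 2 * window lam s)%:E)%E by rewrite lee_fin mulr_ge0// ?sqr_ge0// window_ge0.
have p2 s : (0 <= (h (s *: x) ^+ 2 * ge1 s)%:E)%E by rewrite lee_fin mulr_ge0// ?sqr_ge0// ge1_ge0.
have -> : ((y ^+ 2)%:E = \int[leb]_s (y ^+ 2 * window lam s)%:E)%E.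
  under eq_integral do rewrite EFinM.
  rewrite ge0_integralZl_EFin ?integral_window ?mule1 ?sqr_ge0//.
  - by move=> s _; rewrite lee_fin window_ge0.
  - by apply/measurable_EFinP; exact: measurable_window.
rewrite /ray_energy -ge0_integralD// -ge0_integralZl_EFin//; last 2 first.
- by move=> s _; exact: adde_ge0.
- exact: emeasurable_funD.
apply: ge0_le_integral => //.
- by move=> s _; rewrite lee_fin mulr_ge0// window_ge0.
- apply/measurable_EFinP; apply: measurable_funM; last exact: measurable_window.
  by apply: measurableT_comp => //; apply: measurable_funM => //; exact: measurable_cst.
- by apply: measurable_funeM; exact: emeasurable_funD.
move=> s _; rewrite -EFinD -EFinM lee_fin mx.
have [->|i0] := eqVneq (window lam s) 0.
  by rewrite !mulr0 add0r mulr_ge0// mulr_ge0// ?sqr_ge0// ge1_ge0.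
have -> : window lam s = 1 by move: i0; rewrite /window indicE; case: (_ \in _); rewrite ?eqxx.
rewrite ge1E; last by rewrite (le_trans lam1)// window_neq0.
rewrite !mulr1 !normrM (ger0_norm c0).
rewrite -[y ^+ 2]real_normK ?num_real// -[h _ ^+ 2]real_normK ?num_real//.
set a := `|y|; set b := `|h _|.
have -> : a * c * b = c / 2 * (2 * a * b) by field.
by rewrite ler_wpM2l//; have := sqr_ge0 (a - b); lra.
Qed.

Lemma mu_slab_box n : @lebesgue_rV R n (obox (const_mx 1) (const_mx 2)) = 1%E.
Proof.
elim: n => [|n IH].
  rewrite /= diracE mem_set// => -[] //.
rewrite /= /lebesgue_cons /pushforward.
have -> : @cons_row R n @^-1` obox (const_mx 1) (const_mx 2) =
    [set` `]1, 2[] `*` obox (const_mx 1) (const_mx 2).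
  apply/seteqP; split => [[r v] /= H|[r v] /= [Hr Hv] i].
    split; first by have := H ord0; rewrite cons_row0/= in_itv/= !mxE.
    by move=> i; have := H (lift ord0 i); rewrite cons_rowS !mxE.
  case: (unliftP ord0 i) => [j|] ->.
    by have := Hv j; rewrite cons_rowS !mxE.
  by move: Hr; rewrite cons_row0/= in_itv/= !mxE.
rewrite product_measure1E//; last exact: measurable_obox.
have LE : (@lebesgue_measure R [set` `]1%R, 2%R[] = 1)%E.
  rewrite lebesgue_measure_itv/= lte_fin ltr1n -EFinB; congr EFin; lra.
by rewrite [X in (X * _)%E]LE IH mul1e.
Qed.

Lemma ae_slab_box (P : E -> Prop) : {ae mu, forall x, P x} ->
  exists x, obox (const_mx 1) (const_mx 2) x /\ P x.
Proof.
move=> [A [mA A0 PA]]; apply: contrapT => nE.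
have : (mu (obox (const_mx 1%R) (const_mx 2%R)) <= mu A)%E.
  apply: le_measure; rewrite ?inE//; first exact: measurable_obox.
  by move=> x Bx; apply: PA => Px; apply: nE; exists x.
by rewrite mu_slab_box A0 lee_fin; lra.
Qed.

(** Substitute y = s x in the integral over s >= 1 and over the slab 1 < x_i < 2.
For fixed y, the factors s that put y/s in the slab lie between y_i/2 and y_i,
and the weight s^(-N) <= 1/s has integral at most 1 over this interval. *)
Lemma ray_energy_finite (h : E -> R) (i : 'I_N) : L2 h ->
  {ae mu, forall x : E, 1 < x ord0 i < 2 -> (ray_energy h x < +oo)%E}.
Proof.
move=> Lh; have [mh hfin] := Lh.
pose sl (x : E) : R := \1_(`]1, 2[%classic) (x ord0 i).
have msl : measurable_fun setT sl.
  by apply: measurableT_comp; [exact: measurable_indic|exact: measurable_coord].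
have sl0 x : 0 <= sl x by rewrite /sl indicE.
pose Q (z : measurableTypeR R * E) : \bar R := (sl z.2 * (h (z.1 *: z.2) ^+ 2 * ge1 z.1))%:E.
have mQ : measurable_fun setT Q.
  apply/measurable_EFinP; apply: measurable_funM.
    exact: (measurableT_comp msl measurable_snd).
  by have /measurable_EFinP := measurable_ray_energy2 mh.
have Q0 z : (0 <= Q z)%E.
  by rewrite lee_fin mulr_ge0// mulr_ge0// ?sqr_ge0// ge1_ge0.
(* 1/s for s >= 1, and continuous on the whole line *)
pose iv (s : R) : R := ((s + 1 + `|s - 1|) / 2)^-1.
have ivE (s : R) : 1 <= s -> iv s = s^-1.
  by move=> s1; rewrite /iv ger0_norm ?subr_ge0//; congr (_^-1); lra.
have miv : measurable_fun [set: R] iv.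
  apply: continuous_measurable_fun => s; rewrite /iv; apply: (@continuousV _ _ (fun s : R => (s + 1 + `|s - 1|) / 2) s).
    by have := ler_norm (s - 1); have := ler_norm (- (s - 1)); rewrite normrN => h1 h2; apply: lt0r_neq0; lra.
  apply: continuousM; last exact: cst_continuous.
  apply: continuousD.
    by apply: continuousD; [|exact: cst_continuous].
  apply: (@continuous_comp _ _ _ (fun s : R => s - 1) (fun u : R => `|u|)).
    by apply: continuousB; [|exact: cst_continuous].
  exact: norm_continuous.
have minv : measurable_fun [set: measurableTypeR R * E] (fun z => iv z.1).
  exact: (measurableT_comp miv measurable_fst).
pose P (z : measurableTypeR R * E) : \bar R :=
  (h z.2 ^+ 2 * (iv z.1 * sl (iv z.1 *: z.2) * ge1 z.1))%:E.
have mP : measurable_fun setT P.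
  apply/measurable_EFinP; apply: measurable_funM.
    by apply: measurable_funX; exact: (measurableT_comp mh measurable_snd).
  apply: measurable_funM; last exact: (measurableT_comp measurable_ge1 measurable_fst).
  apply: measurable_funM => //.
  have mpair : measurable_fun [set: measurableTypeR R * E]
      (fun z => (iv z.1, z.2) : R * E).
    by apply: measurable_fun_pair => //; exact: measurable_snd.
  exact: (measurableT_comp (measurable_comp_scale2 msl) mpair).
have P0 z : (0 <= P z)%E.
  rewrite lee_fin mulr_ge0// ?sqr_ge0//.
  have [->|/ge1_neq0 z1] := eqVneq (ge1 z.1) 0; first by rewrite mulr0.
  by rewrite mulr_ge0// ?ge1_ge0// mulr_ge0// ivE// invr_ge0 (le_trans _ z1).
have step1 : (\int[leb]_s \int[mu]_x Q (s, x) <= \int[leb]_s \int[mu]_x P (s, x))%E.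
  apply: ge0_le_integral => //.
  - by move=> s _; exact: integral_ge0.
  - exact: (@measurable_fun_fubini_tonelli_F _ _ _ _ _ mu _ mQ Q0).
  - exact: (@measurable_fun_fubini_tonelli_F _ _ _ _ _ mu _ mP P0).
  move=> s _; rewrite /Q /P /=.
  have [->|/ge1_neq0 s1] := eqVneq (ge1 s) 0.
    under eq_integral do rewrite !mulr0; under [X in (_ <= X)%E]eq_integral do rewrite !mulr0.
    exact: lexx.
  have s0 : 0 < s by exact: lt_le_trans s1.
  rewrite ge1E// ivE//.
  pose F (x : E) : \bar R := (sl (s^-1 *: x) * (h x ^+ 2 * 1))%:E.
  have mF : measurable_fun setT F.
    apply/measurable_EFinP; apply: measurable_funM; first exact: measurable_comp_scale.
    by apply: measurable_funM; [exact: measurable_funX|exact: measurable_cst].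
  have F0 x : (0 <= F x)%E by rewrite lee_fin mulr_ge0// mulr1 sqr_ge0.
  have -> : (\int[mu]_x (sl x * (h (s *: x) ^+ 2 * 1))%:E = \int[mu]_x F (s *: x))%E.
    by apply: eq_integral => x _; rewrite /F scalerA mulVf ?gt_eqF// scale1r.
  rewrite (@ge0_integral_scale R N s F)//.
  have -> : (\int[mu]_x (h x ^+ 2 * (s^-1 * sl (s^-1 *: x) * 1))%:E = (s^-1)%:E * \int[mu]_x F x)%E.
    rewrite -ge0_integralZl_EFin//.
      by apply: eq_integral => x _; rewrite /F -EFinM; congr EFin; ring.
    by rewrite invr_ge0 ltW.
  apply: lee_wpmul2r; first exact: integral_ge0.
  have si : s^-1 <= 1 by rewrite invf_le1.
  have si0 : 0 <= s^-1 by rewrite invr_ge0 ltW.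
  have : (0 < N)%N := leq_ltn_trans (leq0n i) (ltn_ord i).
  case: (N) => // n _; rewrite lee_fin exprS ger_pMr ?invr_gt0//.
  exact: exprn_ile1.
have step2 : (\int[leb]_s \int[mu]_x P (s, x) <= sq h)%E.
  rewrite (@fubini_tonelli _ _ _ _ _ leb mu _ mP P0).
  apply: ge0_le_integral => //.
  - by move=> x _; exact: integral_ge0.
  - exact: (@measurable_fun_fubini_tonelli_G _ _ _ _ _ leb _ mP P0).
  - exact: measurable_sq.
  move=> x _; rewrite /P /=.
  pose w (s : R) := iv s * sl (iv s *: x) * ge1 s.
  have w0 s : 0 <= w s.
    rewrite /w; have [->|/ge1_neq0 z1] := eqVneq (ge1 s) 0; first by rewrite mulr0.
    by rewrite mulr_ge0// ?ge1_ge0// mulr_ge0// ivE// invr_ge0 (le_trans _ z1).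
  have mw : measurable_fun [set: R] w.
    apply: measurable_funM; last exact: measurable_ge1.
    apply: measurable_funM => //.
    have mpair : measurable_fun [set: R] (fun s => (iv s, x) : R * E).
      by apply: measurable_fun_pair => //; exact: measurable_cst.
    exact: (measurableT_comp (measurable_comp_scale2 msl) mpair).
  pose y := x ord0 i.
  have wb : (\int[leb]_s (w s)%:E <= 1)%E.
    have wslab s : w s != 0 -> [/\ y / 2 < s, s < y & w s = s^-1].
      rewrite /w; have [->|/ge1_neq0 z1] := eqVneq (ge1 s) 0; first by rewrite mulr0 eqxx.
      rewrite ge1E// ivE// mulr1 /sl indicE mxE.
      have s0 : 0 < s by exact: lt_le_trans z1.
      have [|] := boolP (_ \in _); last by rewrite mulr0 eqxx.
      rewrite inE/= in_itv/= mulr1 [s^-1 * _]mulrC ltr_pdivlMr// ltr_pdivrMr// mul1r.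
      by move=> /andP[h1 h2] _; split => //; rewrite -/y in h2; lra.
    have [y0|y0] := ltP 0 y; last first.
      rewrite (_ : (fun s => _) = cst 0%E) ?integral0 ?lee01//.
      apply/funext => s /=; congr EFin; apply/eqP; apply: contrapT => /negP/wslab[h1 h2 _].
      by clear -h1 h2 y0; lra.
    apply: (@le_trans _ _ (\int[leb]_s (2 / y * \1_(`]y / 2, y[%classic) s)%:E)%E).
      apply: ge0_le_integral => //.
      - by move=> s _; rewrite lee_fin.
      - exact/measurable_EFinP.
      - by apply/measurable_EFinP; apply: measurable_funM; [exact: measurable_cst|exact: measurable_indic].
      move=> s _; rewrite lee_fin.
      have [->|/wslab[h1 h2 ->]] := eqVneq (w s) 0.
        by rewrite mulr_ge0// divr_ge0// ltW.
      rewrite indicE mem_set/= ?in_itv/= ?h1// mulr1.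
      have s0 : 0 < s by rewrite (lt_trans _ h1)// divr_gt0.
      rewrite -[2 / y]invf_div lef_pV2 ?posrE ?divr_gt0//; exact: ltW.
    under eq_integral do rewrite EFinM.
    have q0 : 0 <= 2 / y by rewrite divr_ge0// ltW.
    have mI : measurable_fun setT (fun s : R => (\1_(`]y / 2, y[%classic) s : R)%:E).
      by apply/measurable_EFinP; exact: measurable_indic.
    rewrite ge0_integralZl_EFin//.
    rewrite integral_indic// setIT.
    have LE : (leb [set` `](y / 2)%R, y[] = (y / 2)%:E)%E.
      rewrite lebesgue_measure_itv/= lte_fin ifT -?EFinB; first by congr EFin; lra.
      lra.
    rewrite [X in (_ * X <= _)%E]LE -EFinM lee_fin.
    by rewrite (_ : _ * _ = 1)//; field; rewrite gt_eqF.
  under eq_integral do rewrite EFinM.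
  rewrite ge0_integralZl_EFin ?sqr_ge0//; last 2 first.
  - by move=> s _; rewrite lee_fin; exact: w0.
  - exact/measurable_EFinP.
  by rewrite -[leRHS]mule1; apply: lee_wpmul2l => //; rewrite lee_fin sqr_ge0.
pose V x := (\int[leb]_s Q (s, x))%E.
have iV : mu.-integrable setT V.
  apply/integrableP; split.
    exact: (@measurable_fun_fubini_tonelli_G _ _ _ _ _ leb _ mQ Q0).
  rewrite (eq_integral V); last by move=> x _; rewrite gee0_abs//; exact: integral_ge0.
  rewrite /V -(@fubini_tonelli _ _ _ _ _ leb mu _ mQ Q0).
  by apply: le_lt_trans (le_trans step1 step2) _.
have := integrable_ae measurableT iV.
apply: filterS => x /(_ I) Vx xs; move: Vx.
have -> : V x = ray_energy h x.
  rewrite /V /Q/=; apply: eq_integral => s _; rewrite /sl indicE mem_set ?mul1r//=.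
by rewrite ge0_fin_numE// ray_energy_ge0.
Qed.

Variables (f : E -> R) (g : 'I_N -> E -> R).
Hypotheses (Lf : L2 f) (Lg : forall j, L2 (g j)) (wg : forall j, wpart j f (g j)).

(** An upper bound of |f(lam x)| that does not depend on lam >= 1. *)
Definition ray_bound (x : E) : \bar R := ((2^-1)%:E * ((1 + ray_energy f x) +
  \sum_j ((x ord0 j ^+ 2)%:E + ray_energy (g j) x)))%E.

Lemma measurable_ray_bound : measurable_fun setT ray_bound.
Proof.
apply: measurable_funeM; apply: emeasurable_funD.
  apply: emeasurable_funD; first exact: measurable_cst.
  by apply: measurable_ray_energy; case: Lf.
apply: emeasurable_sum => j; apply: emeasurable_funD.
  apply/measurable_EFinP; apply: measurable_funX; exact: measurable_coord.
by apply: measurable_ray_energy; case: (Lg j).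
Qed.

(** Cut to a box by a bump function, divide by it, and exhaust the space by boxes. *)
Lemma ray_bound_dilate (lam : R) : 1 <= lam ->
  {ae mu, forall x, (`|f (lam *: x)|%:E <= ray_bound x)%E}.
Proof.
move=> lam1; have lam0 : 0 < lam by exact: lt_le_trans lam1.
have [mf _] := Lf.
have H n : {ae mu, forall x, obox (const_mx (- n%:R)) (const_mx n%:R) x ->
    (`|f (lam *: x)|%:E <= ray_bound x)%E}.
  pose chi : E -> R := box_bump (const_mx (- n%:R) : E) (const_mx n%:R : E).
  have nchi : nice chi.
    split; first exact: smooth_bump.
    have [K HK] := @supported_sbump R N (const_mx (- n%:R)) (const_mx n%:R) 1.
    exists K => x x0; apply: HK; rewrite /sbump gt_eqF// subr_gt0 expR_lt1 oppr_lt0.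
    by rewrite mul1r lt0r x0/= bump_ge0.
  have [[Cchi _] _] := nchi; have mchi := Cinf_measurable Cchi.
  have [M [M0 HM]] := nice_bounded nchi.
  have njc j := nice_coordM j nchi.
  have mjc j : measurable_fun setT (fun x : E => x ord0 j * chi x).
    by have [[/Cinf_measurable]] := njc j.
  have Bj j := nice_bounded (njc j).
  have [Mj HMj] := choice Bj.
  have [La aeE] := avg_L2 lam1 Lf mchi HM.
  have Laj j := (avg_L2 lam1 (Lg j) (mjc j) (HMj j).2).1.
  have aeEj j := (avg_L2 lam1 (Lg j) (mjc j) (HMj j).2).2.
  have LF : L2 (fun x => chi x * f (lam *: x)).
    by apply: (L2_bounded mchi HM); exact: L2_scale.
  have := ae_dominated LF (L2D La (L2_sum (index_enum 'I_N) Laj)).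
  move=> /(_ _ (fun th => @dilated_dot_le R N f g Lf Lg wg lam chi th lam1 nchi)) dom.
  have : {ae mu, forall x, `|chi x * f (lam *: x)| <=
      fine (avg lam f chi x) + \sum_j fine (avg lam (g j) (fun x => x ord0 j * chi x) x)}.
    apply: dom => x; rewrite addr_ge0//; first by rewrite fine_ge0// avg_ge0.
    by apply: sumr_ge0 => j _; rewrite fine_ge0// avg_ge0.
  have : {ae mu, forall x, forall j, avg lam (g j) (fun x => x ord0 j * chi x) x =
     (fine (avg lam (g j) (fun x => x ord0 j * chi x) x))%:E} by apply: filter_forall.
  move: aeE; apply: filterS3 => x E1 E2 dm bx.
  have c0 : 0 < chi x by exact: bump_gt0.
  have : ((chi x)%:E * `|f (lam *: x)|%:E <= (chi x)%:E * ray_bound x)%E.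
    pose S : \bar R := (\sum_j avg lam (g j) (fun x => (x ord0 j * chi x)%R) x)%E.
    apply: (@le_trans _ (\bar R) (avg lam f chi x + S)%E).
      rewrite E1 /S; under eq_bigr do rewrite E2.
      rewrite sumEFin -EFinD -EFinM lee_fin.
      by move: dm; rewrite normrM (gtr0_norm c0).
    rewrite /ray_bound muleA -EFinM ge0_muleDr; last 2 first.
    - by rewrite adde_ge0// ray_energy_ge0.
    - by apply: sume_ge0 => j _; rewrite adde_ge0 ?ray_energy_ge0// lee_fin sqr_ge0.
    apply: leeD.
      have := @avg_le_ray_energy lam 1 (chi x) f chi x lam1 mf (ltW c0).
      by rewrite mul1r expr1n; apply.
    rewrite ge0_sume_distrr; last first.
      by move=> j _; rewrite adde_ge0 ?ray_energy_ge0// lee_fin sqr_ge0.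
    apply: lee_sum => j _; apply: avg_le_ray_energy => //; last exact: ltW.
    by case: (Lg j).
  by rewrite lee_pmul2l.
have := @ae_foralln _ _ _ mu _ H; apply: filterS => x Hx.
have /filter_ex[n Hn] := obox_exhaust x.
exact: Hx Hn.
Qed.

Lemma enorm_scale (s : R) (x : E) : 0 <= s -> enorm (s *: x) = s * enorm x.
Proof.
move=> s0; rewrite /enorm -[X in _ = X * _]ger0_norm// -sqrtr_sqr -sqrtrM ?sqr_ge0//.
congr Num.sqrt; rewrite mulr_sumr; apply: eq_bigr => j _.
by rewrite mxE exprMn.
Qed.

Lemma measurable_enorm : measurable_fun setT (@enorm R N).
Proof.
rewrite /enorm; apply: (@measurableT_comp _ _ _ _ _ _ (@Num.sqrt R)).
  exact: (continuous_measurable_fun (@sqrt_continuous R)).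
by apply: measurable_sum => j; apply: measurable_funX; exact: measurable_coord.
Qed.

(** Choose x0 in the slab such that the bound along its ray is finite and f is equal
to G of the norm almost everywhere on it.  Along almost every other ray, f takes
the values of f on the ray of x0, after a change of parameter. *)
Lemma radial_bounded (G : R -> R) : (0 < N)%N ->
  {ae mu, forall x, f x = G (enorm x)} ->
  exists c r0 : R, {ae mu, forall x, r0 < enorm x -> `|f x| <= c}.
Proof.
move=> N0 fG; have [mf _] := Lf.
pose i0 : 'I_N := Ordinal N0.
pose A : set (measurableTypeR R * E) :=
  [set z | 1 <= z.1 /\ (0 < `|f (z.1 *: z.2)|%:E - ray_bound z.2)%E].
have mA : measurable A.
  have -> : A = (fst @^-1` `[1, +oo[%classic) `&`
      (setT `&` [set z | (0 < `|f (z.1 *: z.2)|%:E - ray_bound z.2)%E]).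
    by apply/seteqP; split => z; rewrite /A/= in_itv/= andbT => -[? H]; split => //; case: H.
  apply: measurableI; first by rewrite -[_ @^-1` _]setTI; exact: measurable_fst.
  apply: emeasurable_fun_o_infty => //; apply: emeasurable_funB.
    apply/measurable_EFinP; apply: measurableT_comp => //.
    exact: measurable_comp_scale2.
  exact: (measurableT_comp measurable_ray_bound measurable_snd).
have H1 : {ae leb, forall s, {ae mu, forall x, ~ A (s, x)}}.
  apply: aeW => s; have [s1|s1] := leP 1 s; last first.
    by apply: aeW => x [/=]; rewrite leNgt s1.
  apply: filterS (ray_bound_dilate s1) => x Hx [_ /=].
  by rewrite sube_gt0 ltNge Hx.
have H2 := @ae_swap R _ _ (measurableTypeR R) E leb mu A mA H1.
have H3 := ae_ray fG.
have H4 : {ae mu, forall x : E, 1 < x ord0 i0 < 2 -> ray_bound x \is a fin_num}.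
  have Hg : {ae mu, forall x : E, forall j, 1 < x ord0 i0 < 2 -> (ray_energy (g j) x < +oo)%E}.
    by apply: filter_forall => j; exact: ray_energy_finite.
  move: (ray_energy_finite i0 Lf) Hg; apply: filterS2 => x h1 h2 xs.
  rewrite /ray_bound fin_numM// fin_numD; apply/andP; split.
    by rewrite fin_numD/= ge0_fin_numE ?ray_energy_ge0// h1.
  rewrite sum_fin_num; apply/allP => u /mapP[j _ ->] /=.
  by rewrite fin_numD/= ge0_fin_numE ?ray_energy_ge0// h2.
have [x0 [bx0 [nA [fx0 fin0]]]] : exists x, obox (const_mx 1) (const_mx 2) x /\
   ({ae leb, forall s, ~ A (s, x)} /\ ({ae leb, forall s, 0 < s -> f (s *: x) = G (enorm (s *: x))} /\
     (1 < x ord0 i0 < 2 -> ray_bound x \is a fin_num))).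
  by apply: ae_slab_box; apply: filterS3 H2 H3 H4 => x.
have {}fin0 : ray_bound x0 \is a fin_num.
  by apply: fin0; have := bx0 i0; rewrite !mxE.
have r0 : 0 < enorm x0.
  rewrite /enorm sqrtr_gt0 (bigD1 i0)//= ltr_pwDl//.
    by rewrite exprn_gt0//; have := bx0 i0; rewrite !mxE => /andP[h _]; exact: lt_trans h.
  by apply: sumr_ge0 => j _; exact: sqr_ge0.
pose c := fine (ray_bound x0).
exists c, (enorm x0).
have S0 : {ae leb, forall s, (0 < s -> f (s *: x0) = G (enorm (s *: x0))) /\
    (1 <= s -> `|f (s *: x0)| <= c)}.
  move: nA fx0; apply: filterS2 => s nAs fs; split => // s1.
  rewrite leNgt; apply/negP => h; apply: nAs; split => //=.
  by rewrite sube_gt0 -(fineK fin0) lte_fin.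
pose B : set E := [set x | enorm x0 < enorm x /\ c < `|f x|].
have mB : measurable B.
  have -> : B = (@enorm R N @^-1` `]enorm x0, +oo[%classic) `&`
     ((fun x => `|f x|) @^-1` `]c, +oo[%classic).
    by apply/seteqP; split => x; rewrite /B/= !in_itv/= !andbT.
  apply: measurableI; rewrite -[_ @^-1` _]setTI; first exact: measurable_enorm.
  have mab : measurable_fun setT (fun x => `|f x|) by apply: measurableT_comp.
  exact: mab.
have : {ae mu, forall x, ~ B x}.
  apply: ray_ae => //; apply: filterS H3 => y fy.
  have [y0|y0] := ltP 0 (enorm y); last first.
    apply: aeW => s s0 [+ _]; rewrite enorm_scale ?ltW// => h.
    have : s * enorm y <= 0 by rewrite pmulr_rle0.
    by lra.
  have rho0 : 0 < enorm y / enorm x0 by rewrite divr_gt0.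
  move: (ae_scale1 rho0 S0) fy; apply: (@filterS2 _ (nbhs (almost_everywhere leb)) _ (fun s : R => _ ) (fun s : R => _) (fun s : R => _)) => s [fs1 fs2] fy s0 [].
  rewrite enorm_scale ?ltW// => h1 h2.
  have rs0 : 0 < enorm y / enorm x0 * s by rewrite mulr_gt0.
  have E1 : enorm (s *: y) = enorm ((enorm y / enorm x0 * s) *: x0).
    by rewrite !enorm_scale ?ltW// mulrAC divfK ?gt_eqF// mulrC.
  have : `|f (s *: y)| <= c.
    rewrite (fy s0) E1 -(fs1 rs0); apply: fs2.
    by rewrite mulrAC ler_pdivlMr// mul1r mulrC ltW.
  by rewrite leNgt h2.
apply: filterS => x nB rx; rewrite leNgt; apply/negP => h; exact: nB.
Qed.

End ray_bound.

(** * Polynomial decay of the ground state *)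

Section weights.
Context {R : realType} {N : nat}.
Local Notation E := 'rV[R]_N.
Local Notation mu := (@lebesgue_rV R N).
Local Notation sq := (l2sq mu). Local Notation L2 := (isL2 mu).
Local Notation dot := (l2dot mu).
Local Notation e_ j := (delta_mx ord0 j : E).

Lemma L2_fatou (f_ : nat -> E -> R) (f : E -> R) (C : R) : (forall n, L2 (f_ n)) ->
  (forall n, dot (f_ n) (f_ n) <= C) -> (forall x, f_ n x @[n --> \oo] --> f x) -> L2 f.
Proof.
move=> Lf bf cf.
have mf : measurable_fun setT f.
  exact: (@measurable_fun_cvg _ _ R setT f_ f (fun n => (Lf n).1) (fun x _ => cf x)).
split => //; apply: le_lt_trans (ltry C).
have := @fatou _ _ _ mu setT measurableT (fun n x => (f_ n x ^+ 2)%:E).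
move=> /(_ (fun n => measurable_sq (Lf n).1)) /(_ (fun n x _ => _)) H.
have {}H := H (fun n x => ltac:(by rewrite lee_fin sqr_ge0)).
apply: le_trans (le_trans _ H) _.
  rewrite /l2sq le_eqVlt; apply/orP; left; apply/eqP; apply: eq_integral => x _.
  have c2 : (f_ n x ^+ 2)%:E @[n --> \oo] --> (f x ^+ 2)%:E.
    by apply: cvg_EFin; [exact: nearW|]; apply: cvgM; exact: cf.
  by rewrite (cvg_limn_einf_sup c2).1.
rewrite limn_einf_lim; apply: lime_le; first exact: is_cvg_einfs.
apply: nearW => n; apply: (@le_trans _ _ (sq (f_ n))).
  by apply: ereal_inf_lbound; exists n => //=.
by rewrite sqE// lee_fin.
Qed.

Definition rsq (x : E) : R := \sum_j x ord0 j ^+ 2.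

Lemma rsq_ge0 x : 0 <= rsq x. Proof. by apply: sumr_ge0 => j _; exact: sqr_ge0. Qed.

Lemma enorm_sq (x : E) : enorm x ^+ 2 = rsq x.
Proof. by rewrite /enorm sqr_sqrtr// rsq_ge0. Qed.

Lemma enorm_ge0 (x : E) : 0 <= enorm x. Proof. exact: sqrtr_ge0. Qed.

Lemma sqr_coord_le (x : E) j : x ord0 j ^+ 2 <= rsq x.
Proof. by rewrite /rsq (bigD1 j)//= lerDl; apply: sumr_ge0 => i _; exact: sqr_ge0. Qed.

Lemma Cinf_rsq : Cinf rsq.
Proof. by move=> k; apply: Ck_sum => j; apply: CkM; exact: Ck_coord. Qed.

Lemma partial_rsq j x : partial j rsq x = 2 * x ord0 j.
Proof.
apply: is_derive_partial.
have -> : rsq = \sum_(i < N) (fun x : E => x ord0 i * x ord0 i).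
  by apply/funext => y; rewrite fct_sumE.
have H i : is_derive x (e_ j) (fun x : E => x ord0 i * x ord0 i)
    (if i == j then 2 * x ord0 j else 0).
  apply: (is_derive_eq (is_deriveM (is_derive_coord i j x) (is_derive_coord i j x))); rewrite /GRing.scale/=.
  by case: eqP => [->|_]; rewrite ?mulr1 ?mulr0 ?addr0//; ring.
apply: (is_derive_eq (is_derive_sum H)).
by rewrite -big_mkcond/= big_pred1_eq.
Qed.

Definition rden (e : R) (x : E) : R := 1 + e * rsq x.
(** A bounded weight that increases to 1 + |x|^2 as e decreases to 0, and whose
logarithmic gradient is small at infinity uniformly in e. *)
Definition rweight (e : R) (x : E) : R := (1 + rsq x) * (rden e x)^-1.

Section fixed.
Variable e : R.
Hypothesis e01 : 0 < e <= 1.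
Let e0 : 0 < e. Proof. by case/andP: e01. Qed.
Let e1 : e <= 1. Proof. by case/andP: e01. Qed.

Lemma rden_gt0 x : 0 < rden e x.
Proof. by rewrite /rden ltr_pwDl// mulr_ge0 ?rsq_ge0 ?ltW. Qed.

Lemma Cinf_rden : Cinf (rden e).
Proof.
by move=> k; apply: CkD; [exact: Ck_cst|apply: CkM; [exact: Ck_cst|exact: Cinf_rsq]].
Qed.

Lemma Cinf_rweight : Cinf (rweight e).
Proof.
move=> k; apply: CkM; first by apply: CkD; [exact: Ck_cst|exact: Cinf_rsq].
by apply: Ck_inv => [x|]; [rewrite gt_eqF// rden_gt0|exact: Cinf_rden].
Qed.

Lemma rweight_ge1 x : 1 <= rweight e x.
Proof.
rewrite /rweight ler_pdivlMr ?rden_gt0// mul1r /rden lerD2l.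
by rewrite -[leRHS]mul1r ler_wpM2r ?rsq_ge0.
Qed.

Lemma rweight_le_rsq x : rweight e x <= 1 + rsq x.
Proof.
rewrite /rweight -[leRHS]mulr1 ler_wpM2l ?addr_ge0 ?rsq_ge0//.
by rewrite invf_le1 ?rden_gt0// lerDl mulr_ge0 ?rsq_ge0// ltW.
Qed.

Lemma rweight_le x : rweight e x <= e^-1.
Proof.
rewrite /rweight ler_pdivrMr ?rden_gt0// /rden mulrDr mulKf ?gt_eqF// mulr1 lerD2r.
by rewrite -invr1 lef_pV2 ?posrE.
Qed.

(** Differentiate the product with the denominator rather than the quotient. *)
Lemma partial_rweight j x :
  partial j (rweight e) x = 2 * x ord0 j * (1 - e * rweight e x) * (rden e x)^-1.
Proof.
have d0 := lt0r_neq0 (rden_gt0 x).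
have H1 : partial j (fun x => rden e x * rweight e x) x = 2 * x ord0 j.
  have -> : (fun x => rden e x * rweight e x) = (fun x => 1 + rsq x).
    by apply/funext => y; rewrite /rweight mulrC divfK// lt0r_neq0// rden_gt0.
  apply: is_derive_partial.
  apply: (is_derive_eq (is_deriveD (is_derive_cst (1 : R) x (e_ j)) (Cinf_is_derive j x Cinf_rsq))).
  by rewrite add0r partial_rsq.
have H2 : partial j (rden e) x = e * (2 * x ord0 j).
  apply: is_derive_partial.
  apply: (is_derive_eq (is_deriveD (is_derive_cst (1 : R) x (e_ j))
    (is_deriveM (is_derive_cst (e : R) x (e_ j)) (Cinf_is_derive j x Cinf_rsq)))).
  by rewrite add0r partial_rsq /GRing.scale/= mulr0 addr0.
move: H1; rewrite (partialM _ _ Cinf_rden Cinf_rweight) H2 => H1.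
apply: (mulfI d0); rewrite mulrCA mulfV// mulr1.
have -> : rden e x * partial j (rweight e) x = 2 * x ord0 j - rweight e x * (e * (2 * x ord0 j)).
  by apply/eqP; rewrite eq_sym subr_eq H1.
by ring.
Qed.

Lemma partial_rweight_sq j x : partial j (rweight e) x ^+ 2 <= 4 * x ord0 j ^+ 2 * (rden e x)^-1 ^+ 2.
Proof.
rewrite partial_rweight !exprMn (_ : 2 ^+ 2 = 4) -?natrX// -[leLHS]mulrA ler_wpM2l//; first by rewrite mulr_ge0// sqr_ge0.
rewrite -[leRHS]mul1r ler_wpM2r ?sqr_ge0// expr_le1// ?gerBl ?subr_ge0.
- by rewrite mulr_ge0 ?(ltW e0)// (le_trans _ (rweight_ge1 x)).
- by rewrite -ler_pdivlMl// mulr1 rweight_le.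
Qed.

Lemma abs_partial_rweight j x : `|partial j (rweight e) x| <= rweight e x.
Proof.
have w0 : 0 <= rweight e x by apply: le_trans (rweight_ge1 x).
rewrite -ler_sqr ?nnegrE// real_normK ?num_real// (le_trans (partial_rweight_sq j x))//.
rewrite /rweight exprMn ler_wpM2r ?sqr_ge0//.
have := sqr_coord_le x j; have := rsq_ge0 x; set r := rsq x; set y := x ord0 j ^+ 2.
by have := sqr_ge0 (1 - r); lra.
Qed.

(** The logarithmic gradient of the weight is at most 2 |x| / (1 + |x|^2) in norm.
From |x|^2 = 63 on its square is at most 1/16, and before that the weight is
bounded. *)
Lemma sum_partial_rweight_sq (rho : R) x : 63 <= rho ->
  \sum_j partial j (rweight e) x ^+ 2 <= 16^-1 * rweight e x ^+ 2 + (1 + rho) ^+ 2.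
Proof.
move=> rho63.
have S : \sum_j partial j (rweight e) x ^+ 2 <= 4 * rsq x * (rden e x)^-1 ^+ 2.
  rewrite -mulrA [rsq x * _]mulrC /rsq mulrA mulr_sumr; apply: ler_sum => j _.
  by rewrite (le_trans (partial_rweight_sq j x))// mulrAC.
apply: (le_trans S).
have r0 := rsq_ge0 x.
have [rx|rx] := leP rho (rsq x).
  rewrite -[leLHS]addr0 lerD ?sqr_ge0// /rweight exprMn [leRHS]mulrA ler_wpM2r ?sqr_ge0//.
  by set r := rsq x in rx r0 *; nra.
rewrite -[leLHS]add0r lerD//; first by rewrite mulr_ge0 ?sqr_ge0// invr_ge0.
apply: (@le_trans _ _ (4 * rsq x)); last by have := sqr_ge0 (1 - rho); lra.
rewrite -[leRHS]mulr1 ler_wpM2l ?mulr_ge0// expr_le1 ?invr_ge0 ?(ltW (rden_gt0 x))//.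
by rewrite invf_le1 ?rden_gt0// lerDl mulr_ge0// ltW.
Qed.

End fixed.

Lemma rweight_cvg x : rweight n.+1%:R^-1 x @[n --> \oo] --> 1 + rsq x.
Proof.
rewrite /rweight -[X in _ --> X]mulr1; apply: cvgM; first exact: cvg_cst.
rewrite -[X in _ --> X]invr1; apply: cvgV; first exact: oner_neq0.
rewrite /rden -[X in _ --> X]addr0; apply: cvgD; first exact: cvg_cst.
rewrite -[X in _ --> X](mul0r (rsq x)); apply: cvgM; last exact: cvg_cst.
exact: cvg_harmonic.
Qed.
End weights.

Section decay.
Context {R : realType} {N : nat}.
Local Notation E := 'rV[R]_N.
Local Notation mu := (@lebesgue_rV R N).
Local Notation L2 := (isL2 mu).
Local Notation dot := (l2dot mu).
Implicit Types (f u v : E -> R) (g vp : 'I_N -> E -> R).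

(** The gradient is part of the data, so no representative has to be chosen. *)
Definition H1 f g := L2 f /\ forall j, L2 (g j) /\ wpart j f (g j).

Lemma H1M (M : R) (m : E -> R) f g : Cinf m -> (forall x, `|m x| <= M) ->
  (forall j x, `|partial j m x| <= M) -> H1 f g ->
  H1 (fun x => m x * f x) (fun j x => m x * g j x + partial j m x * f x).
Proof.
move=> Cm bm bp [Lf Hg]; have mm := Cinf_measurable Cm.
split; first exact: L2_bounded bm Lf.
move=> j; have [Lg wg] := Hg j; split; last exact: wpartM.
apply: L2D; first exact: L2_bounded bm Lg.
by apply: L2_bounded (bp j) Lf; exact: Cinf_measurable (Cinf_partial j Cm).
Qed.

Variables (b sigma : R) (u : E -> R) (g : 'I_N -> E -> R).

Definition potential (x : E) : R := enorm x `^ (- b) * `|u x| `^ (2 * sigma).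

(** The real part of the ground-state equation; the integrability of the nonlinear
term is in has_integral. *)
Definition real_ground_state := forall v vp, H1 v vp ->
  has_integral mu (fun x => potential x * u x * v x)
    (\sum_j dot (g j) (vp j) + dot u v).

Hypotheses (Hu : H1 u g) (N0 : (0 < N)%N) (b0 : 0 < b) (s0 : 0 <= sigma)
  (rad : exists G : R -> R, {ae mu, forall x, u x = G (enorm x)}).

(** The ground state is bounded at infinity and the factor |x|^(-b) tends to 0. *)
Lemma potential_small : exists rho : R, 63 <= rho /\
  {ae mu, forall x, rho <= rsq x -> potential x <= 4^-1}.
Proof.
have [G uG] := rad; have [Lu Hg] := Hu.
have [c [r0 H]] := @radial_bounded R N u g Lu (fun j => (Hg j).1) (fun j => (Hg j).2) G N0 uG.
(* the maximum keeps the base of the power nonnegative *)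
pose c' := Num.max c 0 `^ (2 * sigma).
have c'0 : 0 <= c' by exact: powR_ge0.
pose K := 4 * (c' + 1).
have K0 : 0 < K by rewrite /K mulr_gt0// ltr_wpDl.
(* K is four times the bound of |u|^(2 sigma) plus one; beyond K^(1/b) the factor
   |x|^(-b) is at most 1/K; r0 + 1 makes u bounded, and 8 gives 63 <= R2^2 *)
pose R2 := Num.max (K `^ b^-1) (Num.max (r0 + 1) 8).
have R28 : 8 <= R2 by rewrite /R2 !le_max lexx !orbT.
have R2r : r0 + 1 <= R2 by rewrite /R2 !le_max lexx !orbT.
have R2K : K `^ b^-1 <= R2 by rewrite /R2 !le_max lexx.
have R20 : 0 < R2 by rewrite (lt_le_trans _ R28).
exists (R2 ^+ 2); split; first by rewrite expr2; nra.
apply: filterS H => x Hx xr.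
have nx : R2 <= enorm x.
  by rewrite -ler_sqr ?nnegrE ?enorm_ge0 ?(ltW R20)// enorm_sq.
have ux : `|u x| <= c by apply: Hx; lra.
have KE : K <= enorm x `^ b.
  have {1}-> : K = (K `^ b^-1) `^ b by rewrite -powRrM mulVf ?gt_eqF// powRr1// ltW.
  apply: ge0_ler_powR; rewrite ?nnegrE ?powR_ge0 ?enorm_ge0 ?(ltW b0)//.
  exact: le_trans nx.
have uE : `|u x| `^ (2 * sigma) <= c'.
  apply: ge0_ler_powR; rewrite ?nnegrE ?mulr_ge0//.
    by rewrite le_max lexx orbT.
  by rewrite le_max ux.
rewrite /potential powRN mulrC ler_pdivrMr ?(lt_le_trans K0)//.
apply: (le_trans uE); rewrite -ler_pdivrMl ?invr_gt0// invrK.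
by apply: le_trans KE; rewrite /K; lra.
Qed.

Hypothesis heq : real_ground_state.

(** Test with w^2 u.  Up to a multiple of the terms without weight, the potential
contributes a quarter of the square of w u, and the gradient of w is absorbed by
half the square of w grad u and an eighth of the square of w u. *)
Lemma weighted_bound : exists C : R, forall e : R, 0 < e <= 1 ->
  dot (fun x => rweight e x * u x) (fun x => rweight e x * u x) <= C /\
  forall j, dot (fun x => rweight e x * g j x) (fun x => rweight e x * g j x) <= C.
Proof.
have [Lu Hg] := Hu.
have [rho [rho63 small]] := potential_small.
pose K := 2 * (1 + rho) ^+ 2.
have [puu_int puuE] := heq Hu.
set Wuu := \sum_j dot (g j) (g j) + dot u u in puuE.
exists (2 * (K * Wuu + K * dot u u)) => e e01.
have e0 : 0 < e by case/andP: e01.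
pose w : E -> R := rweight e.
have Cw : Cinf w by exact: (Cinf_rweight e01).
have w1 x : 1 <= w x by exact: (rweight_ge1 e01).
have bw x : `|w x| <= e^-1.
  by rewrite ger0_norm ?(le_trans _ (w1 x))//; exact: (rweight_le e01).
have bd j x : `|partial j w x| <= e^-1.
  by apply: (le_trans (abs_partial_rweight e01 j x)); exact: (rweight_le e01).
have Hwu := H1M Cw bw bd Hu.
have Hv := H1M Cw bw bd Hwu.
have [pv_int pvE] := heq Hv.
have mw := Cinf_measurable Cw.
have LQ : L2 (fun x => w x * u x) by case: Hwu.
have LP j : L2 (fun x => w x * g j x) by apply: L2_bounded bw (Hg j).1.
have Ld j : L2 (fun x => partial j w x * u x).
  by apply: L2_bounded (bd j) Lu; exact: Cinf_measurable (Cinf_partial j Cw).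
set Q := fun x => w x * u x in LQ *.
pose P j x := w x * g j x.
pose D j x := partial j w x * u x.
have iF := has_integralD
  (has_integralD (has_integralZ K (heq Hu)) (has_integralZ K (has_integral_dot Lu Lu)))
  (has_integralD (has_integralZ (3 / 8) (has_integral_dot LQ LQ))
   (has_integral_sum (index_enum 'I_N) (fun j => has_integralD
     (has_integralZ (1 / 2) (has_integral_dot (LP j) (LP j)))
     (has_integralZ 2 (has_integral_dot (Ld j) (LP j)))))).
have {}iF := has_integralB iF (heq Hv).
have := has_integral_ge0 iF.
rewrite -/Wuu.
have gE j : dot (g j) (fun x => w x * (w x * g j x + partial j w x * u x) +
     partial j w x * (w x * u x)) = dot (P j) (P j) + 2 * dot (D j) (P j).
  apply: (@has_integral_unique R _ E mu (fun x => g j x * (w x * (w x * g j x + partial j w x * u x) +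
     partial j w x * (w x * u x)))).
    apply: has_integral_dot; first by case: (Hg j).
    by case: Hv => _ /(_ j)[].
  apply: has_integral_eq (has_integralD (has_integral_dot (LP j) (LP j))
    (has_integralZ 2 (has_integral_dot (Ld j) (LP j)))) => [x|//].
  by ring.
have uE : dot u (fun x => w x * (w x * u x)) = dot Q Q.
  by apply: eq_Rintegral => x _; rewrite /Q; ring.
rewrite uE (eq_bigr _ (fun j _ => gE j)) !big_split/= -!mulr_sumr.
have S0 : forall j, dot (P j) (P j) <= \sum_j dot (P j) (P j).
  by move=> j; rewrite (bigD1 j)//= lerDl; apply: sumr_ge0 => i _; exact: dot_ge0.
have SS : 0 <= \sum_j dot (P j) (P j) by apply: sumr_ge0 => i _; exact: dot_ge0.
have QQ := dot_ge0 mu Q.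
set SP := \sum_j dot (P j) (P j) in S0 SS *.
set SD := \sum_j dot (D j) (P j).
move=> H; have {}H := H _; suff : 0 <= K * Wuu + K * dot u u +
   (3 / 8 * dot Q Q + (1 / 2 * SP + 2 * SD)) - (SP + 2 * SD + dot Q Q).
  by move=> h; split; [lra|move=> j; have := S0 j; rewrite /P; lra].
apply: H; apply: filterS small => x sx.
have pot0 : 0 <= potential x by rewrite mulr_ge0// powR_ge0.
have SQ := sum_partial_rweight_sq e01 x rho63.
have key : \sum_j partial j w x ^+ 2 * (u x ^+ 2) * 2 <=
    16^-1 * 2 * Q x ^+ 2 + K * u x ^+ 2.
  rewrite -!mulr_suml /Q exprMn /K.
  have := sqr_ge0 (u x); move: SQ; rewrite -/w.
  set A := \sum_j _; set U := u x ^+ 2; set W := w x ^+ 2; set V := (1 + rho) ^+ 2.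
  by move=> h1 h2; nra.
have key2 : 0 <= \sum_j ((1 / 2) * (P j x * P j x) + 2 * (D j x * P j x) +
    partial j w x ^+ 2 * (u x ^+ 2) * 2).
  apply: sumr_ge0 => j _; have := sqr_ge0 (P j x + 2 * D j x); rewrite /D; nra.
have key3 : potential x * u x * (w x * (w x * u x)) <=
    4^-1 * Q x ^+ 2 + K * (potential x * u x * u x).
  have u20 := sqr_ge0 (u x).
  have -> : potential x * u x * (w x * (w x * u x)) = potential x * Q x ^+ 2.
    by rewrite /Q; ring.
  have -> : potential x * u x * u x = potential x * u x ^+ 2 by ring.
  have K0 : 0 <= K by rewrite /K mulr_ge0// sqr_ge0.
  have [rx|rx] := leP rho (rsq x).
    rewrite -[leLHS]addr0 lerD//; last by rewrite mulr_ge0// mulr_ge0.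
    by rewrite ler_wpM2r ?sqr_ge0// sx.
  rewrite -[leLHS]add0r lerD//; first by rewrite mulr_ge0 ?sqr_ge0.
  rewrite [leRHS]mulrCA ler_wpM2l// /Q exprMn ler_wpM2r//.
  have := rweight_le_rsq e01 x; have := w1 x; rewrite -/w /K => h1 h2.
  by nra.
move: key2; rewrite big_split/= => key2.
by move: key key2 key3; rewrite !expr2 -/(P _) -/(D _); lra.
Qed.

Lemma weighted_L2 : L2 (fun x => (1 + rsq x) * u x) /\
  forall j, L2 (fun x => (1 + rsq x) * g j x).
Proof.
have [C HC] := weighted_bound; have [Lu Hg] := Hu.
have e01 n : 0 < (n.+1%:R^-1 : R) <= 1.
  by rewrite invr_gt0 ltr0n/= invf_le1// ler1n.
have gen (h : E -> R) : L2 h ->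
    (forall e : R, 0 < e <= 1 -> dot (fun x => rweight e x * h x) (fun x => rweight e x * h x) <= C) ->
    L2 (fun x => (1 + rsq x) * h x).
  move=> Lh H; apply: (@L2_fatou R N (fun n x => rweight n.+1%:R^-1 x * h x) _ C).
  - move=> n; apply: (L2_bounded (Cinf_measurable (Cinf_rweight (e01 n))) _ Lh) => x.
    by rewrite ger0_norm ?(le_trans _ (rweight_ge1 (e01 n) x))//; exact: rweight_le.
  - by move=> n; apply: H.
  by move=> x; apply: cvgM; [exact: rweight_cvg|exact: cvg_cst].
split; first by apply: gen => // e /HC[].
by move=> j; apply: gen => [|e /HC[]]; [case: (Hg j)|].
Qed.

End decay.

(** * Real and imaginary parts *)

Section complex_valued.
Context {R : realType} {N : nat}.
Local Notation E := 'rV[R]_N.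
Local Notation C := R[i].
Local Notation mu := (@lebesgue_rV R N).
Local Notation L2 := (isL2 mu).
Local Notation dot := (l2dot mu).
Implicit Types (f h v : E -> C).

Definition re f (x : E) : R := complex.Re (f x).
Definition im f (x : E) : R := complex.Im (f x).

Lemma normc_sq (z : C) : Normc.normc z ^+ 2 = complex.Re z ^+ 2 + complex.Im z ^+ 2.
Proof. by case: z => a b; rewrite /Normc.normc sqr_sqrtr// addr_ge0// sqr_ge0. Qed.

Lemma normc_le_add (z : C) : Normc.normc z <= `|complex.Re z| + `|complex.Im z|.
Proof.
rewrite -ler_sqr ?nnegrE ?addr_ge0//; last by case: z => a b; exact: sqrtr_ge0.
rewrite normc_sq sqrrD !real_normK ?num_real// -addrA lerD2l lerDr.
by rewrite mulrn_wge0// mulr_ge0.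
Qed.

Lemma in_L2P f : in_L2 f <-> L2 (re f) /\ L2 (im f).
Proof.
have sqE x : Normc.normc (f x) ^+ 2 = re f x ^+ 2 + im f x ^+ 2 by exact: normc_sq.
split=> [[[mr mi] int]|[[mr Lr] [mi Li]]].
  have fin : (\int[mu]_x (Normc.normc (f x) ^+ 2)%:E < +oo)%E.
    have [_] := integrableP _ _ _ int.
    by under eq_integral do rewrite gee0_abs ?lee_fin ?sqr_ge0//.
  have mint := measurable_int _ int.
  split; split => //; apply: le_lt_trans fin; apply: ge0_le_integral => //.
  - by move=> x _; rewrite lee_fin sqr_ge0.
  - exact: (measurable_sq (f := re f)).
  - by move=> x _; rewrite lee_fin sqE lerDl sqr_ge0.
  - by move=> x _; rewrite lee_fin sqr_ge0.
  - exact: (measurable_sq (f := im f)).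
  - by move=> x _; rewrite lee_fin sqE lerDr sqr_ge0.
split; first by split.
have := has_integralD (has_integral_dot (conj mr Lr) (conj mr Lr)) (has_integral_dot (conj mi Li) (conj mi Li)).
move=> [int _]; apply: eq_integrable int => // x _.
by rewrite /= sqE !expr2.
Qed.

Lemma L2norm_ge0 f : 0 <= L2norm f. Proof. exact: sqrtr_ge0. Qed.

Lemma L2norm_sq f : in_L2 f ->
  L2norm f ^+ 2 = dot (re f) (re f) + dot (im f) (im f).
Proof.
move=> /in_L2P[Lr Li].
have [_ <-] := has_integralD (has_integral_dot Lr Lr) (has_integral_dot Li Li).
rewrite /L2norm sqr_sqrtr; last by apply: Rintegral_ge0 => x _; exact: sqr_ge0.
by apply: eq_Rintegral => x _; rewrite normc_sq !expr2.
Qed.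

Lemma L2dotE f h : in_L2 f -> in_L2 h ->
  L2dot f h = ((dot (re f) (re h) + dot (im f) (im h)) +i*
               (dot (im f) (re h) - dot (re f) (im h)))%C.
Proof.
move=> /in_L2P[fr fi] /in_L2P[hr hi].
have [_ <-] := has_integralD (has_integral_dot fr hr) (has_integral_dot fi hi).
have [_ <-] := has_integralB (has_integral_dot fi hr) (has_integral_dot fr hi).
rewrite /L2dot /cintegral; congr (_ +i* _)%C; apply: eq_Rintegral => x _;
  rewrite /re /im; case: (f x) => a b; case: (h x) => c d /=; ring.
Qed.

Lemma is_weak_partialP j f h : is_weak_partial j f h <->
  wpart j (re f) (re h) /\ wpart j (im f) (im h).
Proof.
have cE (k : E -> C) (th : E -> R) : cintegral (fun x => k x * (th x)%:C%C) =
    (dot (re k) th +i* dot (im k) th)%C.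
  rewrite /cintegral; congr (_ +i* _)%C; apply: eq_Rintegral => x _;
    rewrite /re /im; case: (k x) => a b /=; ring.
split=> [H|[Hr Hi]].
  by split=> th /H; rewrite !cE => -[].
by move=> th tth; rewrite !cE Hr// Hi.
Qed.

Lemma in_H1P f : in_H1 f <-> exists p q, H1 (re f) p /\ H1 (im f) q.
Proof.
split=> [[/in_L2P[Lr Li] H]|[p [q [[Lr Hr] [Li Hi]]]]].
  have [h Hh] := choice H.
  exists (fun j => re (h j)), (fun j => im (h j)); split; split => // j;
    by have [/in_L2P[h1 h2] /is_weak_partialP[w1 w2]] := Hh j.
split; first exact/in_L2P.
move=> j; exists (fun x => (p j x +i* q j x)%C); split.
  by apply/in_L2P; have [? _] := Hr j; have [? _] := Hi j.
by apply/is_weak_partialP; have [_ ?] := Hr j; have [_ ?] := Hi j.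
Qed.

Section gradient.
Variables (f : E -> C) (p q : 'I_N -> E -> R).
Hypotheses (Hr : H1 (re f) p) (Hi : H1 (im f) q).

(** Weak derivatives are unique up to a null set, so the chosen one is harmless. *)
Lemma weak_partialE j : [/\ in_L2 (weak_partial j f),
  {ae mu, forall x, re (weak_partial j f) x = p j x} &
  {ae mu, forall x, im (weak_partial j f) x = q j x}].
Proof.
have [_ /(_ j)[Lp wp]] := Hr; have [_ /(_ j)[Lq wq]] := Hi.
have : [set g | in_L2 g /\ is_weak_partial j f g] (weak_partial j f).
  rewrite /weak_partial; apply: (xgetPex (fun=> 0)).
  exists (fun x => (p j x +i* q j x)%C); split; first exact/in_L2P.
  exact/is_weak_partialP.
move=> [/[dup] inL /in_L2P[L1 L2] /is_weak_partialP[w1 w2]].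
by split => //; [exact: (wpart_unique L1 Lp w1 wp)|exact: (wpart_unique L2 Lq w2 wq)].
Qed.

Lemma in_L2_H1 : in_L2 f. Proof. by apply/in_L2P; case: Hr; case: Hi. Qed.

Lemma L2norm_weak_partial_sq j :
  L2norm (weak_partial j f) ^+ 2 = dot (p j) (p j) + dot (q j) (q j).
Proof.
have [inL e1 e2] := weak_partialE j; have /in_L2P[L1 L2] := inL.
have [_ /(_ j)[Lp _]] := Hr; have [_ /(_ j)[Lq _]] := Hi.
by rewrite L2norm_sq//; congr (_ + _); apply: ae_eq_dot.
Qed.

Lemma H1norm_sq : H1norm f ^+ 2 = dot (re f) (re f) + dot (im f) (im f) +
  \sum_j (dot (p j) (p j) + dot (q j) (q j)).
Proof.
rewrite /H1norm sqr_sqrtr; last by rewrite addr_ge0 ?sqr_ge0// sumr_ge0// => j _; exact: sqr_ge0.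
rewrite (L2norm_sq in_L2_H1); congr (_ + _); apply: eq_bigr => j _.
exact: L2norm_weak_partial_sq.
Qed.

Lemma L2norm_le_H1norm : L2norm f <= H1norm f.
Proof.
rewrite -ler_sqr ?nnegrE ?sqrtr_ge0// H1norm_sq (L2norm_sq in_L2_H1) lerDl.
by apply: sumr_ge0 => j _; rewrite addr_ge0// dot_ge0.
Qed.

End gradient.

Lemma L2dot_weak_partial f h p q p' q' j : H1 (re f) p -> H1 (im f) q ->
  H1 (re h) p' -> H1 (im h) q' ->
  L2dot (weak_partial j f) (weak_partial j h) =
    ((dot (p j) (p' j) + dot (q j) (q' j)) +i* (dot (q j) (p' j) - dot (p j) (q' j)))%C.
Proof.
move=> Hr Hi Hr' Hi'.
have [inL e1 e2] := weak_partialE Hr Hi j; have /in_L2P[L1 L2] := inL.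
have [inL' e1' e2'] := weak_partialE Hr' Hi' j; have /in_L2P[L1' L2'] := inL'.
have [_ /(_ j)[Lp _]] := Hr; have [_ /(_ j)[Lq _]] := Hi.
have [_ /(_ j)[Lp' _]] := Hr'; have [_ /(_ j)[Lq' _]] := Hi'.
by rewrite L2dotE//; congr ((_ + _) +i* (_ - _))%C; apply: ae_eq_dot.
Qed.

Lemma ReB (x y : C) : complex.Re (x - y) = complex.Re x - complex.Re y.
Proof. by case: x => a b; case: y. Qed.
Lemma ImB (x y : C) : complex.Im (x - y) = complex.Im x - complex.Im y.
Proof. by case: x => a b; case: y. Qed.

Lemma Re_sum (F : 'I_N -> C) : complex.Re (\sum_j F j) = \sum_j complex.Re (F j).
Proof.
by apply: (big_ind2 (fun (z : C) (r : R) => complex.Re z = r)) => // -[a1 a2] r1 [b1 b2] r2 /= -> ->.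
Qed.
Lemma Im_sum (F : 'I_N -> C) : complex.Im (\sum_j F j) = \sum_j complex.Im (F j).
Proof.
by apply: (big_ind2 (fun (z : C) (r : R) => complex.Im z = r)) => // -[a1 a2] r1 [b1 b2] r2 /= -> ->.
Qed.

Lemma H1_eq0 f : (forall x, im f x = 0) -> H1 (im f) (fun _ _ => 0).
Proof.
move=> f0; have -> : im f = fun=> 0 by apply/funext.
split; first exact: L20.
by move=> j; split; [exact: L20|exact: wpart0].
Qed.

Variables (b sigma : R) (psi : E -> R).
Hypothesis gs : is_ground_state b sigma psi.

(** Real test functions suffice, the ground state being real. *)
Lemma ground_state_real : exists g, H1 psi g /\ real_ground_state b sigma psi g.
Proof.
have [/in_H1P[g [q [Hg Hq]]] _ _ eq] := gs.
exists g; split => // v vp Hv.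
have Hv' : H1 (im (of_real v)) (fun _ _ => 0) by exact: H1_eq0.
have Hq' : H1 (im (of_real psi)) (fun _ _ => 0) by exact: H1_eq0.
have inv : in_H1 (of_real v) by apply/in_H1P; exists vp, (fun _ _ => 0).
have [[pair _]] := eq _ inv.
have NLE : (fun x => complex.Re (nonlinearity b sigma (of_real psi) x * conjc (of_real v x))) =
    (fun x => potential b sigma psi x * psi x * v x).
  apply/funext => x; rewrite /nonlinearity /of_real /potential /=.
  by rewrite expr0n/= addr0 sqrtr_sqr; ring.
have {}pair : mu.-integrable setT (EFin \o (fun x => potential b sigma psi x * psi x * v x)).
  by rewrite -NLE.
move=> /(congr1 (@complex.Re R)); rewrite /energy_gradient !ReB Re_sum.
rewrite (eq_bigr (fun j => dot (g j) (vp j))); last first.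
  move=> j _; rewrite (@L2dot_weak_partial (of_real psi) (of_real v) g (fun _ _ => 0) vp (fun _ _ => 0) j Hg Hq' Hv Hv')/=.
  by rewrite -[RHS]addr0; congr (_ + _); rewrite /l2dot; under eq_Rintegral do rewrite mul0r;
    rewrite Rintegral_cst// mul0r.
rewrite (@L2dotE (of_real psi) (of_real v)); [|exact: (@in_L2_H1 (of_real psi) _ _ Hg Hq')|exact: (@in_L2_H1 (of_real v) _ _ Hv Hv')].
have -> : dot (im (of_real psi)) (im (of_real v)) = 0.
  by rewrite /l2dot; under eq_Rintegral do rewrite mul0r; rewrite Rintegral_cst// mul0r.
rewrite /L2dot /cintegral NLE/= addr0 => H; split => //.
by apply/eqP; rewrite -subr_eq0 opprD addrA; apply/eqP.
Qed.

End complex_valued.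

(** * Cut-off and quadratic phase *)

Section cutoff.
Context {R : realType} {N : nat}.
Local Notation E := 'rV[R]_N.
Local Notation e_ j := (delta_mx ord0 j : E).

(** Decays fast enough to absorb one factor |x|^2, hence also one factor x from the
gradient of the phase and one from the Euler field. *)
Definition cutoff (e : R) (x : E) : R := (rden e x)^-1.

Section fixed.
Variable e : R.
Hypothesis e01 : 0 < e <= 1.
Let e0 : 0 < e. Proof. by case/andP: e01. Qed.
Let e1 : e <= 1. Proof. by case/andP: e01. Qed.

Lemma cutoff_gt0 x : 0 < cutoff e x. Proof. by rewrite invr_gt0 (rden_gt0 e01). Qed.

Lemma cutoff_le1 x : cutoff e x <= 1.
Proof. by rewrite /cutoff invf_le1 ?(rden_gt0 e01)// lerDl mulr_ge0 ?rsq_ge0// ltW. Qed.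

Lemma Cinf_cutoff : Cinf (cutoff e).
Proof. by move=> k; apply: Ck_inv => [x|]; [rewrite gt_eqF// (rden_gt0 e01)|exact: Cinf_rden]. Qed.

Lemma partial_cutoff j x : partial j (cutoff e) x = - (2 * e * x ord0 j * cutoff e x ^+ 2).
Proof.
have d0 := lt0r_neq0 (rden_gt0 e01 x).
have H1 : partial j (fun x => rden e x * cutoff e x) x = 0.
  have -> : (fun x => rden e x * cutoff e x) = (fun x => 1).
    by apply/funext => y; rewrite /cutoff divff// lt0r_neq0// (rden_gt0 e01).
  by apply: is_derive_partial; exact: is_derive_cst.
have H2 : partial j (@rden R N e) x = e * (2 * x ord0 j).
  apply: is_derive_partial.
  apply: (is_derive_eq (is_deriveD (is_derive_cst (1 : R) x (e_ j))
    (is_deriveM (is_derive_cst (e : R) x (e_ j)) (Cinf_is_derive j x (@Cinf_rsq R N))))).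
  by rewrite add0r partial_rsq /GRing.scale/= mulr0 addr0.
move: H1; rewrite (partialM _ _ (Cinf_rden e) Cinf_cutoff) H2 => H1.
apply: (mulfI d0); move/eqP: H1; rewrite addr_eq0 => /eqP ->.
rewrite /cutoff; field; exact: d0.
Qed.

Lemma abs_partial_cutoff j x : `|partial j (cutoff e) x| <= cutoff e x.
Proof.
have c0 := cutoff_gt0 x; have d0 := rden_gt0 e01 x.
rewrite partial_cutoff normrN expr2 mulrA normrM (gtr0_norm c0) -[leRHS]mul1r.
rewrite ler_wpM2r ?(ltW c0)// normrM (gtr0_norm c0) ler_pdivrMr// mul1r.
rewrite !normrM (gtr0_norm e0) ger0_norm// /rden.
have h1 := sqr_coord_le x j; have h2 := sqr_ge0 (1 - `|x ord0 j|).
have h3 : `|x ord0 j| ^+ 2 = x ord0 j ^+ 2 by rewrite real_normK ?num_real.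
move: h1 h2; rewrite sqrrB h3 expr1n mul1r.
set y := x ord0 j ^+ 2; set a := `|_|; set q := rsq x => h1 h2.
have : e * (2 * a) <= e * (1 + q) by rewrite ler_pM2l//; lra.
by have := e1; lra.
Qed.

Lemma cutoff_rsq x : rsq x * cutoff e x <= e^-1.
Proof.
apply: le_trans (rweight_le e01 x); rewrite /rweight ler_wpM2r ?(ltW (cutoff_gt0 x))//.
by rewrite lerDr.
Qed.

Lemma coord_le_rsq (x : E) j : `|x ord0 j| <= 1 + rsq x.
Proof.
have h1 := sqr_coord_le x j; have h2 := sqr_ge0 (1 - `|x ord0 j|).
have h3 : `|x ord0 j| ^+ 2 = x ord0 j ^+ 2 by rewrite real_normK ?num_real.
move: h1 h2; rewrite sqrrB h3 expr1n mul1r.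
have := normr_ge0 (x ord0 j).
set y := x ord0 j ^+ 2; set a := `|_|; set q := rsq x => h0 h1 h2.
lra.
Qed.

Lemma cutoff_coord (x : E) j : `|x ord0 j| * cutoff e x <= e^-1.
Proof.
apply: le_trans (rweight_le e01 x); rewrite /rweight ler_wpM2r ?(ltW (cutoff_gt0 x))//.
exact: coord_le_rsq.
Qed.
End fixed.

Lemma cutoff_cvg x : cutoff n.+1%:R^-1 x @[n --> \oo] --> (1 : R).
Proof.
rewrite -[X in _ --> X]invr1; apply: cvgV; first exact: oner_neq0.
rewrite /rden -[X in _ --> X]addr0; apply: cvgD; first exact: cvg_cst.
rewrite -[X in _ --> X](mul0r (rsq x)); apply: cvgM; last exact: cvg_cst.
exact: cvg_harmonic.
Qed.

Lemma partial_cutoff_cvg j x : partial j (cutoff n.+1%:R^-1) x @[n --> \oo] --> (0 : R).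
Proof.
have e01 n : 0 < (n.+1%:R^-1 : R) <= 1 by rewrite invr_gt0 ltr0n/= invf_le1// ler1n.
have -> : (fun n => partial j (cutoff n.+1%:R^-1) x) =
    (fun n => n.+1%:R^-1 * - (2 * x ord0 j) * (cutoff n.+1%:R^-1 x * cutoff n.+1%:R^-1 x)).
  by apply/funext => n; rewrite partial_cutoff//; ring.
rewrite -[X in _ --> X](mul0r (1 * 1)); apply: cvgM.
  rewrite -[X in _ --> X](mul0r (- (2 * x ord0 j))); apply: cvgM; last exact: cvg_cst.
  exact: cvg_harmonic.
by apply: cvgM; exact: cutoff_cvg.
Qed.
End cutoff.

Section phase.
Context {R : realType} {N : nat}.
Local Notation E := 'rV[R]_N.
Local Notation e_ j := (delta_mx ord0 j : E).
Implicit Types (c r : R) (x : E).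

(** The constant c distinguishes the real part from the imaginary part. *)
Definition phase c r x : R := r - r * rsq x / 4 + c.
Definition cosph c r x : R := cos (phase c r x).
Definition sinph c r x : R := sin (phase c r x).

Lemma Cinf_phase c r : Cinf (phase c r).
Proof.
move=> k; apply: CkD; last exact: Ck_cst.
apply: CkB; first exact: Ck_cst.
apply: CkM; last exact: Ck_cst.
by apply: CkM; [exact: Ck_cst|exact: Cinf_rsq].
Qed.

Lemma Cinf_cosph c r : Cinf (cosph c r).
Proof.
move=> k; have := Ck_comp (@derivs_cos R) (@Cinf_phase c r k) 0%N.
by rewrite (_ : (fun x => _) = cosph c r)//; apply/funext => x; rewrite mul0r addr0.
Qed.

Lemma cosph_shift c r x : cosph (c - pi / 2) r x = sinph c r x.
Proof. by rewrite /cosph /sinph /phase addrA cosBpihalf. Qed.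

Lemma sinph_shift c r x : sinph (c - pi / 2) r x = - cosph c r x.
Proof. by rewrite /cosph /sinph /phase addrA sinBpihalf. Qed.

Lemma Cinf_sinph c r : Cinf (sinph c r).
Proof.
have -> : sinph c r = cosph (c - pi / 2) r by apply/funext => x; rewrite cosph_shift.
exact: Cinf_cosph.
Qed.

Lemma partial_cosph c r j x : partial j (cosph c r) x = r / 2 * x ord0 j * sinph c r x.
Proof.
apply: is_derive_partial.
have dp : is_derive x (e_ j) (phase c r) (- (r / 2 * x ord0 j)).
  apply: (is_derive_eq (Cinf_is_derive j x (Cinf_phase c r))).
  apply: is_derive_partial.
  have -> : phase c r = (fun x => (r + c) + (- (r / 4)) * rsq x).
    by apply/funext => y; rewrite /phase; ring.
  apply: (is_derive_eq (is_deriveD (is_derive_cst (r + c : R) x (e_ j))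
    (is_deriveM (is_derive_cst (- (r / 4) : R) x (e_ j)) (Cinf_is_derive j x (@Cinf_rsq R N))))).
  by rewrite partial_rsq /GRing.scale/=; field.
apply: (is_derive_eq (is_derive_dir_comp (is_derive_cos (phase c r x)) dp)).
by rewrite mulrNN mulrC.
Qed.

Lemma partial_sinph c r j x : partial j (sinph c r) x = - (r / 2 * x ord0 j * cosph c r x).
Proof.
have -> : sinph c r = cosph (c - pi / 2) r by apply/funext => y; rewrite cosph_shift.
by rewrite partial_cosph sinph_shift mulrN.
Qed.

Lemma cosph_le1 c r x : `|cosph c r x| <= 1. Proof. by rewrite ler_norml cos_geN1 cos_le1. Qed.
Lemma sinph_le1 c r x : `|sinph c r x| <= 1. Proof. by rewrite ler_norml sin_geN1 sin_le1. Qed.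

Lemma cos2Dsin2ph c r x : cosph c r x ^+ 2 + sinph c r x ^+ 2 = 1.
Proof. exact: cos2Dsin2. Qed.
End phase.

(** * The weak equation of the profile *)

Section blow_up_profile.
Context {R : realType} {N : nat}.
Local Notation E := 'rV[R]_N.
Local Notation mu := (@lebesgue_rV R N).
Local Notation L2 := (isL2 mu).
Local Notation dot := (l2dot mu).
Variables (b sigma : R) (u : E -> R) (g : 'I_N -> E -> R).
Hypotheses (Hu : H1 u g) (heq : real_ground_state b sigma u g).
Hypotheses (Lwu : L2 (fun x => (1 + rsq x) * u x))
  (Lwg : forall j, L2 (fun x => (1 + rsq x) * g j x)).
Implicit Types (v : E -> R) (vp : 'I_N -> E -> R).

Lemma L2_eq (f h : E -> R) : (forall x, f x = h x) -> L2 f -> L2 h.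
Proof. by move=> /funext->. Qed.

Lemma has_integral_scale (s : R) (F : E -> R) (a : R) : 0 < s ->
  has_integral mu F a -> has_integral mu (fun x => F (s *: x)) (s^-1 ^+ N * a).
Proof.
move=> s0 [iF <-]; split; last by rewrite Rintegral_scale.
have [/measurable_EFinP mF finF] := integrableP _ _ _ iF.
apply/integrableP; split.
  by apply/measurable_EFinP; exact: measurable_comp_scale.
have := @ge0_integral_scale R N s (fun x => `|F x|%:E) s0.
move=> H; rewrite [ltLHS]H; last 2 first.
- by apply/measurable_EFinP; apply: measurableT_comp.
- by move=> x; rewrite lee_fin.
by apply: lte_mul_pinfty => //; rewrite lee_fin exprn_ge0// invr_ge0 ltW.
Qed.

Lemma H1_scale (s : R) v vp : 0 < s -> H1 v vp ->
  H1 (fun x => v (s *: x)) (fun j x => s * vp j (s *: x)).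
Proof.
move=> s0 [Lv Hv]; split; first exact: L2_scale.
move=> j; have [Lp wp] := Hv j; split; last exact: wpart_scale.
by apply: L2Z; exact: L2_scale.
Qed.

(** Test the equation with v(x/r) and substitute. *)
Lemma scaled_ground_state (r : R) v vp : 0 < r -> H1 v vp ->
  has_integral mu (fun x => r ^+ 2 * (potential b sigma u (r *: x) * u (r *: x)) * v x)
    (\sum_j dot (fun x => r * g j (r *: x)) (vp j) + r ^+ 2 * dot (fun x => u (r *: x)) v).
Proof.
move=> r0 Hv; have r'0 : 0 < r^-1 by rewrite invr_gt0.
have [Lu Hg] := Hu; have [Lv Hvp] := Hv.
have := has_integralZ (r ^+ 2) (has_integral_scale r0 (heq (H1_scale r'0 Hv))).
apply: has_integral_eq => [x|].
  by rewrite scalerA mulVf ?gt_eqF// scale1r; ring.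
rewrite mulrDr mulrDr; congr (_ + _); last first.
  by congr (_ * _); rewrite dot_scale1.
rewrite !mulr_sumr; apply: eq_bigr => j _.
have [Lg _] := Hg j; have [Lp _] := Hvp j.
rewrite dotZl//; last exact: L2_scale.
rewrite dotZr//; last exact: L2_scale.
rewrite dot_scale1//; field; rewrite gt_eqF//.
Qed.

Variable r : R.
Hypothesis r0 : 0 < r.

Definition dil (x : E) : R := u (r *: x).
Definition ddil j (x : E) : R := r * g j (r *: x).

Lemma H1_dil : H1 dil ddil. Proof. exact: H1_scale. Qed.

Lemma L2_coordM f j : L2 f -> L2 (fun x => (1 + rsq x) * f x) -> L2 (fun x => x ord0 j * f x).
Proof.
move=> [mf _] Lw; apply: (L2_le _ Lw).
  by apply: measurable_funM => //; exact: measurable_coord.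
by apply: aeW => x; rewrite !normrM ler_wpM2r// (le_trans (coord_le_rsq x j))// ler_norm.
Qed.

Lemma L2_coord_dil j : L2 (fun x => x ord0 j * dil x).
Proof.
have [Lu _] := Hu.
apply: L2_eq (L2Z r^-1 (L2_scale r0 (L2_coordM j Lu Lwu))) => x.
by rewrite mxE -mulrA mulKf ?gt_eqF.
Qed.

Lemma L2_euler : L2 (euler g).
Proof.
by rewrite /euler; apply: L2_sum => j; apply: L2_coordM; [have [_ /(_ j)[]] := Hu|exact: Lwg].
Qed.

Lemma L2_rsq_dil : L2 (fun x => rsq x * dil x).
Proof.
have [Lu _] := Hu; have [mu_ _] := Lu.
have mr : measurable_fun setT (@rsq R N) by exact: Cinf_measurable (@Cinf_rsq R N).
have L : L2 (fun x => rsq x * u x).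
  apply: (L2_le _ Lwu); first exact: measurable_funM.
  apply: aeW => x; rewrite !normrM ler_wpM2r// !ger0_norm ?addr_ge0 ?rsq_ge0//.
  by rewrite lerDr.
apply: L2_eq (L2Z (r^-1 ^+ 2) (L2_scale r0 L)) => x; rewrite mulrA /dil; congr (_ * _).
rewrite /rsq mulr_sumr; apply: eq_bigr => j _; rewrite mxE exprMn mulrA -exprMn.
by rewrite mulVf ?gt_eqF// expr1n mul1r.
Qed.

Lemma euler_ddil x : euler ddil x = euler g (r *: x).
Proof. by rewrite /euler; apply: eq_bigr => j _; rewrite mxE /ddil; ring. Qed.

Variable c : R.
Local Notation CC := (cosph c r).
Local Notation SS := (sinph c r).

(** The gradient of cos(phase) u(r x). *)
Definition slope j (x : E) : R := CC x * ddil j x + r / 2 * x ord0 j * SS x * dil x.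
(** Up to the factor r^(N/2) and the shift of the phase by pi/2, the derivative in
time of the profile. *)
Definition rate (x : E) : R := (N%:R * (r / 2) * dil x + r * euler g (r *: x)) * SS x
  + (r ^+ 2 - r ^+ 2 / 4 * rsq x) * dil x * CC x.

Lemma measurable_CC : measurable_fun setT (CC : E -> R). Proof. exact: Cinf_measurable (Cinf_cosph c r). Qed.
Lemma measurable_SS : measurable_fun setT (SS : E -> R). Proof. exact: Cinf_measurable (Cinf_sinph c r). Qed.

Lemma L2_CC f : L2 f -> L2 (fun x => CC x * f x).
Proof. by apply: L2_bounded; [exact: measurable_CC|exact: cosph_le1]. Qed.
Lemma L2_SS f : L2 f -> L2 (fun x => SS x * f x).
Proof. by apply: L2_bounded; [exact: measurable_SS|exact: sinph_le1]. Qed.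

Lemma L2_slope j : L2 (slope j).
Proof.
rewrite /slope; apply: L2D; first by apply: L2_CC; have [_ /(_ j)[]] := H1_dil.
by apply: L2_eq (L2Z (r / 2) (L2_SS (L2_coord_dil j))) => x; ring.
Qed.

Lemma H1_cos_dil : H1 (fun x => CC x * dil x) slope.
Proof.
have [Ld Hd] := H1_dil.
split; first exact: L2_CC.
move=> j; split; first exact: L2_slope.
have [Lj wj] := Hd j.
have := wpartM (Cinf_cosph c r) Ld Lj wj.
by rewrite (_ : (fun x => _ + _) = slope j)//; apply/funext => x; rewrite partial_cosph.
Qed.

Lemma L2_rate : L2 rate.
Proof.
have [Ld _] := H1_dil.
rewrite /rate; apply: L2D.
  by apply: L2_eq (L2_SS (L2D (L2Z (N%:R * (r / 2)) Ld) (L2Z r (L2_scale r0 L2_euler)))) => x;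
    rewrite mulrC.
by apply: L2_eq (L2_CC (L2B (L2Z (r ^+ 2) Ld) (L2Z (r ^+ 2 / 4) L2_rsq_dil))) => x; ring.
Qed.

Section cut.
Variables (v : E -> R) (vp : 'I_N -> E -> R).
Hypothesis Hv : H1 v vp.
Variable e : R.
Hypothesis e01 : 0 < e <= 1.
Let e0 : 0 < e. Proof. by case/andP: e01. Qed.
Local Notation chi := (@cutoff R N e).

Lemma abs_cutoff x : `|chi x| <= 1.
Proof. by rewrite ger0_norm ?(ltW (cutoff_gt0 e01 x))// (cutoff_le1 e01). Qed.

Lemma abs_partial_cutoff1 j x : `|partial j chi x| <= 1.
Proof. exact: le_trans (abs_partial_cutoff e01 j x) (cutoff_le1 e01 x). Qed.

Lemma H1_cutoff : H1 (fun x => chi x * v x) (fun j x => chi x * vp j x + partial j chi x * v x).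
Proof. exact: (H1M (Cinf_cutoff e01) abs_cutoff abs_partial_cutoff1 Hv). Qed.

Let Ck_cos : Cinf (fun x => CC x * chi x).
Proof. by move=> k; apply: CkM; [exact: Cinf_cosph|exact: Cinf_cutoff]. Qed.
Let Ck_sin : Cinf (fun x => SS x * chi x).
Proof. by move=> k; apply: CkM; [exact: Cinf_sinph|exact: Cinf_cutoff]. Qed.

Let pcos j x : partial j (fun x => CC x * chi x) x =
  CC x * partial j chi x + chi x * (r / 2 * x ord0 j * SS x).
Proof. by rewrite partialM ?partial_cosph//; [exact: Cinf_cosph|exact: Cinf_cutoff]. Qed.
Let psin j x : partial j (fun x => SS x * chi x) x =
  SS x * partial j chi x - chi x * (r / 2 * x ord0 j * CC x).
Proof. by rewrite partialM ?partial_sinph ?mulrN//; [exact: Cinf_sinph|exact: Cinf_cutoff]. Qed.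

Let bound : R := 1 + r / 2 * e^-1.

Let bM (a p q z y : R) : `|a| <= 1 -> `|q| <= 1 -> `|p| <= 1 -> 0 <= y -> `|z| * y <= e^-1 ->
  `|a * p + y * (r / 2 * z * q)| <= bound.
Proof.
move=> ha hq hp y0 hz; rewrite (le_trans (ler_normD _ _))// lerD//.
  by rewrite normrM mulr_ile1.
have r20 : 0 <= r / 2 by rewrite divr_ge0 ?(ltW r0).
have -> : y * (r / 2 * z * q) = r / 2 * (z * y * q) by ring.
rewrite normrM (ger0_norm r20) ler_wpM2l// normrM -[leRHS]mulr1 ler_pM//.
by rewrite normrM (ger0_norm y0).
Qed.

Let H1_cos : H1 (fun x => CC x * chi x * v x)
  (fun j x => CC x * chi x * vp j x + partial j (fun x => CC x * chi x) x * v x).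
Proof.
apply: (H1M (M := bound) Ck_cos _ _ Hv) => [x|j x].
  rewrite (@le_trans _ _ 1)//; last by rewrite lerDl mulr_ge0// ?divr_ge0 ?invr_ge0 ?(ltW r0) ?(ltW e0).
  by rewrite normrM mulr_ile1// ?cosph_le1// abs_cutoff.
rewrite pcos; apply: bM; rewrite ?cosph_le1 ?sinph_le1 ?abs_partial_cutoff1 ?(ltW (cutoff_gt0 e01 x))//.
exact: cutoff_coord.
Qed.

Let H1_sin : H1 (fun x => SS x * chi x * v x)
  (fun j x => SS x * chi x * vp j x + partial j (fun x => SS x * chi x) x * v x).
Proof.
apply: (H1M (M := bound) Ck_sin _ _ Hv) => [x|j x].
  rewrite (@le_trans _ _ 1)//; last by rewrite lerDl mulr_ge0// ?divr_ge0 ?invr_ge0 ?(ltW r0) ?(ltW e0).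
  by rewrite normrM mulr_ile1// ?sinph_le1// abs_cutoff.
rewrite psin -mulrN -mulrN; apply: bM; rewrite ?normrN ?cosph_le1 ?sinph_le1 ?abs_partial_cutoff1 ?(ltW (cutoff_gt0 e01 x))//.
exact: cutoff_coord.
Qed.

Let L2_euler_sin :
  L2 (euler (fun j x => SS x * chi x * vp j x + partial j (fun x => SS x * chi x) x * v x)).
Proof.
have [Lv Hvp] := Hv.
have mc : measurable_fun setT (chi : E -> R) by exact: Cinf_measurable (Cinf_cutoff e01).
have mco j : measurable_fun setT (fun x : E => x ord0 j) by exact: measurable_coord.
have mr : measurable_fun setT (@rsq R N) by exact: Cinf_measurable (@Cinf_rsq R N).
apply: L2_sum => j; have [Lj _] := Hvp j.
have mp : measurable_fun setT (partial j chi : E -> R) by exact: Cinf_measurable (Cinf_partial j (Cinf_cutoff e01)).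
have bc (x : E) : `|x ord0 j * chi x| <= e^-1.
  by rewrite normrM (gtr0_norm (cutoff_gt0 e01 x)); exact: cutoff_coord.
have bp (x : E) : `|x ord0 j * partial j chi x| <= e^-1.
  rewrite normrM; apply: le_trans (cutoff_coord e01 x j).
  by rewrite ler_wpM2l//; exact: abs_partial_cutoff.
have b2 (x : E) : `|x ord0 j ^+ 2 * chi x| <= e^-1.
  rewrite normrM (gtr0_norm (cutoff_gt0 e01 x)) ger0_norm ?sqr_ge0//.
  apply: le_trans (cutoff_rsq e01 x).
  by rewrite ler_wpM2r ?sqr_coord_le// ltW ?cutoff_gt0.
have L1 := L2_SS (L2_bounded (measurable_funM (mco j) mc) bc Lj).
have L3 := L2_SS (L2_bounded (measurable_funM (mco j) mp) bp Lv).
have L4 := L2Z (r / 2) (L2_CC (L2_bounded (measurable_funM (measurable_funX 2 (mco j)) mc) b2 Lv)).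
by apply: L2_eq (L2B (L2D L1 L3) L4) => x; rewrite psin /=; ring.
Qed.

(** Add the rescaled ground-state equation tested with cos(phase) chi v and r/2
times euler_by_parts for u(r x) and sin(phase) chi v.  The integrands then
agree pointwise: the cross terms x . grad u and |x|^2 u come from the gradients
of the cosine and of the sine. *)
Lemma cutoff_identity :
  has_integral mu (fun x => chi x * (r ^+ 2 * (potential b sigma u (r *: x) * dil x) * (CC x * v x)))
    (\sum_j dot (slope j) (fun x => chi x * vp j x + partial j chi x * v x)
      + dot rate (fun x => chi x * v x)).
Proof.
have [Ld Hd] := H1_dil; have [Lv Hvp] := Hv.
apply: has_integral_eq (scaled_ground_state r0 H1_cos) => [x|]; first by rewrite /dil; ring.
have [Lc Hc] := H1_cos; have [Ls Hs] := H1_sin; have [Lx Hx] := H1_cutoff.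
have Le : L2 (euler ddil).
  have := L2_scale r0 L2_euler.
  by rewrite (_ : (fun x => _) = euler ddil)//; apply/funext => x; rewrite euler_ddil.
have EP := euler_by_parts Ld Ls (fun j => (Hd j).1) (fun j => (Hs j).1)
  (fun j => (Hd j).2) (fun j => (Hs j).2) Le L2_euler_sin.
have I1 := has_integralD (has_integralD
  (has_integral_sum (index_enum 'I_N) (fun j => has_integral_dot (Hd j).1 (Hc j).1))
  (has_integralZ (r ^+ 2) (has_integral_dot Ld Lc)))
  (has_integralZ (r / 2) (has_integralD (has_integralD (has_integral_dot Le Ls)
   (has_integral_dot Ld L2_euler_sin)) (has_integralZ N%:R (has_integral_dot Ld Ls)))).
rewrite EP mulr0 addr0 in I1.
have I2 := has_integralD
  (has_integral_sum (index_enum 'I_N) (fun j => has_integral_dot (L2_slope j) (Hx j).1))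
  (has_integral_dot L2_rate Lx).
apply: has_integral_unique I1 _; apply: has_integral_eq I2 => [x|//].
pose p j := ddil j x.
pose rest := \sum_j (r * x ord0 j * p j * SS x - (r / 2) ^+ 2 * x ord0 j ^+ 2 * dil x * CC x) * (chi x * v x).
have E1 : \sum_j ddil j x * (CC x * chi x * vp j x + partial j (fun x => CC x * chi x) x * v x)
   + r / 2 * (dil x * euler (fun j x => SS x * chi x * vp j x + partial j (fun x => SS x * chi x) x * v x) x)
   + r / 2 * (euler ddil x * (SS x * chi x * v x)) =
   \sum_j slope j x * (chi x * vp j x + partial j chi x * v x) + rest.
  rewrite /euler !(mulr_sumr, mulr_suml) -!big_split/=; apply: eq_bigr => j _.
  by rewrite pcos psin /slope /p; field.
have E2 : rest = (r * euler g (r *: x) * SS x - (r / 2) ^+ 2 * rsq x * dil x * CC x) * (chi x * v x).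
  rewrite /rest -mulr_suml; congr (_ * _); rewrite sumrB; congr (_ - _).
    by rewrite -mulr_suml -euler_ddil /euler mulr_sumr; congr (_ * _); apply: eq_bigr => j _; rewrite mulrA.
  by rewrite -!mulr_suml -mulr_sumr.
transitivity (\sum_j slope j x * (chi x * vp j x + partial j chi x * v x) + rest +
   (r ^+ 2 * (dil x * (CC x * chi x * v x)) + r / 2 * (N%:R * (dil x * (SS x * chi x * v x))))).
  by rewrite E2 /rate; field.
rewrite -E1; ring.
Qed.
End cut.
End blow_up_profile.

Lemma mvt_abs {R : realType} (f df : R -> R) (lo hi K s a : R) :
  (forall z, lo <= z <= hi -> is_derive z 1 f (df z)) ->
  (forall z, lo <= z <= hi -> `|df z| <= K) ->
  lo <= s <= hi -> lo <= a <= hi -> `|f s - f a| <= K * `|s - a|.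
Proof.
move=> der bd.
wlog lt : s a / s < a => [H hs ha|/andP[s1 s2] /andP[a1 a2]].
  have [lt|lt|->] := ltgtP s a; first exact: H.
    by rewrite distrC [`|s - a|]distrC; exact: H.
  by rewrite !subrr normr0 mulr0.
have cont : {within `[s, a], continuous f}.
  apply: derivable_within_continuous => z; rewrite in_itv/= => /andP[z1 z2].
  by have [] := der z _; [rewrite (le_trans s1)//= (le_trans z2)|].
have [|z] := MVT lt _ cont (df := df).
  by move=> z; rewrite in_itv/= => /andP[z1 z2]; apply: der; rewrite !ltW ?(le_lt_trans s1)// ?(lt_le_trans z2).
rewrite in_itv/= => /andP[z1 z2] E1.
rewrite distrC E1 normrM [`|s - a|]distrC ler_wpM2r//; apply: bd.
by rewrite !ltW ?(le_lt_trans s1)// ?(lt_le_trans z2).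
Qed.

Lemma cvg_seq_bound {R : realType} (r_ : nat -> R) (a : R) : r_ n @[n --> \oo] --> a ->
  exists M : R, (forall n, r_ n <= M) /\ a <= M.
Proof.
move=> cv; have [M [_ HM]] := cvg_seq_bounded (cvgP _ cv).
have b n : r_ n <= M + 1.
  by apply: le_trans (ler_norm _) _; apply: HM => //; rewrite ltrDl.
by exists (M + 1); split => //; rewrite -(cvg_lim _ cv)//; apply: limr_le; [exact: cvgP cv|exact: nearW].
Qed.

Section profile.
Context {R : realType} {N : nat}.
Local Notation E := 'rV[R]_N.
Local Notation mu := (@lebesgue_rV R N).
Local Notation L2 := (isL2 mu).
Local Notation dot := (l2dot mu). Local Notation sqcvg := (l2cvg mu).
Implicit Types (f : E -> R) (v : E -> R) (vp : 'I_N -> E -> R).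

Lemma cvg_sum_ord (F : 'I_N -> nat -> R) (l : 'I_N -> R) :
  (forall j, F j n @[n --> \oo] --> l j) -> \sum_j F j n @[n --> \oo] --> \sum_j l j.
Proof.
move=> cF; elim: (index_enum _) => [|j s IH].
  by rewrite big_nil; under eq_fun do rewrite big_nil; exact: cvg_cst.
by rewrite big_cons; under eq_fun do rewrite big_cons; apply: cvgD.
Qed.

(** Dominated convergence. *)
Lemma has_integral_cvg (F_ : nat -> E -> R) (F G : E -> R) (a_ : nat -> R) (a : R) :
  (forall n, has_integral mu (F_ n) (a_ n)) -> mu.-integrable setT (EFin \o G) ->
  (forall x, F_ n x @[n --> \oo] --> F x) -> (forall n x, `|F_ n x| <= `|G x|) ->
  a_ n @[n --> \oo] --> a -> has_integral mu F a.
Proof.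
move=> iF iG cF dF ca.
have mF_ n : measurable_fun setT (F_ n).
  by have [i _] := iF n; apply/measurable_EFinP; exact: measurable_int i.
have mF : measurable_fun setT F.
  exact: (@measurable_fun_cvg _ _ R setT F_ F mF_ (fun x _ => cF x)).
have [] := @dominated_convergence _ _ R mu setT measurableT (fun n x => (F_ n x)%:E)
  (EFin \o F) (fun x => `|G x|%:E).
- by move=> n; apply/measurable_EFinP.
- exact/measurable_EFinP.
- by apply: aeW => x _; apply: cvg_EFin; [exact: nearW|exact: cF].
- by have := integrable_abse iG; apply: eq_integrable.
- by apply: aeW => x n _ /=; rewrite lee_fin.
move=> intF _ cv; split => //.
have cv' : (a_ n)%:E @[n --> \oo] --> (\int[mu]_x (F x)%:E)%E.
  apply: cvg_trans cv; apply: near_eq_cvg; apply: nearW => n.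
  have [i <-] := iF n; rewrite /Rintegral fineK//; exact: integrable_fin_num.
rewrite /Rintegral; have fi := integrable_fin_num measurableT intF.
have c2 : a_ n @[n --> \oo] --> fine (\int[mu]_x (F x)%:E)%E.
  by rewrite -(fineK fi) in cv'; move/fine_cvgP : cv' => [].
exact: (cvg_unique _ c2 ca).
Qed.

Variables (b sigma : R) (u : E -> R) (g : 'I_N -> E -> R).
Hypotheses (Hu : H1 u g) (heq : real_ground_state b sigma u g).
Hypotheses (Lwu : L2 (fun x => (1 + rsq x) * u x))
  (Lwg : forall j, L2 (fun x => (1 + rsq x) * g j x)).

(** Let the cut-off tend to 1; the nonlinear term is dominated because its product
with v is integrable without the cut-off. *)
Lemma profile_identity (r c : R) v vp : 0 < r -> H1 v vp ->
  has_integral mu (fun x => r ^+ 2 * (potential b sigma u (r *: x) * dil u r x) * (cosph c r x * v x))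
    (\sum_j dot (slope u g r c j) (vp j) + dot (rate u g r c) v).
Proof.
move=> r0 Hv; have [Lv Hvp] := Hv.
have e01 n : 0 < (n.+1%:R^-1 : R) <= 1 by rewrite invr_gt0 ltr0n/= invf_le1// ler1n.
have [iG _] := scaled_ground_state Hu heq r0 Hv.
apply: (has_integral_cvg (fun n => cutoff_identity Hu heq Lwu Lwg r0 c Hv (e01 n)) iG).
- move=> x; rewrite -[X in _ --> X]mul1r; apply: cvgM; last exact: cvg_cst.
  exact: cutoff_cvg.
- move=> n x; rewrite normrM -[leRHS]mul1r ler_pM//; first exact: abs_cutoff.
  by rewrite /dil !normrM ler_wpM2l ?mulr_ge0// -[leRHS]mul1r ler_wpM2r// cosph_le1.
have mc n : measurable_fun setT (cutoff n.+1%:R^-1 : E -> R) by exact: Cinf_measurable (Cinf_cutoff (e01 n)).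
have mpc j n : measurable_fun setT (partial j (cutoff n.+1%:R^-1) : E -> R).
  exact: Cinf_measurable (Cinf_partial j (Cinf_cutoff (e01 n))).
have c1 f : L2 f -> sqcvg (fun n x => cutoff n.+1%:R^-1 x * f x) f.
  move=> Lf; have [mf _] := Lf; apply: (sqcvg_dom _ _ _ (L2Z 2 Lf)) => //.
  - by move=> n; apply: measurable_funM.
  - by move=> x; rewrite -[X in _ --> X]mul1r; apply: cvgM; [exact: cutoff_cvg|exact: cvg_cst].
  move=> n x; rewrite (le_trans (ler_normB _ _))// normrM [leRHS]normrM [`|2|]ger0_norm//.
  by rewrite [2 * _]mulrDl mul1r lerD2r -[leRHS]mul1r ler_wpM2r// abs_cutoff.
have c2 j f : L2 f -> sqcvg (fun n x => partial j (cutoff n.+1%:R^-1) x * f x) (fun=> 0).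
  move=> Lf; have [mf _] := Lf; apply: (sqcvg_dom _ _ _ Lf) => //.
  - by move=> n; apply: measurable_funM.
  - by move=> x; rewrite -[X in _ --> X](mul0r (f x)); apply: cvgM; [exact: partial_cutoff_cvg|exact: cvg_cst].
  by move=> n x; rewrite subr0 normrM -[leRHS]mul1r ler_wpM2r// abs_partial_cutoff1.
have Lc n f : L2 f -> L2 (fun x => cutoff n.+1%:R^-1 x * f x).
  by apply: L2_bounded => // x; exact: (abs_cutoff (e01 n)).
have Lpc j n f : L2 f -> L2 (fun x => partial j (cutoff n.+1%:R^-1) x * f x).
  by apply: L2_bounded => // x; exact: (abs_partial_cutoff1 (e01 n)).
apply: cvgD; last first.
  by apply: dot_cvg; [move=> n; exact: L2_rate|exact: L2_rate|move=> n; exact: Lc|by []|exact: sqcvg_cst|exact: c1].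
apply: cvg_sum_ord => j; have [Lj _] := Hvp j.
apply: dot_cvg; [move=> n; exact: L2_slope|exact: L2_slope|move=> n; apply: L2D; [exact: Lc|exact: Lpc]|by []| |].
  exact: sqcvg_cst.
apply: (@sqcvg_eq _ _ _ _ (fun n x => cutoff n.+1%:R^-1 x * vp j x + partial j (cutoff n.+1%:R^-1) x * v x)
  _ (fun x => vp j x + 0)); [by []|by move=> x; rewrite addr0|].
have [mv _] := Lv; have [mvj _] := Lj.
apply: sqcvgD; [by move=> n; apply: measurable_funM|by []|by move=> n; apply: measurable_funM|exact: measurable_cst|exact: c1|exact: c2].
Qed.
End profile.

(** * Dependence of the profile on the dilation parameter *)

Section evolution.
Context {R : realType} {N : nat}.
Local Notation E := 'rV[R]_N.
Local Notation mu := (@lebesgue_rV R N).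
Local Notation L2 := (isL2 mu).
Local Notation sqcvg := (l2cvg mu).

(** The factor that makes the dilation unitary. *)
Definition amp (r : R) : R := r `^ (N%:R / 2).

Lemma amp_ge0 r : 0 <= amp r. Proof. exact: powR_ge0. Qed.

Lemma amp_le (r s : R) : 0 <= r -> r <= s -> amp r <= amp s.
Proof.
move=> r0 rs; apply: ge0_ler_powR; rewrite ?nnegrE ?divr_ge0//; exact: le_trans rs.
Qed.

Lemma amp_sq (r : R) : 0 <= r -> amp r ^+ 2 = r ^+ N.
Proof. by move=> r0; rewrite /amp -powR_mulrn ?powR_ge0// -powRrM divfK// powR_mulrn. Qed.

Lemma is_derive_amp (r : R) : 0 < r -> is_derive r 1 amp (N%:R / 2 * r^-1 * amp r).
Proof.
move=> r0; apply: (is_derive_eq (is_derive1_powR (N%:R / 2) r0)).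
by rewrite -[RHS]mulrA powRB ?(gt_eqF r0) ?implybT// powRr1 ?(ltW r0)// [r^-1 * _]mulrC.
Qed.

Variables (u : E -> R) (g : 'I_N -> E -> R).
Hypotheses (Hu : H1 u g).
Hypotheses (Lwu : L2 (fun x => (1 + rsq x) * u x))
  (Lwg : forall j, L2 (fun x => (1 + rsq x) * g j x)).

Definition prof (c r : R) (x : E) : R := amp r * (cosph c r x * dil u r x).
Definition profd (c r : R) j (x : E) : R := amp r * slope u g r c j x.
(** The derivative of the profile with respect to t, where r = 1/(1 - t) has
derivative r^2. *)
Definition vel (c r : R) (x : E) : R := amp r *
  ((N%:R * (r / 2) * dil u r x + r * euler g (r *: x)) * cosph c r x -
   (r ^+ 2 - r ^+ 2 / 4 * rsq x) * dil u r x * sinph c r x).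

Lemma vel_rate c r x : amp r * rate u g r c x = vel (c - pi / 2) r x.
Proof. by rewrite /vel /rate cosph_shift sinph_shift mulrN opprK. Qed.

Lemma vel_opp c r x : vel (c - pi / 2 - pi / 2) r x = - vel c r x.
Proof. by rewrite /vel cosph_shift sinph_shift sinph_shift cosph_shift; ring. Qed.

Lemma L2_vel c r : 0 < r -> L2 (vel c r).
Proof.
move=> r0; apply: L2_eq (L2Z (amp r) (L2_rate Hu Lwu Lwg r0 (c + pi / 2))) => x.
by rewrite vel_rate addrK.
Qed.

Lemma H1_prof c r : 0 < r -> H1 (prof c r) (profd c r).
Proof.
move=> r0; have [Lf Hf] := H1_cos_dil Hu Lwu r0 c.
split; first exact: L2Z.
by move=> j; have [Lj wj] := Hf j; split; [exact: L2Z|exact: wpartZ].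
Qed.

Lemma is_derive_cosph c (r : R) (x : E) :
  is_derive r 1 (fun r => cosph c r x) (- (1 - rsq x / 4) * sinph c r x).
Proof.
have dp : is_derive r 1 (fun r : R => phase c r x) (1 - rsq x / 4).
  have -> : (fun r : R => phase c r x) = (fun r => (1 - rsq x / 4) * r + c).
    by apply/funext => s; rewrite /phase; ring.
  apply: (is_derive_eq (is_deriveD (is_deriveM (is_derive_cst (1 - rsq x / 4 : R) r 1) (is_derive_id r 1))
    (is_derive_cst (c : R) r 1))).
  by rewrite /GRing.scale/=; ring.
apply: (is_derive_eq (is_derive1_comp (is_derive_cos _) dp)).
by rewrite /sinph; ring.
Qed.

Definition factor c (x : E) (r : R) : R := amp r * cosph c r x.
Definition dfactor c (x : E) (r : R) : R :=
  N%:R / 2 * r^-1 * amp r * cosph c r x - amp r * ((1 - rsq x / 4) * sinph c r x).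

Lemma is_derive_factor c x (r : R) : 0 < r -> is_derive r 1 (factor c x) (dfactor c x r).
Proof.
move=> r0; apply: (is_derive_eq (is_deriveM (is_derive_amp r0) (is_derive_cosph c r x))).
by rewrite /dfactor /GRing.scale/=; ring.
Qed.

Lemma is_derive_continuous1 (f : R -> R) (r d : R) : is_derive r 1 f d -> {for r, continuous f}.
Proof. by move=> [df _]; apply: differentiable_continuous; apply/derivable1_diffP. Qed.

(** The derivative of the phase in r grows like |x|^2, which the decay of u absorbs. *)
Lemma dfactor_bound c x (r M : R) : 1 <= r -> r <= M ->
  `|dfactor c x r| <= amp M * (N%:R / 2 + 1) * (1 + rsq x).
Proof.
move=> r1 rM; have r0 : 0 < r by exact: lt_le_trans r1.
have aM : amp r <= amp M by apply: amp_le => //; exact: ltW.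
have n0 : 0 <= N%:R / 2 :> R by rewrite divr_ge0.
have q0 := rsq_ge0 x.
rewrite /dfactor (le_trans (ler_normB _ _))//.
have h1 : `|N%:R / 2 * r^-1 * amp r * cosph c r x| <= amp M * (N%:R / 2).
  rewrite normrM -[leRHS]mulr1 ler_pM ?cosph_le1//.
  rewrite ger0_norm ?mulr_ge0 ?invr_ge0 ?amp_ge0 ?(ltW r0)// mulrC ler_pM ?amp_ge0//.
    by rewrite mulr_ge0 ?invr_ge0 ?(ltW r0).
  by rewrite -[leRHS]mulr1 ler_wpM2l// invf_le1.
have h2 : `|amp r * ((1 - rsq x / 4) * sinph c r x)| <= amp M * (1 + rsq x).
  rewrite normrM (ger0_norm (amp_ge0 r)) ler_pM ?amp_ge0//.
  rewrite normrM -[leRHS]mulr1 ler_pM ?sinph_le1//.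
  by rewrite ler_norml; apply/andP; split; lra.
have := amp_ge0 M; move: h1 h2; set A := `|_|; set B := `|_|; set a := amp M; set n := N%:R / 2 in n0 *.
move=> h1 h2 a0.
apply: (le_trans (lerD h1 h2)).
have : 0 <= a * n * rsq x by rewrite !mulr_ge0.
by lra.
Qed.

Section sequence.
Variables (r_ : nat -> R) (a : R).
Hypotheses (r1 : forall n, 1 <= r_ n) (a1 : 1 <= a) (ra : r_ n @[n --> \oo] --> a).
Let r0 n : 0 < r_ n. Proof. exact: lt_le_trans (r1 n). Qed.
Let a0 : 0 < a. Proof. exact: lt_le_trans a1. Qed.

Lemma factor_cvg c x : factor c x (r_ n) @[n --> \oo] --> factor c x a.
Proof.
by apply: (continuous_cvg _ (is_derive_continuous1 (is_derive_factor c x a0))).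
Qed.

Lemma factor_bound : exists M : R, forall c n x, `|factor c x (r_ n)| <= M.
Proof.
have [M [rM aM]] := cvg_seq_bound ra.
exists (amp M) => c n x; rewrite normrM (ger0_norm (amp_ge0 _)) -[leRHS]mulr1.
by rewrite ler_pM ?amp_ge0 ?cosph_le1// amp_le// ltW.
Qed.

Lemma measurable_factor c (r : R) : measurable_fun setT (fun x : E => factor c x r).
Proof. by apply: measurable_funM => //; exact: Cinf_measurable (Cinf_cosph c r). Qed.

Lemma sqcvg_prof c : sqcvg (fun n => prof c (r_ n)) (prof c a).
Proof.
have [Lu _] := Hu; have [M HM] := factor_bound.
have := sqcvg_mul_scale Lu ltr01 r1 a1 ra (fun n => measurable_factor c (r_ n))
  (measurable_factor c a) (HM c) (@factor_cvg c).
by apply: sqcvg_eq => [n x|x]; rewrite /prof /factor /dil mulrA.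
Qed.

(** In the second term of the gradient, r x_j is a coordinate of r x: it is a
bounded multiplier times a dilation of x_j u. *)
Lemma sqcvg_profd c j : sqcvg (fun n => profd c (r_ n) j) (profd c a j).
Proof.
have [Lu Hg] := Hu; have [Lj _] := Hg j; have [M HM] := factor_bound.
have [B [rB aB]] := cvg_seq_bound ra.
have Lx : L2 (fun x => x ord0 j * u x) by exact: L2_coordM.
have mid (r : R) : measurable_fun setT (fun x : E => r * factor c x r).
  by apply: measurable_funM => //; exact: measurable_factor.
have ms (r : R) : measurable_fun setT (fun x : E => 2^-1 * factor (c - pi / 2) x r).
  by apply: measurable_funM => //; exact: measurable_factor.
have B0 : 0 <= B by rewrite (le_trans _ aB)// ltW.
have M0 : 0 <= M by apply: le_trans (HM c 0%N 0).
have c1 := @sqcvg_mul_scale R N (g j) (fun n x => r_ n * factor c x (r_ n)) (fun x => a * factor c x a)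
  (B * M) r_ a 1 Lj ltr01 r1 a1 ra (fun n => mid (r_ n)) (mid a).
have {}c1 := c1 (fun n x => _) (fun x => _).
have c2 := @sqcvg_mul_scale R N _ (fun n x => 2^-1 * factor (c - pi / 2) x (r_ n))
  (fun x => 2^-1 * factor (c - pi / 2) x a)
  M r_ a 1 Lx ltr01 r1 a1 ra (fun n => ms (r_ n)) (ms a).
have {}c2 := c2 (fun n x => _) (fun x => _).
have mf n : measurable_fun setT (fun x => r_ n * factor c x (r_ n) * g j (r_ n *: x)).
  by apply: measurable_funM => //; apply: measurable_comp_scale; case: Lj.
have mfa : measurable_fun setT (fun x => a * factor c x a * g j (a *: x)).
  by apply: measurable_funM => //; apply: measurable_comp_scale; case: Lj.
have mg n : measurable_fun setT (fun x => 2^-1 * factor (c - pi / 2) x (r_ n) * ((r_ n *: x) ord0 j * u (r_ n *: x))).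
  by apply: measurable_funM => //; apply: (measurable_comp_scale _ Lx.1).
have mga : measurable_fun setT (fun x => 2^-1 * factor (c - pi / 2) x a * ((a *: x) ord0 j * u (a *: x))).
  by apply: measurable_funM => //; apply: (measurable_comp_scale _ Lx.1).
apply: (sqcvg_eq _ _ (sqcvgD mf mfa mg mga (c1 _ _) (c2 _ _))).
- by move=> n x; rewrite /profd /slope /factor cosph_shift /ddil /dil mxE; field.
- by move=> x; rewrite /profd /slope /factor cosph_shift /ddil /dil mxE; field.
- by move=> n x; rewrite normrM (gtr0_norm (r0 n)) ler_pM// ltW.
- by move=> x; apply: cvgM => //; exact: factor_cvg.
- move=> n x; rewrite normrM ger0_norm ?invr_ge0//.
  by have := HM (c - pi / 2) n x; have := normr_ge0 (factor (c - pi / 2) x (r_ n)); lra.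
- by move=> x; apply: cvgM; [exact: cvg_cst|exact: factor_cvg].
Qed.

(** Vary the factor first, with the decay of u as a domination, and the dilation
second. *)
Lemma sqcvg_prof_derive c : (forall n, r_ n != a) ->
  sqcvg (fun n x => (r_ n - a)^-1 * (prof c (r_ n) x - prof c a x))
        (fun x => a^-1 ^+ 2 * vel c a x).
Proof.
move=> rna; have [Lu Hg] := Hu; have [M HM] := factor_bound.
have [B [rB aB]] := cvg_seq_bound ra.
have Leu := L2_euler Hu Lwg.
have Lda : L2 (dil u a) by exact: L2_scale.
have mda : measurable_fun setT (dil u a) by case: Lda.
have Lra : L2 (fun x => (1 + rsq x) * dil u a x).
  by apply: L2_eq (L2D Lda (L2_rsq_dil Hu Lwu a0)) => x; ring.
pose K := amp B * (N%:R / 2 + 1).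
have quot c' x n : `|(r_ n - a)^-1 * (factor c' x (r_ n) - factor c' x a)| <= K * (1 + rsq x).
  have h : `|factor c' x (r_ n) - factor c' x a| <= K * (1 + rsq x) * `|r_ n - a|.
    apply: (@mvt_abs R _ (dfactor c' x) 1 B).
    - by move=> z /andP[z1 _]; apply: is_derive_factor; exact: lt_le_trans z1.
    - by move=> z /andP[z1 z2]; exact: dfactor_bound.
    - by rewrite r1 rB.
    - by rewrite a1 aB.
  by rewrite normrM normfV mulrC ler_pdivrMr// normr_gt0 subr_eq0.
have dquot x : `|dfactor c x a| <= K * (1 + rsq x) by exact: dfactor_bound.
have mq n : measurable_fun setT (fun x : E => (r_ n - a)^-1 * (factor c x (r_ n) - factor c x a)).
  by apply: measurable_funM => //; apply: measurable_funB; exact: measurable_factor.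
have md : measurable_fun setT (fun x : E => dfactor c x a).
  have mr : measurable_fun setT (@rsq R N) by exact: Cinf_measurable (@Cinf_rsq R N).
  apply: measurable_funB.
    by apply: measurable_funM => //; exact: Cinf_measurable (Cinf_cosph c a).
  apply: measurable_funM => //; apply: measurable_funM; last exact: Cinf_measurable (Cinf_sinph c a).
  by apply: measurable_funB => //; apply: measurable_funM.
have C1 : sqcvg (fun n x => (r_ n - a)^-1 * (factor c x (r_ n) - factor c x a) * dil u a x)
    (fun x => dfactor c x a * dil u a x).
  apply: (sqcvg_dom _ _ _ (L2Z (2 * K) Lra)).
  - by move=> n; apply: measurable_funM.
  - exact: measurable_funM.
  - move=> x; apply: cvgM; last exact: cvg_cst.
    have := is_derive_seq (is_derive_factor c x a0) rna ra.
    by apply: cvg_trans; apply: near_eq_cvg; apply: nearW => n; rewrite mulrC.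
  move=> n x; rewrite -mulrBl normrM mulrA [leRHS]normrM ler_wpM2r//.
  apply: le_trans (ler_norm _); rewrite (le_trans (ler_normB _ _))//.
  by rewrite -mulrA [2 * _]mulrDl mul1r lerD.
have mD n : measurable_fun setT (fun x : E => (r_ n - a)^-1 * (u (r_ n *: x) - u (a *: x))).
  by apply: measurable_funM => //; apply: measurable_funB; apply: measurable_comp_scale; case: Lu.
have LD : L2 (fun x => a^-1 * euler g (a *: x)) by apply: L2Z; exact: L2_scale.
have C2 := sqcvg_mulr (fun n => measurable_factor c (r_ n)) (measurable_factor c a)
  (HM c) (@factor_cvg c) mD LD
  (sqcvg_dilation_derive Lu (fun j => (Hg j).1) (fun j => (Hg j).2) Leu ltr01 rna r1 a1 ra).
apply: (sqcvg_eq _ _ (sqcvgD _ _ _ _ C1 C2)).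
- by move=> n x; rewrite /prof /factor /dil; ring.
- by move=> x; rewrite /vel /dfactor /factor; field; rewrite gt_eqF.
- by move=> n; apply: measurable_funM.
- exact: measurable_funM.
- by move=> n; apply: measurable_funM => //; exact: measurable_factor.
- by apply: measurable_funM; [exact: measurable_factor|case: LD].
Qed.
End sequence.
End evolution.

(** * The complex profile *)

Section solution.
Context {R : realType} {N : nat}.
Local Notation E := 'rV[R]_N.
Local Notation mu := (@lebesgue_rV R N).
Local Notation sq := (l2sq mu). Local Notation L2 := (isL2 mu).
Local Notation dot := (l2dot mu). Local Notation sqcvg := (l2cvg mu).

Lemma H1B (f f' : E -> R) (p p' : 'I_N -> E -> R) : H1 f p -> H1 f' p' ->
  H1 (fun x => f x - f' x) (fun j x => p j x - p' j x).
Proof.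
move=> [Lf Hf] [Lf' Hf']; split; first exact: L2B.
move=> j; have [Lp wp] := Hf j; have [Lp' wp'] := Hf' j; split; first exact: L2B.
have := wpartD Lf Lp (L2Z (-1) Lf') (L2Z (-1) Lp') wp (wpartZ (-1) Lf' Lp' wp').
have -> : (fun x => f x + -1 * f' x) = (fun x => f x - f' x) by apply/funext => x; rewrite mulN1r.
by have -> : (fun x => p j x + -1 * p' j x) = (fun x => p j x - p' j x) by apply/funext => x; rewrite mulN1r.
Qed.

Lemma sqcvg_dot0 (f_ : nat -> E -> R) (f : E -> R) : (forall n, L2 (f_ n)) -> L2 f ->
  sqcvg f_ f -> dot (fun x => f_ n x - f x) (fun x => f_ n x - f x) @[n --> \oo] --> (0 : R).
Proof.
move=> Lf_ Lf; rewrite /l2cvg.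
have -> : (fun n => sq (fun x => f_ n x - f x)) =
    (fun n => (dot (fun x => f_ n x - f x) (fun x => f_ n x - f x))%:E).
  by apply/funext => n; rewrite sqE//; exact: L2B.
by move=> /fine_cvgP[_].
Qed.

Variables (b sigma : R) (u : E -> R) (g : 'I_N -> E -> R).
Hypotheses (N0 : (0 < N)%N) (sE : sigma = (2 - b) / N%:R).
Hypotheses (Hu : H1 u g) (heq : real_ground_state b sigma u g).
Hypotheses (Lwu : L2 (fun x => (1 + rsq x) * u x))
  (Lwg : forall j, L2 (fun x => (1 + rsq x) * g j x)).

Local Notation P1 := (prof u 0).
Local Notation P2 := (prof u (0 - pi / 2)).
Local Notation D1 := (profd u g 0).
Local Notation D2 := (profd u g (0 - pi / 2)).
Local Notation V1 := (vel u g 0).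
Local Notation V2 := (vel u g (0 - pi / 2)).

Lemma prof_sq (r : R) x : P1 r x ^+ 2 + P2 r x ^+ 2 = (@amp R N r * `|dil u r x|) ^+ 2.
Proof.
rewrite [RHS]exprMn real_normK ?num_real// /prof cosph_shift !exprMn -mulrDr -mulrDl.
by rewrite cos2Dsin2ph mul1r.
Qed.

(** This is where sigma = (2 - b)/N enters: the exponent of r is 2 for every b. *)
Lemma potential_scale (r : R) x : 0 < r ->
  enorm x `^ (- b) * (@amp R N r * `|dil u r x|) `^ (2 * sigma) =
  r ^+ 2 * potential b sigma u (r *: x).
Proof.
move=> r0; rewrite /potential enorm_scale ?(ltW r0)// !powRM ?amp_ge0 ?enorm_ge0 ?(ltW r0)//.
have -> : @amp R N r `^ (2 * sigma) = r `^ (2 - b).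
  rewrite /amp -powRrM sE; congr (_ `^ _); field.
  by rewrite pnatr_eq0 -lt0n.
have -> : r `^ (2 - b) = r ^+ 2 * r `^ (- b).
  by rewrite powRD ?(gt_eqF r0) ?implybT// powR_mulrn// ltW.
by rewrite /dil; ring.
Qed.

(** Real part cos(phase), imaginary part sin(phase) = cos(phase - pi/2). *)
Definition cprof (r : R) (x : E) : R[i] := (P1 r x +i* P2 r x)%C.

Lemma nonlinearity_cprof (r : R) x : 0 < r -> nonlinearity b sigma (cprof r) x =
  ((r ^+ 2 * potential b sigma u (r *: x) * P1 r x) +i*
   (r ^+ 2 * potential b sigma u (r *: x) * P2 r x))%C.
Proof.
move=> r0; rewrite /nonlinearity.
have -> : Normc.normc (cprof r x) = @amp R N r * `|dil u r x|.
  rewrite /cprof /= prof_sq sqrtr_sqr ger0_norm// mulr_ge0 ?amp_ge0//.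
by rewrite potential_scale// /cprof; apply/eqP; rewrite eq_complex/=; apply/andP; split; apply/eqP; ring.
Qed.

Lemma prof_identity (r c : R) v vp : 0 < r -> H1 v vp ->
  has_integral mu (fun x => r ^+ 2 * potential b sigma u (r *: x) * prof u c r x * v x)
    (\sum_j dot (profd u g c r j) (vp j) + dot (vel u g (c - pi / 2) r) v).
Proof.
move=> r0 Hv; have [Lv Hvp] := Hv.
apply: has_integral_eq (has_integralZ (@amp R N r) (profile_identity Hu heq Lwu Lwg c r0 Hv)) => [x|].
  by rewrite /prof; ring.
rewrite mulrDr mulr_sumr; congr (_ + _).
  apply: eq_bigr => j _; rewrite -dotZl//; first exact: L2_slope.
  by have [] := Hvp j.
rewrite -dotZl//; last exact: L2_rate.
by congr l2dot; apply/funext => x; rewrite vel_rate.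
Qed.

Lemma in_H1_cprof r : 0 < r -> H1 (re (cprof r)) (D1 r) /\ H1 (im (cprof r)) (D2 r).
Proof. by move=> r0; split; exact: H1_prof. Qed.

Section pairing.
Variables (r : R) (v : E -> R[i]) (p q : 'I_N -> E -> R).
Hypotheses (r0 : 0 < r) (Hr : H1 (re v) p) (Hi : H1 (im v) q).

Let I11 := prof_identity 0 r0 Hr.
Let I12 := prof_identity 0 r0 Hi.
Let I21 := prof_identity (0 - pi / 2) r0 Hr.
Let I22 := prof_identity (0 - pi / 2) r0 Hi.

Let ReE x : complex.Re (nonlinearity b sigma (cprof r) x * conjc (v x)) =
  r ^+ 2 * potential b sigma u (r *: x) * P1 r x * re v x +
  r ^+ 2 * potential b sigma u (r *: x) * P2 r x * im v x.
Proof. by rewrite nonlinearity_cprof// /re /im; case: (v x) => c d /=; ring. Qed.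

Let ImE x : complex.Im (nonlinearity b sigma (cprof r) x * conjc (v x)) =
  r ^+ 2 * potential b sigma u (r *: x) * P2 r x * re v x -
  r ^+ 2 * potential b sigma u (r *: x) * P1 r x * im v x.
Proof. by rewrite nonlinearity_cprof// /re /im; case: (v x) => c d /=; ring. Qed.

Lemma cprof_pairs : nonlinearity_pairs b sigma (cprof r) v.
Proof.
split.
  have [i _] := has_integralD I11 I22.
  by apply: eq_integrable i => // x _; rewrite ReE.
have [i _] := has_integralB I21 I12.
by apply: eq_integrable i => // x _; rewrite ImE.
Qed.

(** The identity for c = 0 brings the velocity of the imaginary part, and the one
for c = - pi/2 minus the velocity of the real part: the energy gradient is - i
times the velocity. *)
Lemma energy_gradient_cprof : energy_gradient b sigma (cprof r) v =
  ((dot (V2 r) (re v) - dot (V1 r) (im v)) +i*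
   (- dot (V1 r) (re v) - dot (V2 r) (im v)))%C.
Proof.
have [Hc1 Hc2] := in_H1_cprof r0.
have LV1 : L2 (V1 r) by exact: L2_vel.
have opp w : L2 w -> dot (vel u g (0 - pi / 2 - pi / 2) r) w = - dot (V1 r) w.
  move=> Lw; transitivity (dot (fun x => -1 * V1 r x) w); last by rewrite dotZl// mulN1r.
  by congr l2dot; apply/funext => x; rewrite vel_opp mulN1r.
have [Lr _] := Hr; have [Li _] := Hi.
have [_ E1] := has_integral_eq (fun x => esym (ReE x)) erefl (has_integralD I11 I22).
have [_ E2] := has_integral_eq (fun x => esym (ImE x)) erefl (has_integralB I21 I12).
rewrite /energy_gradient [L2dot (nonlinearity _ _ _) _]/L2dot /cintegral E1 E2 !opp//.
rewrite (eq_bigr _ (fun j _ => L2dot_weak_partial j Hc1 Hc2 Hr Hi)).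
apply/eqP; rewrite eq_complex ReB ImB Re_sum Im_sum /= !big_split/= sumrN.
by apply/andP; split; apply/eqP; ring.
Qed.
End pairing.

Lemma L2norm_cprof (r : R) : 0 < r -> L2norm (cprof r) = L2norm (of_real u).
Proof.
move=> r0; have [Hc1 Hc2] := in_H1_cprof r0; have [L1 _] := Hc1; have [L2' _] := Hc2.
have [Lu _] := Hu.
rewrite /L2norm; congr Num.sqrt.
have iu := has_integral_dot Lu Lu.
have [_ E] := has_integralZ (@amp R N r ^+ 2) (has_integral_scale r0 iu).
transitivity (\int[mu]_x (@amp R N r ^+ 2 * (u (r *: x) * u (r *: x)))).
  apply: eq_Rintegral => x _; rewrite normc_sq /= prof_sq exprMn real_normK ?num_real//.
rewrite E amp_sq ?(ltW r0)// mulrA -exprMn mulfV ?gt_eqF// expr1n mul1r.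
by apply: eq_Rintegral => x _; rewrite normc_sq /= expr0n addr0.
Qed.

(** In the sum of the squares of the two slopes, cosine and sine disappear and the
term of the phase can only add. *)
Lemma H1norm_cprof_ge (r : R) j : 0 < r ->
  r * Num.sqrt (dot (g j) (g j)) <= H1norm (cprof r).
Proof.
move=> r0; have [Hc1 Hc2] := in_H1_cprof r0.
have [_ /(_ j)[Lj _]] := Hu.
rewrite -ler_sqr ?nnegrE ?mulr_ge0 ?sqrtr_ge0 ?(ltW r0)// exprMn sqr_sqrtr ?dot_ge0//.
rewrite (H1norm_sq Hc1 Hc2) (bigD1 j)//=.
have h0 : 0 <= dot (re (cprof r)) (re (cprof r)) + dot (im (cprof r)) (im (cprof r)).
  by rewrite addr_ge0 ?dot_ge0.
have h1 : 0 <= \sum_(i < N | i != j) (dot (D1 r i) (D1 r i) + dot (D2 r i) (D2 r i)).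
  by apply: sumr_ge0 => i _; rewrite addr_ge0 ?dot_ge0.
suff : r ^+ 2 * dot (g j) (g j) <= dot (D1 r j) (D1 r j) + dot (D2 r j) (D2 r j) by lra.
have LD1 : L2 (D1 r j) by have [_ /(_ j)[]] := Hc1.
have LD2 : L2 (D2 r j) by have [_ /(_ j)[]] := Hc2.
have I1 := has_integralD (has_integral_dot LD1 LD1) (has_integral_dot LD2 LD2).
have I2 := has_integralZ (@amp R N r ^+ 2 * r ^+ 2) (has_integral_scale r0 (has_integral_dot Lj Lj)).
have := has_integral_ge0 (has_integralB I1 I2).
have -> : @amp R N r ^+ 2 * r ^+ 2 * (r^-1 ^+ N * dot (g j) (g j)) = r ^+ 2 * dot (g j) (g j).
  have rN : r ^+ N * r^-1 ^+ N = 1 by rewrite -exprMn mulfV ?gt_eqF// expr1n.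
  rewrite amp_sq ?(ltW r0)//.
  transitivity (r ^+ N * r^-1 ^+ N * (r ^+ 2 * dot (g j) (g j))); first by ring.
  by rewrite rN mul1r.
rewrite subr_ge0; apply; apply: aeW => x.
have -> : D1 r j x * D1 r j x + D2 r j x * D2 r j x - @amp R N r ^+ 2 * r ^+ 2 * (g j (r *: x) * g j (r *: x)) =
   @amp R N r ^+ 2 * (r / 2 * x ord0 j * dil u r x) ^+ 2.
  have := cos2Dsin2ph 0 r x => cs.
  have {cs}cs : sinph 0 r x ^+ 2 = 1 - cosph 0 r x ^+ 2 by rewrite -cs addrAC subrr add0r.
  rewrite /profd /slope cosph_shift sinph_shift /ddil.
  transitivity (@amp R N r ^+ 2 * ((cosph 0 r x ^+ 2 + sinph 0 r x ^+ 2) *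
     ((r * g j (r *: x)) ^+ 2 + (r / 2 * x ord0 j * dil u r x) ^+ 2)) -
     @amp R N r ^+ 2 * r ^+ 2 * (g j (r *: x) * g j (r *: x))); first by ring.
  by rewrite cs; ring.
by rewrite mulr_ge0// sqr_ge0.
Qed.

End solution.

(** * The strong solution and its blow-up *)

Section strong.
Context {R : realType} {N : nat}.
Local Notation E := 'rV[R]_N.
Local Notation mu := (@lebesgue_rV R N).
Local Notation sq := (l2sq mu). Local Notation L2 := (isL2 mu).
Local Notation dot := (l2dot mu). Local Notation sqcvg := (l2cvg mu).

Variables (b sigma : R) (u : E -> R) (g : 'I_N -> E -> R).
Hypotheses (N0 : (0 < N)%N) (sE : sigma = (2 - b) / N%:R).
Hypotheses (Hu : H1 u g) (heq : real_ground_state b sigma u g).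
Hypotheses (Lwu : L2 (fun x => (1 + rsq x) * u x))
  (Lwg : forall j, L2 (fun x => (1 + rsq x) * g j x)).

(** Pseudo-conformal time: 1/(1 - t) increases from 1 to infinity on [0, 1[. *)
Definition explicit_solution (t : R) : E -> R[i] := cprof u (1 - t)^-1.

Lemma rtime_ge1 (t : R) : 0 <= t < 1 -> 1 <= (1 - t)^-1.
Proof.
move=> /andP[t0 t1]; rewrite -[leLHS]invr1 lef_pV2 ?posrE ?subr_gt0//.
by rewrite gerBl.
Qed.

Lemma rtime_gt0 (t : R) : 0 <= t < 1 -> 0 < (1 - t)^-1.
Proof. by move=> /rtime_ge1; exact: lt_le_trans. Qed.

Section sequence.
Variables (t_ : nat -> R) (t : R).
Hypotheses (t01_ : forall n, 0 <= t_ n < 1) (t01 : 0 <= t < 1)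
  (tcv : t_ n @[n --> \oo] --> t).
Let r_ n := (1 - t_ n)^-1.
Let a := (1 - t)^-1.

Let rcv : r_ n @[n --> \oo] --> a.
Proof.
apply: cvgV; first by rewrite gt_eqF// subr_gt0; case/andP: t01.
by apply: cvgB; [exact: cvg_cst|].
Qed.
Let r1 n : 1 <= r_ n. Proof. exact: rtime_ge1. Qed.
Let a1 : 1 <= a. Proof. exact: rtime_ge1. Qed.

Lemma H1norm_phi_cvg : H1norm (fun x => explicit_solution (t_ n) x - explicit_solution t x) @[n --> \oo] --> (0 : R).
Proof.
have r0 n : 0 < r_ n by exact: rtime_gt0.
have a0 : 0 < a by exact: rtime_gt0.
suff H : H1norm (fun x => explicit_solution (t_ n) x - explicit_solution t x) ^+ 2 @[n --> \oo] --> (0 : R).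
  have -> : (fun n => H1norm (fun x => explicit_solution (t_ n) x - explicit_solution t x)) =
      (fun n => Num.sqrt (H1norm (fun x => explicit_solution (t_ n) x - explicit_solution t x) ^+ 2)).
    by apply/funext => n; rewrite sqrtr_sqr ger0_norm// sqrtr_ge0.
  rewrite -[X in _ --> X](sqrtr0 R); apply: (continuous_cvg _ (@sqrt_continuous R 0)) => //.
have Hc s (s0 : 0 < s) := in_H1_cprof Hu Lwu s0.
pose d c n x := prof u c (r_ n) x - prof u c a x.
pose dd c j n x := profd u g c (r_ n) j x - profd u g c a j x.
have HE n : H1norm (fun x => explicit_solution (t_ n) x - explicit_solution t x) ^+ 2 =
    dot (d 0 n) (d 0 n) + dot (d (0 - pi / 2) n) (d (0 - pi / 2) n) +
    \sum_j (dot (dd 0 j n) (dd 0 j n) + dot (dd (0 - pi / 2) j n) (dd (0 - pi / 2) j n)).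
  have := @H1norm_sq R N (fun x => explicit_solution (t_ n) x - explicit_solution t x) _ _
    (H1B (Hc _ (r0 n)).1 (Hc _ a0).1) (H1B (Hc _ (r0 n)).2 (Hc _ a0).2).
  exact.
under eq_fun do rewrite HE.
have L c s : 0 < s -> L2 (prof u c s) by move=> s0; case: (H1_prof Hu Lwu c s0).
have Ld c s j : 0 < s -> L2 (profd u g c s j).
  by move=> s0; have [_ /(_ j)[]] := H1_prof Hu Lwu c s0.
have c1 c : dot (d c n) (d c n) @[n --> \oo] --> (0 : R).
  apply: (@sqcvg_dot0 R N (fun n => prof u c (r_ n))) => [n||]; [exact: L|exact: L|].
  exact: (sqcvg_prof Hu r1 a1 rcv).
have c2 c j : dot (dd c j n) (dd c j n) @[n --> \oo] --> (0 : R).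
  apply: (@sqcvg_dot0 R N (fun n => profd u g c (r_ n) j)) => [n||]; [exact: Ld|exact: Ld|].
  exact: (sqcvg_profd Hu Lwu r1 a1 rcv).
have S : \sum_(j < N) (0 + 0 : R) = 0 by rewrite big1// => j _; rewrite addr0.
suff : dot (d 0 n) (d 0 n) + dot (d (0 - pi / 2) n) (d (0 - pi / 2) n) +
    \sum_j (dot (dd 0 j n) (dd 0 j n) + dot (dd (0 - pi / 2) j n) (dd (0 - pi / 2) j n))
    @[n --> \oo] --> (0 + 0 + \sum_(j < N) (0 + 0) : R) by rewrite S !addr0.
apply: cvgD; first by apply: cvgD; exact: c1.
by apply: cvg_sum_ord => j; apply: cvgD; exact: c2.
Qed.

(** The difference quotient in t is the one in r = 1/(1 - t) times the product of
the two values of r. *)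
Lemma sqcvg_time_derive c : (forall n, t_ n != t) ->
  sqcvg (fun n x => (t_ n - t)^-1 * (prof u c (r_ n) x - prof u c a x)) (vel u g c a).
Proof.
move=> tn.
have r0 n : 0 < r_ n by exact: rtime_gt0.
have a0 : 0 < a by exact: rtime_gt0.
have t1 n : 1 - t_ n != 0 by rewrite gt_eqF// subr_gt0; case/andP: (t01_ n).
have t1' : 1 - t != 0 by rewrite gt_eqF// subr_gt0; case/andP: t01.
have rE n : r_ n - a = (t_ n - t) * (r_ n * a) by rewrite /r_ /a; field; rewrite t1 t1'.
have rna n : r_ n != a.
  rewrite -subr_eq0 rE; apply: mulf_neq0; first by rewrite subr_eq0.
  by apply: mulf_neq0; rewrite gt_eqF.
have [B [rB aB]] := cvg_seq_bound rcv.
have Lp s : 0 < s -> L2 (prof u c s) by move=> s0; case: (H1_prof Hu Lwu c s0).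
have H := @sqcvg_mulr R _ _ mu (B * a) (fun n _ => r_ n * a) (fun=> a * a) _ _
  (fun n => measurable_cst _) (measurable_cst _) _ _ _ _
  (sqcvg_prof_derive Hu Lwu Lwg r1 a1 rcv c rna).
apply: sqcvg_eq (H _ _ _ _).
- move=> n x; rewrite rE mulrA; congr (_ * _); field.
  by rewrite !subr_eq0 tn !gt_eqF.
- by move=> x; field; rewrite gt_eqF.
- move=> n x; rewrite ger0_norm ?mulr_ge0 ?(ltW (r0 n)) ?(ltW a0)//.
  by rewrite ler_wpM2r ?(ltW a0).
- by move=> x; apply: cvgM; [exact: rcv|exact: cvg_cst].
- move=> n; apply: measurable_funM => //; apply: measurable_funB; [by case: (Lp _ (r0 n))|by case: (Lp _ a0)].
- by apply: L2Z; apply: L2_vel.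
Qed.
End sequence.

Lemma phi_H1 (t : R) : 0 <= t < 1 -> in_H1 (explicit_solution t).
Proof.
move=> /rtime_gt0 r0; apply/in_H1P.
by exists (profd u g 0 (1 - t)^-1), (profd u g (0 - pi / 2) (1 - t)^-1); exact: in_H1_cprof.
Qed.

Lemma phi_continuous : continuous_in_H1 1 explicit_solution.
Proof.
split=> t; rewrite in_itv/= => t01; first exact: phi_H1.
apply/cvgrPdist_lt => e e0.
have [] := @seq_eps_delta R (fun s => 0 <= s < 1) t
  (fun s => (H1norm (fun x => explicit_solution s x - explicit_solution t x))%:E) _ e e0.
  move=> s_ s01 cs e' e'0; have := H1norm_phi_cvg s01 t01 cs.
  move=> /cvgrPdist_lt/(_ _ e'0); apply: filterS => n; rewrite lte_fin sub0r normrN.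
  by rewrite ger0_norm// sqrtr_ge0.
move=> d d0 Hd; rewrite near_withinE; apply/nbhs_ballP; exists d => //= s.
rewrite /ball/= distrC => sd s01; have := Hd s; rewrite lte_fin sub0r normrN.
rewrite [`|H1norm _|]ger0_norm ?sqrtr_ge0//; exact.
Qed.

(** Once the velocity is inserted, the energy gradient turns the expression to be
bounded into the pairing of v with the error of the difference quotients, and
Cauchy-Schwarz gives uniformity in v. *)
Lemma phi_strong : strong_solution b sigma 1 explicit_solution.
Proof.
split; first exact: phi_continuous.
move=> t; rewrite in_itv/= => t01.
pose a := (1 - t)^-1; have a0 : 0 < a by exact: rtime_gt0.
split.
  by move=> v /in_H1P[p [q [Hr Hi]]]; exact: (cprof_pairs N0 sE Hu heq Lwu Lwg a0 Hr Hi).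
move=> eps eps0.
pose Q c s x := (s - t)^-1 * (prof u c (1 - s)^-1 x - prof u c a x).
pose err c s x := Q c s x - vel u g c a x.
have Lp c s : 0 <= s < 1 -> L2 (prof u c (1 - s)^-1).
  by move=> /rtime_gt0 s0; case: (H1_prof Hu Lwu c s0).
have LQ c s : 0 <= s < 1 -> L2 (Q c s) by move=> s01; apply: L2Z; apply: L2B; apply: Lp.
have LV c : L2 (vel u g c a) by exact: L2_vel.
have Lerr c s : 0 <= s < 1 -> L2 (err c s) by move=> s01; apply: L2B; [exact: LQ|exact: LV].
have small c : exists2 d : R, 0 < d & forall s, 0 <= s < 1 /\ s != t -> `|s - t| < d ->
    (sq (err c s) < ((eps / 4) ^+ 2)%:E)%E.
  apply: seq_eps_delta; last by rewrite exprn_gt0// divr_gt0.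
  move=> s_ Hs cs e e0.
  have := sqcvg_time_derive (fun n => (Hs n).1) t01 cs c (fun n => (Hs n).2).
  by move=> /(ge0_cvge0P (fun n => sq_ge0 _ _)) /(_ _ e0).
have [d1 d10 H1'] := small 0; have [d2 d20 H2'] := small (0 - pi / 2).
rewrite near_withinE near_withinE; apply/nbhs_ballP; exists (Num.min d1 d2); first by rewrite /= lt_min d10.
move=> s; rewrite /ball/= distrC lt_min => /andP[sd1 sd2] st.
rewrite in_itv/= => s01 v /in_H1P[p [q [Hr Hi]]].
have [Lr _] := Hr; have [Li _] := Hi.
have invv : in_L2 v by exact: in_L2_H1 Hr Hi.
have e4 : 0 <= eps / 4 by rewrite divr_ge0// ltW.
have sm c : (sq (err c s) < ((eps / 4) ^+ 2)%:E)%E -> Num.sqrt (dot (err c s) (err c s)) <= eps / 4.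
  rewrite sqE; last exact: Lerr.
  rewrite lte_fin => /ltW h; by rewrite -[leRHS]ger0_norm// -sqrtr_sqr ler_sqrt// sqr_ge0.
have {sm}[sm1 sm2] : Num.sqrt (dot (err 0 s) (err 0 s)) <= eps / 4 /\
    Num.sqrt (dot (err (0 - pi / 2) s) (err (0 - pi / 2) s)) <= eps / 4.
  by split; apply: sm; [exact: H1'|exact: H2'].
have vn : L2norm v <= H1norm v by exact: L2norm_le_H1norm Hr Hi.
have nr : Num.sqrt (dot (re v) (re v)) <= H1norm v.
  apply: le_trans vn; rewrite -[leRHS]ger0_norm ?L2norm_ge0// -sqrtr_sqr ler_sqrt ?sqr_ge0//.
  by rewrite L2norm_sq// lerDl dot_ge0.
have ni : Num.sqrt (dot (im v) (im v)) <= H1norm v.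
  apply: le_trans vn; rewrite -[leRHS]ger0_norm ?L2norm_ge0// -sqrtr_sqr ler_sqrt ?sqr_ge0//.
  by rewrite L2norm_sq// lerDr dot_ge0.
have CS c w : L2 w -> Num.sqrt (dot w w) <= H1norm v ->
    Num.sqrt (dot (err c s) (err c s)) <= eps / 4 -> `|dot (err c s) w| <= eps / 4 * H1norm v.
  move=> Lw wn en; apply: (le_trans (cauchy_schwarz (Lerr c s s01) Lw)).
  by rewrite ler_pM// sqrtr_ge0.
have B11 := CS _ _ Lr nr sm1; have B12 := CS _ _ Li ni sm1.
have B21 := CS _ _ Lr nr sm2; have B22 := CS _ _ Li ni sm2.
pose Df (x : E) : R[i] := ((s - t)^-1%:C * (explicit_solution s x - explicit_solution t x))%C.
have reD : re Df = Q 0 s by apply/funext => x; rewrite /re /Df /Q /=; ring.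
have imD : im Df = Q (0 - pi / 2) s by apply/funext => x; rewrite /im /Df /Q /=; ring.
have inD : in_L2 Df by apply/in_L2P; rewrite reD imD; split; exact: LQ.
rewrite (_ : (fun x => _) = Df); last by [].
rewrite (L2dotE inD invv) reD imD.
rewrite (energy_gradient_cprof N0 sE Hu heq Lwu Lwg a0 Hr Hi).
have eE c w : L2 w -> dot (err c s) w = dot (Q c s) w - dot (vel u g c a) w.
  by move=> Lw; rewrite dotBl//; exact: LQ.
apply: (le_trans (normc_le_add _)) => /=.
set X := (X in `|X| + _); set Y := (Y in _ + `|Y|).
have -> : X = - dot (err (0 - pi / 2) s) (re v) + dot (err 0 s) (im v).
  by rewrite /X !eE//; ring.
have -> : Y = dot (err 0 s) (re v) + dot (err (0 - pi / 2) s) (im v).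
  by rewrite /Y !eE//; ring.
have T1 := ler_normD (- dot (err (0 - pi / 2) s) (re v)) (dot (err 0 s) (im v)).
have T2 := ler_normD (dot (err 0 s) (re v)) (dot (err (0 - pi / 2) s) (im v)).
rewrite normrN in T1.
have -> : eps * H1norm v = eps / 4 * H1norm v + eps / 4 * H1norm v + (eps / 4 * H1norm v + eps / 4 * H1norm v) by field.
by rewrite lerD// ?(le_trans T1)// ?(le_trans T2)// lerD.
Qed.

Lemma phi_blow_up : (exists j, 0 < dot (g j) (g j)) -> H1norm (explicit_solution t) @[t --> 1^'-] --> +oo.
Proof.
move=> [j gj]; apply/cvgryPge => A.
pose c := Num.sqrt (dot (g j) (g j)); have c0 : 0 < c by rewrite sqrtr_gt0.
have B0 : 0 < `|A| + 1 by rewrite ltr_pwDr.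
pose d := Num.min 1 (c / (`|A| + 1)).
have d0 : 0 < d by rewrite /d lt_min ltr01 divr_gt0.
near=> t.
have t1 : t < 1 by near: t; exact: nbhs_left_lt.
have td : 1 - d < t by near: t; apply: nbhs_left_gt; rewrite ltrBlDr ltrDl.
have dd1 : d <= 1 by rewrite /d ge_min lexx.
have dd2 : d <= c / (`|A| + 1) by rewrite /d ge_min lexx orbT.
have t01 : 0 <= t < 1 by rewrite t1 andbT; lra.
apply: le_trans (H1norm_cprof_ge Hu Lwu j (rtime_gt0 t01)).
apply: (le_trans (ler_norm A)); rewrite -/c mulrC ler_pdivlMr ?subr_gt0//.
have h : 1 - t <= c / (`|A| + 1) by lra.
apply: (@le_trans _ _ (`|A| * (c / (`|A| + 1)))); first by rewrite ler_wpM2l.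
rewrite mulrCA ler_piMr ?(ltW c0)// ler_pdivrMr// mul1r; lra.
Unshelve. all: by end_near. Qed.

End strong.

Theorem corollary2 (R : realType) (N : nat) (b sigma : R) (psi : 'rV[R]_N -> R)
    (hN : (1 <= N)%N) (hb0 : 0 < b) (hb : b < Num.min 2 N%:R)
    (hsigma : sigma = (2 - b) / N%:R)
    (hpsi : is_ground_state b sigma psi) :
  exists (T : R) (phi : R -> 'rV[R]_N -> R[i]),
    [/\ 0 < T,
        strong_solution b sigma T phi,
        forall t, t \in `[0, T[ -> L2norm (phi t) = L2norm (of_real psi) &
        H1norm (phi t) @[t --> T^'-] --> +oo].
Proof.
have [g [Hg heq]] := ground_state_real hpsi.
have [_ pos rad _] := hpsi.
have s0 : 0 <= sigma.
  rewrite hsigma divr_ge0// subr_ge0 ltW//.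
  by move: hb; rewrite lt_min => /andP[].
have [Lwu Lwg] := weighted_L2 Hg hN hb0 s0 rad heq.
exists 1, (explicit_solution psi); split.
- exact: ltr01.
- exact: phi_strong Lwg.
- by move=> t; rewrite in_itv/= => t01; exact: (L2norm_cprof Hg Lwu (rtime_gt0 t01)).
apply: (phi_blow_up Hg Lwu).
apply: contrapT => nE.
have [Lu Hgj] := Hg.
have g0 j : {ae @lebesgue_rV R N, forall x, g j x = 0}.
  have [Lj _] := Hgj j; apply: (sq_eq0 (lebesgue_rV N) Lj.1).1; rewrite sqE//; congr EFin.
  apply/eqP; rewrite eq_le dot_ge0 andbT leNgt; apply/negP => h.
  by apply: nE; exists j.
have u0 := gradient_eq0 hN Lu (fun j => (Hgj j).1) (fun j => (Hgj j).2) g0.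
have F : {ae @lebesgue_rV R N, forall x, False}.
  by move: pos u0; apply: filterS2 => x + x0; rewrite x0 ltxx.
by have [x [_ []]] := ae_slab_box F.
Qed.
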